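(* Let $p\in[1,+\infty)$. Suppose that the vector field $\mathbf v:[0,T]\times\Omega\times\mathbb R^d\to\mathbb R^d$ is Carathéodory and complies with the sublinearity estimate $$|\mathbf v(t,\omega,x)|\le m(t)(1+|x|)$$ for $\mathcal L^1\times\pi$-almost every $(t,\omega)\in[0,T]\times\Omega$ and all $x\in\mathbb R^d$, where $m(\cdot)\in L^1([0,T],\mathbb R_+)$ is given. Then for every pair $(\tau,\boldsymbol\mu^\tau)\in[0,T]\times\mathcal P_{\pi,p}(\Omega\times\mathbb R^d)$, the Cauchy problem $$\partial_t\boldsymbol\mu(t)+\mathrm{div}_x(\mathbf v(t)\boldsymbol\mu(t))=0,\qquad\boldsymbol\mu(\tau)=\boldsymbol\mu^\tau,$$ admits a forward solution $\boldsymbol\mu(\cdot)\in\mathrm{AC}([\tau,T],\mathcal P_{\pi,p}(\Omega\times\mathbb R^d))$.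
   Context: $\Omega$ is a Polish space, $\pi$ a probability measure on $\Omega$, and $(\Omega,\mathcal A,\pi)$ the corresponding complete probability space. $T>0$. $\mathcal P_\pi(\Omega\times\mathbb R^d)$ is the set of Borel probability measures with first marginal $\pi$, each with Borel disintegration $\boldsymbol\mu=\int_\Omega\mu_\omega\,d\pi(\omega)$. $\mathcal P_{\pi,p}(\Omega\times\mathbb R^d)$ is the subset with $\int_\Omega\int_{\mathbb R^d}|x|^p\,d\mu_\omega\,d\pi(\omega)<+\infty$, endowed with $W_{\pi,p}(\boldsymbol\mu,\boldsymbol\nu):=(\int_\Omega W_p^p(\mu_\omega,\nu_\omega)\,d\pi(\omega))^{1/p}$. $\mathrm{AC}$ denotes absolutely continuous curves in this metric space. $\mathbf v$ is Carathéodory if it is $\mathcal L^1\times\pi$-measurable in $(t,\omega)$ for all $x$ and continuous in $x$ for $\mathcal L^1\times\pi$-a.e. $(t,\omega)$. A (forward) solution satisfies $\boldsymbol\mu(\tau)=\boldsymbol\mu^\tau$ and $\int_\tau^T\int_{\Omega\times\mathbb R^d}(\partial_t\phi+\langle\nabla_x\phi,\mathbf v\rangle)\,d\boldsymbol\mu(t)\,dt=0$ for every $\phi\in C^0_b([\tau,T]\times\Omega\times\mathbb R^d,\mathbb R)$ such that $\phi(\cdot,\omega,\cdot)\in C^1_c((\tau,T)\times\mathbb R^d)$ for all $\omega$ and $\sup_\omega\|\phi(\cdot,\omega,\cdot)\|_{C^1}<+\infty$. *)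

(* Defs.v *)
From HB Require Import structures.
From mathcomp Require Import all_boot all_order all_algebra.
From mathcomp Require Import all_classical all_reals all_analysis.
From mathcomp Require Import measurable_realfun.

Set Implicit Arguments.
Unset Strict Implicit.
Unset Printing Implicit Defensive.
Import Order.TTheory GRing.Theory Num.Theory.
Import numFieldNormedType.Exports.

Local Open Scope classical_set_scope.
Local Open Scope ring_scope.

Notation borel X := (g_sigma_algebraType (@open X)).

(* The sigma-algebra generated by the sets A `|` N, with A measurable and N
   mu-negligible, i.e. the completion of the sigma-algebra with respect to mu.
   Needed because the library's lebesgue_measure and product measures live on
   the uncompleted sigma-algebras. *)
Notation completed mu := (g_sigma_algebraType (completed_algebra_gen mu)).

Section polish.
Variables (R : realType) (X : topologicalType).

Definition is_metric (dist : X -> X -> R) :=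
  [/\ forall x y, 0 <= dist x y,
      forall x y, dist x y = 0 <-> x = y,
      forall x y, dist x y = dist y x &
      forall x y z, dist x z <= dist x y + dist y z].

Definition metrizes (dist : X -> X -> R) :=
  forall (x : X) (A : set X),
    nbhs x A <-> exists2 e : R, 0 < e & [set y | dist x y < e] `<=` A.

Definition complete_metric (dist : X -> X -> R) :=
  forall u : nat -> X,
    (forall e : R, 0 < e ->
       exists N : nat, forall i j : nat, (N <= i)%N -> (N <= j)%N ->
         dist (u i) (u j) < e) ->
    exists l : X, u @ \oo --> l.

Definition polish :=
  (exists2 D : set X, countable D & dense D) /\
  (exists dist : X -> X -> R,
     [/\ is_metric dist, metrizes dist & complete_metric dist]).

End polish.

Section euclidean.
Variables (R : realType) (d : nat).

Definition dotr (x y : 'rV[R]_d) : R := \sum_(i < d) x ord0 i * y ord0 i.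

(* The library's norm on 'rV[R]_d is the sup norm. *)
Definition enorm (x : 'rV[R]_d) : R := Num.sqrt (dotr x x).

Definition grad (f : 'rV[R]_d -> R) (x : 'rV[R]_d) : 'rV[R]_d :=
  \row_(i < d) 'D_(delta_mx ord0 i) f x.

End euclidean.

Section wasserstein.
Variables (R : realType) (d : nat).
Local Open Scope ereal_scope.

Definition coupling (mu nu : set (borel 'rV[R]_d) -> \bar R)
    (gamma : probability (borel ('rV[R]_d * 'rV[R]_d)%type) R) :=
  forall A : set (borel 'rV[R]_d), measurable A ->
    gamma (fst @^-1` A) = mu A /\ gamma (snd @^-1` A) = nu A.

Definition wasserstein (p : R) (mu nu : set (borel 'rV[R]_d) -> \bar R) :
    \bar R :=
  (ereal_inf [set \int[gamma]_z ((enorm (z.1 - z.2) `^ p)%:E)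
             | gamma in coupling mu nu]) `^ p^-1.

End wasserstein.

Section fibered.
Variables (R : realType) (Om : ptopologicalType) (d : nat).
Variable pi : probability (borel Om) R.
Local Open Scope ereal_scope.

Let E := borel (Om * 'rV[R]_d)%type.

Definition P_pi (mu : probability E R) :=
  forall A : set (borel Om), measurable A -> mu (fst @^-1` A) = pi A.

Definition disintegrates (mu : probability E R)
    (k : R.-pker (borel Om) ~> (borel 'rV[R]_d)) :=
  forall A : set E, measurable A -> mu A = \int[pi]_w k w (xsection A w).

(* A chosen Borel disintegration of mu; it exists (and is unique pi-a.e.) for
   every mu in P_pi by the disintegration theorem, so the default kernel is
   irrelevant. *)
Definition disint (mu : probability E R) :
    R.-pker (borel Om) ~> (borel 'rV[R]_d) :=
  if pselect (exists k, disintegrates mu k) is left h then sval (cid h)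
  else kdirac (@measurable_cst _ _ (borel Om) (borel 'rV[R]_d) setT
                 (0%R : 'rV[R]_d)).

Definition P_pi_p (p : R) (mu : probability E R) :=
  P_pi mu /\ \int[pi]_w \int[disint mu w]_x ((enorm x `^ p)%:E) < +oo.

Definition W_pi_p (p : R) (mu nu : probability E R) : \bar R :=
  (\int[pi]_w (wasserstein p (disint mu w) (disint nu w) `^ p)) `^ p^-1.

Definition AC_curve (p a b : R) (mu : R -> probability E R) :=
  (forall t, t \in `[a, b] -> P_pi_p p (mu t)) /\
  exists g : R -> R,
    [/\ lebesgue_measure.-integrable `[a, b] (EFin \o g),
        forall t, t \in `[a, b] -> (0 <= g t)%R &
        forall s t : R, (a <= s)%R -> (s <= t)%R -> (t <= b)%R ->
          W_pi_p p (mu s) (mu t) <=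
            \int[lebesgue_measure]_(r in `[s, t]) (g r)%:E].

End fibered.

Section continuity_equation.
Variables (R : realType) (Om : ptopologicalType) (d : nat).

Definition C1_on (U : set (R * 'rV[R]_d)) (f : R * 'rV[R]_d -> R) :=
  forall z, U z ->
    differentiable f z /\ forall h, {for z, continuous (fun y => 'd f y h)}.

Definition C1c_on (U : set (R * 'rV[R]_d)) (f : R * 'rV[R]_d -> R) :=
  let S := closure (U `&` [set z | f z != 0]) in
  [/\ C1_on U f, compact S & S `<=` U].

Definition test_function (a b : R) (phi : R -> Om -> 'rV[R]_d -> R) :=
  [/\ {within [set z : R * Om * 'rV[R]_d | z.1.1 \in `[a, b]],
        continuous (fun z => phi z.1.1 z.1.2 z.2)},
      exists M : R, forall t w x, t \in `[a, b] -> `|phi t w x| <= M,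
      forall w, C1c_on [set z | z.1 \in `]a, b[] (fun z => phi z.1 w z.2) &
      exists M : R, forall t w x, t \in `]a, b[ ->
        `|phi t w x| + `|derive1 (fun s => phi s w x) t| + enorm (grad (phi t w) x)
          <= M].

Variable pi : probability (borel Om) R.

Definition caratheodory (T : R) (v : R -> Om -> 'rV[R]_d -> 'rV[R]_d) :=
  let mu := (lebesgue_measure \x pi)%E in
  (forall x : 'rV[R]_d,
     measurable_fun ([set z | z.1 \in `[0, T]] : set (completed mu))
       ((fun z => v z.1 z.2 x) : completed mu -> borel 'rV[R]_d)) /\
  (\forall z \ae mu, z.1 \in `[0, T] -> continuous (v z.1 z.2)).

Definition sublinear (T : R) (v : R -> Om -> 'rV[R]_d -> 'rV[R]_d)
    (m : R -> R) :=
  \forall z \ae (lebesgue_measure \x pi)%E, z.1 \in `[0, T] ->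
    forall x : 'rV[R]_d, enorm (v z.1 z.2 x) <= m z.1 * (1 + enorm x).

(* The integrand need only be measurable for the completion of mu t. The
   library integral of a nonnegative function is a supremum over measurable
   simple functions below it, so it agrees there with the integral for the
   completed measure. *)
Definition forward_solution (tau T : R) (v : R -> Om -> 'rV[R]_d -> 'rV[R]_d)
    (mu0 : probability (borel (Om * 'rV[R]_d)%type) R)
    (mu : R -> probability (borel (Om * 'rV[R]_d)%type) R) :=
  (forall A : set (borel (Om * 'rV[R]_d)%type),
     measurable A -> mu tau A = mu0 A) /\
  forall phi, test_function tau T phi ->
    (\int[lebesgue_measure]_(t in `[tau, T])
       \int[mu t]_z
         (derive1 (fun s => phi s z.1 z.2) t +
          dotr (grad (phi t z.1) z.2) (v t z.1 z.2))%:E)%E = 0%E.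

End continuity_equation.

(* Main.v *)
(* The measure mu0 is the law of (w, F0 (w, u)), where w has law pi and u is an
   independent uniform variable: F0 (w, .) is a conditional quantile function,
   read through a Borel encoding of R^d in R. For each (w, u), the equation
   y' = v (t, w, y), y (tau) = F0 (w, u), has Caratheodory solutions, and one can
   be chosen measurably in (t, w, u): the Tonelli iterates with delay h are
   explicit integrals, hence measurable, and Gronwall makes them
   equicontinuous, so that a subsequence converging at all rational times can
   be selected by countably many measurable tests. Call gamma (t, (w, u)) this
   solution; mu t is the law of (w, gamma (t, (w, u))). Using the same u at the
   times s and t couples the fibres, which gives absolute continuity; the weak
   formulation is the chain rule along each trajectory, integrated by Fubini.
   Since v is only measurable for the completed measure, it is first replaced
   by 0 on a null set of (t, w). *)
Require Import Defs.
From HB Require Import structures.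
From mathcomp Require Import all_boot all_order all_algebra.
From mathcomp Require Import all_classical all_reals all_analysis.
From mathcomp Require Import measurable_realfun ring lra.
Set Implicit Arguments.
Unset Strict Implicit.
Unset Printing Implicit Defensive.
Import Order.TTheory GRing.Theory Num.Theory.
Import numFieldNormedType.Exports.
Local Open Scope classical_set_scope.
Local Open Scope ring_scope.

(** * Borel sets of second-countable spaces *)

(** Continuity in [x] alone gives no uniqueness of trajectories, so a convergent subsequence of
    approximations depends on [(w, u)] and its choice must be measurable. The uniform noise also
    stands in for the disintegration theorem: the laws of the maps sending [u] to [F (w, u)] form an
    explicit disintegration of the law of [(w, F (w, u))], so [disint] can be identified with it off
    a null set of [w]. Two integrands are not known to be measurable: the Wasserstein distance of
    the fibres as a function of [w], and the weak integrand built from the original [v]. They are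
    compared with measurable ones off a null set, directly from the definition of the integral as a
    supremum over simple functions. The regularized field vanishes at times outside []tau, T]], so
    trajectories live on the whole line and all primitives can start at [-oo]. Sigma-algebras on
    products are Borel in the statement but product ones in Fubini's theorem; second countability
    reconciles them. *)

Lemma bigcup_countable_measurable d (T : measurableType d) I (D : set I)
    (F : I -> set T) :
  countable D -> (forall i, D i -> measurable (F i)) ->
  measurable (\bigcup_(i in D) F i).
Proof.
move=> /pfcard_geP[->|[f]] mF; first by rewrite bigcup_set0.
have -> : \bigcup_(i in D) F i = \bigcup_k F (f k).
  apply/seteqP; split => [x [i Di Fi]|x [k _ Fk]].
    have [k _ fk] := @surj _ _ _ _ f i Di.
    by exists k => //; rewrite fk.
  by exists (f k) => //; exact: funS.
by apply: bigcup_measurable => k _; apply: mF; exact: funS.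
Qed.

Lemma measurable_fun_g_sigma d (T : measurableType d) (X : pointedType)
    (G : set (set X)) (f : T -> X) :
  (forall V, G V -> measurable (f @^-1` V)) ->
  measurable_fun setT (f : T -> g_sigma_algebraType G).
Proof.
move=> mf.
apply: (@measurability _ _ T (g_sigma_algebraType G) setT f G erefl) => A.
by move=> [V GV <-]; rewrite setTI; exact: mf.
Qed.

(** By second countability an open set of the product is a countable union of basic rectangles. *)
Lemma measurable_fun_borel_pair d (T : measurableType d) (X Y : ptopologicalType)
    (f : T -> X) (g : T -> Y) :
  @second_countable X -> @second_countable Y ->
  measurable_fun setT (f : T -> borel X) -> measurable_fun setT (g : T -> borel Y) ->
  measurable_fun setT ((fun t => (f t, g t)) : T -> borel (X * Y)%type).
Proof.
move=> [B cB bB] [C cC bC] mf mg.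
apply: measurable_fun_g_sigma => V oV.
have -> : (fun t => (f t, g t)) @^-1` V =
    \bigcup_(UV in [set UV | (B `*` C) UV /\ UV.1 `*` UV.2 `<=` V])
      (f @^-1` UV.1 `&` g @^-1` UV.2).
  apply/seteqP; split => [t /= Vft|t [UV [_ UVO] [/= Ut Vt]]]; last exact: UVO.
  have : nbhs (f t, g t) V by exact: open_nbhs_nbhs.
  case=> -[P Q] /= [nP nQ] PQ.
  have [U [BU Uf] UP] := bB.2 _ _ nP.
  have [W [CV Vg] VQ] := bC.2 _ _ nQ.
  exists (U, W) => //; split => //= -[x y] /= [Ux Vy].
  by apply: PQ; split => /=; [exact: UP|exact: VQ].
apply: bigcup_countable_measurable => [|[U W] /= [[BU CW] _]].
  apply: (@sub_countable _ _ _ (B `*` C)); last exact: countableX.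
  by apply: subset_card_le => UV [].
apply: measurableI; rewrite -[_ @^-1` _]setTI; [apply: mf|apply: mg] => //.
- by apply: sub_sigma_algebra; exact: bB.1.
- by apply: sub_sigma_algebra; exact: bC.1.
Qed.

Lemma measurable_fst_borel (X Y : ptopologicalType) :
  measurable_fun setT (fst : borel (X * Y)%type -> borel X).
Proof.
apply: measurable_fun_g_sigma => V oV; apply: sub_sigma_algebra.
by apply: open_comp => // x _; exact: cvg_fst.
Qed.

Lemma measurable_snd_borel (X Y : ptopologicalType) :
  measurable_fun setT (snd : borel (X * Y)%type -> borel Y).
Proof.
apply: measurable_fun_g_sigma => V oV; apply: sub_sigma_algebra.
by apply: open_comp => // x _; exact: cvg_snd.
Qed.

Section polish_second_countable.
Variables (R : realType) (X : topologicalType).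

Lemma polish_second_countable : polish R X -> @second_countable X.
Proof.
move=> [[D cD dD] [dist [[d0 dxx dC dT] dm _]]].
pose b (xr : X * rat) : set X := [set y | dist xr.1 y < ratr xr.2].
have bo x r : open (b (x, r)).
  rewrite openE => y /= xy.
  apply/dm; exists (ratr r - dist x y); first by rewrite subr_gt0.
  move=> z /= yz; rewrite /b/=; apply: le_lt_trans (dT x y z) _.
  by rewrite addrC -ltrBrDr.
exists (b @` (D `*` setT)).
  by apply: (sub_countable (card_image_le _ _)); apply: countableX => //; exact: countableP.
split => [_ [[x r] _ <-] //|x A /dm [e e0 eA]].
(* A centre [y] of [D] within [r] of [x] gives an [r]-ball that contains [x] and, as [2 r < e],
   stays inside the [e]-ball around [x]. *)
have [r [r0 re]] : exists r : rat, 0 < ratr r :> R /\ ratr r < e / 2.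
  have /rat_in_itvoo [r] : 0 < e / 2 by rewrite divr_gt0.
  by rewrite in_itv/= => /andP[? ?]; exists r.
have xb : [set y | dist x y < ratr r] x by rewrite /= (dxx x x).2.
have ox : open (b (x, r)) by [].
have [y [/= xy Dy]] := dD _ (ex_intro _ x xb) ox.
exists (b (y, r)).
  split; first by exists (y, r).
  by rewrite /b/= dC.
move=> z /= yz; apply: eA => /=.
apply: le_lt_trans (dT x y z) _.
by rewrite (splitr e) ltrD// ?(lt_trans xy)// (lt_trans yz).
Qed.

End polish_second_countable.

Section rV_borel.
Variables (R : realType) (n : nat).

Definition ratbox (ab : 'rV[rat]_n * 'rV[rat]_n) : set 'rV[R]_n :=
  [set x | forall i, ratr (ab.1 ord0 i) < x ord0 i < ratr (ab.2 ord0 i)].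

Lemma open_ratbox ab : open (ratbox ab).
Proof.
rewrite openE => x /= xab.
exists (fun i j => `]ratr (ab.1 ord0 j), ratr (ab.2 ord0 j)[%classic).
  move=> i j; rewrite (ord1 i); apply: open_nbhs_nbhs; split => //=.
  by rewrite in_itv/=.
by move=> y yab i; have := yab ord0 i; rewrite /= in_itv.
Qed.

Lemma ratbox_basis : basis (ratbox @` setT).
Proof.
split => [_ [ab _ <-]|x A]; first exact: open_ratbox.
move=> [P xP PA].
have rx i : exists ab : rat * rat, [set y : R | ratr ab.1 < y < ratr ab.2] (x ord0 i) /\
    [set y : R | ratr ab.1 < y < ratr ab.2] `<=` P ord0 i.
  have /nbhs_ballP[e /= e0 eP] := xP ord0 i.
  have /rat_in_itvoo [a] : x ord0 i - e < x ord0 i by lra.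
  have /rat_in_itvoo [b] : x ord0 i < x ord0 i + e by lra.
  rewrite !in_itv/= => /andP[xb bx] /andP[xa ax]; exists (a, b) => /=.
  rewrite xb ax; split => // y /= /andP[ay yb]; apply: eP.
  by rewrite /ball/= ltr_distlC; apply/andP; split; lra.
pose ab i := sval (cid (rx i)).
exists (ratbox (\row_i (ab i).1, \row_i (ab i).2)).
  split; first by eexists.
  by move=> i; rewrite !mxE /ab; case: cid => -[a b] [].
move=> y yab; apply: PA => i j; rewrite (ord1 i).
have := yab j; rewrite !mxE /= /ab; case: cid => -[a b] /= [_ +] yj.
exact.
Qed.

Lemma second_countable_rV : @second_countable 'rV[R]_n.
Proof.
exists (ratbox @` setT); last exact: ratbox_basis.
by apply: (sub_countable (card_image_le _ _)); exact: countableP.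
Qed.

Lemma measurable_coord i :
  measurable_fun setT ((fun x => x ord0 i) : borel 'rV[R]_n -> R).
Proof.
apply: (measurability _ (RGenOpens.measurableE R)).
move=> _ [_ [a [b ->]] <-]; rewrite setTI.
apply: sub_sigma_algebra; apply: open_comp; last exact: interval_open.
by move=> ? _; exact: coord_continuous.
Qed.

Lemma measurable_fun_borel_rV d (T : measurableType d) (f : T -> 'rV[R]_n) :
  measurable_fun setT (f : T -> borel 'rV[R]_n) <->
  forall i, measurable_fun setT (fun t => f t ord0 i).
Proof.
split => [mf i|mf].
  exact: (measurableT_comp (measurable_coord i) mf).
apply: measurable_fun_g_sigma => V oV.
have -> : V = \bigcup_(ab in [set ab | ratbox ab `<=` V]) ratbox ab.
  apply/seteqP; split => [x Vx|x [ab abO abx]]; last exact: abO.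
  have [_ [[ab _ <-] abx] abO] := ratbox_basis.2 _ _ (open_nbhs_nbhs (conj oV Vx)).
  by exists ab.
rewrite preimage_bigcup; apply: bigcup_countable_measurable; first exact: countableP.
move=> ab _.
have -> : f @^-1` ratbox ab = \bigcap_i
   ((fun t => f t ord0 i) @^-1` `]ratr (ab.1 ord0 i), ratr (ab.2 ord0 i)[%classic).
  by apply/seteqP; split => [t h i _ /=|t h i];
    [rewrite in_itv/=|have := h i I; rewrite /= in_itv/=].
apply: fin_bigcap_measurable => // i _; rewrite -[_ @^-1` _]setTI.
by apply: mf => //; exact: measurable_itv.
Qed.

End rV_borel.

(** * Integrals of functions that need not be measurable *)

Section integral_nonmeasurable.
Local Open Scope ereal_scope.
Context d (T : measurableType d) (R : realType) (mu : {measure set T -> \bar R}).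
Implicit Types f g : T -> \bar R.

Import HBNNSimple.

(* No measurability of the integrands: the integral is a supremum over simple
   functions, and a simple function may be cut off on the null set. *)
Lemma ge0_le_integral_off_null (N : set T) f g :
  measurable N -> mu N = 0 -> (forall x, 0 <= f x) -> (forall x, 0 <= g x) ->
  (forall x, ~ N x -> f x <= g x) -> \int[mu]_x f x <= \int[mu]_x g x.
Proof.
move=> mN N0 f0 g0 fg; rewrite [leLHS]ge0_integralTE// [leRHS]ge0_integralTE//.
apply: ge_ereal_sup => _ [h /= hf <-].
pose h' := proj_nnsfun h (measurableC mN).
apply: ereal_sup_ubound; exists h' => /=.
  move=> x; rewrite /h' /= mindicE.
  have [xN|xN] := boolP (x \in ~` N); last by rewrite mulr0.
  by rewrite mulr1 (le_trans (hf x))// fg//; rewrite inE in xN.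
rewrite -!integralT_nnsfun; apply: ge0_ae_eq_integral => //.
- by apply/measurable_EFinP.
- by apply/measurable_EFinP.
- by move=> x _; rewrite lee_fin.
- by move=> x _; rewrite lee_fin.
exists N; split => // x; apply: contra_notP => xN _ /=.
by rewrite mindicE mem_set// mulr1.
Qed.

(** Positive and negative parts reduce this to the preceding comparison. It serves to replace an
    integrand built from the original field, or from the chosen disintegration, by an explicit
    measurable one. *)
Lemma integral_off_null (D N : set T) f g :
  measurable N -> mu N = 0 ->
  (forall x, D x -> ~ N x -> f x = g x) ->
  \int[mu]_(x in D) f x = \int[mu]_(x in D) g x.
Proof.
move=> mN N0 fg; rewrite !(integral_mkcond D).
have {}fg x : ~ N x -> (f \_ D) x = (g \_ D) x.
  by move=> Nx; rewrite /patch; case: ifPn => // /set_mem Dx; exact: fg.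
rewrite integralE [RHS]integralE; congr (_ - _); apply/eqP; rewrite eq_le.
  by apply/andP; split; apply: (ge0_le_integral_off_null mN N0) => // x Nx;
    rewrite !funeposE fg.
by apply/andP; split; apply: (ge0_le_integral_off_null mN N0) => // x Nx;
  rewrite !funenegE fg.
Qed.

End integral_nonmeasurable.

(** * Primitives of integrable functions and the chain rule *)

Lemma diff_dist_le (R : realType) (V W : normedModType R) (f : V -> W) (x : V) :
  differentiable f x -> forall e : R, 0 < e ->
  \forall z \near x, `|f z - f x - 'd f x (z - x)| <= e * `|z - x|.
Proof.
move=> /diff_locally df e e0.
have /eqaddoP/(_ e e0) h : f \o shift x = cst (f x) + 'd f x +o_ (0:V) id by [].
have {}h : \forall y \near (0 : V), `|f (y + x) - (f x + 'd f x y)| <= e * `|y| := h.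
rewrite (near_shift 0 x); apply: filterS h => y /=.
by rewrite /= !subr0 addrK opprD addrA.
Qed.

Section integrable_EFin.
Context d (T : measurableType d) (R : realType) (mu : {measure set T -> \bar R}).
Context (D : set T) (mD : measurable D).
Implicit Types (f g : T -> R) (k : R).

Lemma integrable_EFinD f g : mu.-integrable D (EFin \o f) ->
  mu.-integrable D (EFin \o g) -> mu.-integrable D (EFin \o (fun x => f x + g x)).
Proof.
move=> intf intg; apply: (eq_integrable mD ((EFin \o f) \+ (EFin \o g))%E) => //.
exact: integrableD.
Qed.

Lemma integrable_EFinB f g : mu.-integrable D (EFin \o f) ->
  mu.-integrable D (EFin \o g) -> mu.-integrable D (EFin \o (fun x => f x - g x)).
Proof.
move=> intf intg; apply: (eq_integrable mD ((EFin \o f) \- (EFin \o g))%E) => //.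
exact: integrableB.
Qed.

Lemma integrable_EFinZl k f : mu.-integrable D (EFin \o f) ->
  mu.-integrable D (EFin \o (fun x => k * f x)).
Proof.
move=> intf; apply: (eq_integrable mD (fun x => k%:E * (EFin \o f) x)%E) => //.
exact: integrableZl.
Qed.

Lemma integrable_EFinZr k f : mu.-integrable D (EFin \o f) ->
  mu.-integrable D (EFin \o (fun x => f x * k)).
Proof.
move=> intf; rewrite (_ : (fun x => f x * k) = (fun x => k * f x)).
  exact: integrable_EFinZl.
by apply/funext => x; rewrite mulrC.
Qed.

Lemma le_integrable_EFin f g : measurable_fun D f ->
  (forall x, D x -> `|f x| <= g x) ->
  mu.-integrable D (EFin \o g) -> mu.-integrable D (EFin \o f).
Proof.
move=> mf fg; apply: le_integrable => //; first exact/measurable_EFinP.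
by move=> x Dx /=; rewrite lee_fin (le_trans (fg x Dx))// ler_norm.
Qed.

End integrable_EFin.

Section indefinite_integral.
Variable R : realType.
Notation leb := (@lebesgue_measure R).
Implicit Types f g : R -> R.

Fact primitive_key : unit. Proof. by []. Qed.

(* Locked, so that unification never unfolds the Lebesgue integral. *)
Definition primitive f (t : R) : R :=
  locked_with primitive_key (\int[leb]_(r in `]-oo, t]) f r).

Lemma primitiveE f t : primitive f t = \int[leb]_(r in `]-oo, t]) f r.
Proof. by rewrite /primitive unlock. Qed.

Lemma lebesgue_itvoc (s t : R) : s <= t -> leb `]s, t] = (t - s)%:E.
Proof.
move=> st; rewrite lebesgue_measure_itv/= lte_fin.
move: st; rewrite le_eqVlt => /predU1P[->|->]; first by rewrite ltxx subrr.
by rewrite EFinB.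
Qed.

Lemma primitiveB f s t : leb.-integrable setT (EFin \o f) -> s <= t ->
  primitive f t - primitive f s = \int[leb]_(r in `]s, t]) f r.
Proof.
move=> intf st; rewrite !primitiveE (@Rintegral_itvB _ _ -oo%O (BRight t))//.
by apply: integrableS intf.
Qed.

Lemma primitive_continuous f : leb.-integrable setT (EFin \o f) ->
  continuous (primitive f).
Proof.
move=> intf t; apply/cvgrPdist_lt => e e0.
have [d [d0 dP]] := integral_normr_continuous intf e0.
have key s u : s <= u -> u - s < d -> `|primitive f u - primitive f s| < e.
  move=> su usd; rewrite primitiveB//.
  apply: le_lt_trans (dP `]s, u]%classic _ _) => //.
    by apply: le_normr_Rintegral => //; exact: integrableS intf.
  by rewrite /= lebesgue_itvoc// lte_fin.
apply/nbhs_ballP; exists d => //= u; rewrite /ball/= => tu.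
have [ut|ut] := leP u t.
  by apply: key => //; rewrite ger0_norm// subr_ge0 in tu.
rewrite distrC; apply: key; first exact: ltW.
by rewrite distrC ger0_norm// in tu; rewrite subr_ge0 ltW.
Qed.

Lemma primitive_nondecreasing f : leb.-integrable setT (EFin \o f) ->
  (forall r, 0 <= f r) -> {homo primitive f : s t / s <= t}.
Proof.
move=> intf f0 s t st; rewrite -subr_ge0 primitiveB//.
exact: Rintegral_ge0.
Qed.

Lemma primitive_dist_le f g s t : leb.-integrable setT (EFin \o f) ->
  leb.-integrable setT (EFin \o g) -> s <= t ->
  (forall r, s < r -> r <= t -> `|f r| <= g r) ->
  `|primitive f t - primitive f s| <= primitive g t - primitive g s.
Proof.
move=> intf intg st fg; rewrite !primitiveB//.
have intfst : leb.-integrable `]s, t] (EFin \o f) by exact: integrableS intf.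
apply: le_trans (le_normr_Rintegral _ intfst) _ => //.
apply: le_Rintegral => //.
- exact: integrable_norm.
- exact: integrableS intg.
- by move=> r /=; rewrite in_itv/= => /andP[sr rt]; exact: fg.
Qed.

(** A mean value inequality in which the nondecreasing [A] plays the role of time. It replaces
    almost everywhere differentiation: increments of [h] that are locally, to the right, [o] of
    those of [A] add up to nothing. *)
Lemma local_to_global (h A : R -> R) (a b : R) : a <= b ->
  continuous h -> continuous A -> {homo A : s t / s <= t} ->
  (forall t0 e, a <= t0 -> t0 < b -> 0 < e -> exists2 d, 0 < d &
     forall t, t0 < t -> t < t0 + d -> t <= b ->
       `|h t - h t0| <= e * (A t - A t0)) ->
  h b = h a.
Proof.
move=> ab ch cA ndA loc.
have key e : 0 < e -> `|h b - h a| <= e * (A b - A a).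
  move=> e0; pose g t := e * (A t - A a) - `|h t - h a|.
  have cg : continuous g.
    move=> t; apply: cvgB.
      by apply: cvgMr; apply: cvgB; [exact: cA|exact: cvg_cst].
    by apply: cvg_norm; apply: cvgB; [exact: ch|exact: cvg_cst].
  pose S := [set t | a <= t <= b /\ 0 <= g t].
  have Sa : S a by rewrite /S/= lexx ab /g !subrr mulr0 normr0.
  have hS : has_sup S by split; [exists a|exists b => t [/andP[]]].
  (* [S] contains its supremum by continuity; if [s < b], the local estimate at [s] would produce a
     later element of [S]. *)
  set s := sup S.
  have as_ : a <= s by apply: ub_le_sup => //; case: hS.
  have sb : s <= b by apply: ge_sup; [case: hS|move=> t [/andP[]]].
  have gs : 0 <= g s.
    rewrite leNgt; apply/negP => gs.
    have /nbhs_ballP[d /= d0 dP] : \forall t \near s, g t < 0.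
      by have /cvgr_lt := cg s; apply.
    have [t St st] := sup_adherent d0 hS; have [_ gt] := St.
    have ts : t <= s by apply: ub_le_sup => //; case: hS.
    have := dP t; rewrite /ball/= ger0_norm ?subr_ge0// -/s.
    rewrite -/s in st.
    by move=> /(_ ltac:(lra)); rewrite ltNge gt.
  suff -> : b = s by rewrite -subr_ge0.
  apply/eqP; rewrite eq_le sb andbT leNgt; apply/negP => sltb.
  have [d d0 dP] := loc s e as_ sltb e0.
  pose t := Num.min b (s + d / 2).
  have st : s < t by rewrite /t lt_min sltb/= ltrDl divr_gt0.
  have tb : t <= b by rewrite /t ge_min lexx.
  have tsd : t < s + d by rewrite /t gt_min ltrD2l gtr_pMr// orbC; apply/orP; left; lra.
  have := dP t st tsd tb.
  have : S t.
    split; first by rewrite tb andbT (le_trans as_)// ltW.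
    rewrite /g subr_ge0; apply: le_trans (ler_distD (h s) _ _) _.
    have -> : e * (A t - A a) = e * (A t - A s) + e * (A s - A a) by ring.
    by apply: lerD; [exact: dP|rewrite -subr_ge0].
  move=> St _; have : t <= s by apply: ub_le_sup => //; case: hS.
  by rewrite leNgt st.
apply/eqP; rewrite -subr_eq0 -normr_le0; apply/ler_addgt0Pr => e e0; rewrite add0r.
have C0 : 0 <= A b - A a by rewrite subr_ge0; exact: ndA.
(* The added 1 keeps the denominator positive when [A b = A a]. *)
apply: le_trans (key (e / (A b - A a + 1)) _) _.
  by rewrite divr_gt0// ltr_wpDl.
rewrite mulrAC -mulrA ler_piMr//; first exact: ltW.
by rewrite ler_pdivrMr ?mul1r ?lerDl// ltr_wpDl.
Qed.


Lemma Rintegral_sum d (T : measurableType d) (mu : {measure set T -> \bar R})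
    (D : set T) I (s : seq I) (f : I -> T -> R) :
  measurable D -> (forall i, mu.-integrable D (EFin \o f i)) ->
  mu.-integrable D (EFin \o (fun x => \sum_(i <- s) f i x)) /\
  \int[mu]_(x in D) (\sum_(i <- s) f i x) = \sum_(i <- s) \int[mu]_(x in D) f i x.
Proof.
move=> mD intf; elim: s => [|i s [ints IH]].
  split.
    apply: (eq_integrable mD (cst 0%E)); last exact: integrable0.
    by move=> x _ /=; rewrite big_nil.
  rewrite big_nil /Rintegral integral0_eq// => x _; rewrite big_nil//.
split.
  rewrite (_ : (fun x => _) = (fun x => f i x + \sum_(i <- s) f i x)).
    exact: integrable_EFinD.
  by apply/funext => x; rewrite big_cons.
rewrite big_cons -IH -RintegralD//; apply: eq_Rintegral => x _.
by rewrite big_cons.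
Qed.

Lemma mx_norm_le n (x : 'rV[R]_n) (e : R) :
  0 <= e -> (forall i, `|x ord0 i| <= e) -> `|x| <= e.
Proof.
move=> e0 xe; rewrite /Num.norm/= mx_normrE; apply: bigmax_le => // -[i j] _ /=.
by rewrite (ord1 i).
Qed.

Lemma le_mx_norm n (x : 'rV[R]_n) i : `|x ord0 i| <= `|x|.
Proof.
rewrite [leRHS]/Num.norm/= mx_normrE.
exact: (le_bigmax _ (fun ij : 'I_1 * 'I_n => `|x ij.1 ij.2|) (ord0, i)).
Qed.

Lemma continuous_rV (T : topologicalType) n (f : T -> 'rV[R]_n) :
  (forall i, continuous (fun t => f t ord0 i)) -> continuous f.
Proof.
move=> cf t A [P ftP PA]; apply: filterS (fun s => PA (f s)) _.
apply: filter_forall => i; apply: filter_forall => j.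
by rewrite (ord1 i); apply: (cf j t); move: (ftP i j); rewrite (ord1 i).
Qed.

(** The curve is never differentiated: [local_to_global] is applied to [Psi \o c \- primitive g].
    Near [t0] its increment consists of the first order remainder of [Psi] and of the error made by
    freezing the partial derivatives at [c t0]. *)
Lemma chain_rule_ac n (Psi : R * 'rV[R]_n -> R) (p0 : R * 'rV[R]_n -> R)
    (p : 'I_n -> R * 'rV[R]_n -> R) (x0 : 'rV[R]_n) (beta : R -> 'rV[R]_n)
    (mu g : R -> R) (a b : R) (c := fun t =>
      (t, x0 + \row_i primitive (fun r => beta r ord0 i) t)) :
  a <= b -> (forall z, differentiable Psi z) ->
  (forall z s y, 'd Psi z (s, y) = s * p0 z + \sum_i y ord0 i * p i z) ->
  continuous p0 -> (forall i, continuous (p i)) ->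
  leb.-integrable setT (EFin \o mu) ->
  (forall i, leb.-integrable setT (EFin \o (fun r => beta r ord0 i))) ->
  leb.-integrable setT (EFin \o g) ->
  (forall r, `|beta r| <= mu r) ->
  (forall r, a < r -> r <= b ->
     g r = p0 (c r) + \sum_i beta r ord0 i * p i (c r)) ->
  primitive g b - primitive g a = Psi (c b) - Psi (c a).
Proof.
move=> ab dPsi dPsiE cp0 cp intmu intbeta intg betamu gE.
have mu0 r : 0 <= mu r by rewrite (le_trans _ (betamu r)).
have cc : continuous c.
  move=> t; apply: (@cvg_pair _ _ _ (nbhs t) (nbhs t) (nbhs _)) => /=; first exact: cvg_id.
  apply: cvgD; first exact: cvg_cst.
  apply: continuous_rV => i; rewrite (_ : (fun _ => _) =
    primitive (fun r => beta r ord0 i)); last by apply/funext => s; rewrite mxE.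
  exact: primitive_continuous.
have cPsi : continuous (Psi \o c).
  by move=> t; apply: continuous_comp; [exact: cc|exact: differentiable_continuous].
(* Increments of [A] bound those of both components of [c]. *)
pose A t := t + primitive mu t.
have cA : continuous A.
  by move=> t; apply: cvgD => //; exact: primitive_continuous.
have ndA : {homo A : s t / s <= t}.
  by move=> s t st; apply: lerD => //; exact: primitive_nondecreasing.
suff : (Psi \o c \- primitive g) b = (Psi \o c \- primitive g) a.
  by rewrite /=; lra.
apply: (local_to_global (A := A)) => //.
  by move=> t; apply: cvgB; [exact: cPsi|exact: primitive_continuous].
move=> t0 e' at0 t0b e'0; set z0 := c t0.
(* With [dt] and [dM] the increments of time and of [primitive mu], the remainder costs
   [e (dt + dM)] and freezing costs [e dt + e n dM]; [n.+2] times [e (dt + dM)] covers the sum. *)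
pose e := e' / (n.+2)%:R.
have e0 : 0 < e by rewrite divr_gt0.
have cdist t : t0 <= t -> `|c t - z0| <= A t - A t0.
  move=> t0t; rewrite /Num.norm/= ge_max; apply/andP; split.
    rewrite /= ger0_norm ?subr_ge0// /A.
    by have := primitive_nondecreasing intmu mu0 t0t; lra.
  have b0 : 0 <= A t - A t0 by rewrite subr_ge0; exact: ndA.
  apply: mx_norm_le => // i; rewrite !mxE.
  have := @primitive_dist_le _ mu t0 t (intbeta i) intmu t0t _.
  rewrite /A; set X := primitive _ t; set Y := primitive _ t0.
  have -> : x0 ord0 i + X - (x0 ord0 i + Y) = X - Y by ring.
  move=> /(_ (fun r _ _ => le_trans (le_mx_norm _ _) (betamu r))); lra.
have near1 : \forall z \near z0, `|Psi z - Psi z0 - 'd Psi z0 (z - z0)| <= e * `|z - z0|.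
  exact: diff_dist_le.
have near2 : \forall z \near z0, `|p0 z0 - p0 z| <= e.
  by have /cvgrPdist_le := cp0 z0; exact.
have near3 : \forall z \near z0, forall i, `|p i z0 - p i z| <= e.
  apply: (@filter_forall _ _ (fun i z => `|p i z0 - p i z| <= e) _ (nbhs_filter z0)) => i.
  by have /cvgrPdist_le := cp i z0; exact.
pose G := [set z | [/\ `|Psi z - Psi z0 - 'd Psi z0 (z - z0)| <= e * `|z - z0|,
   `|p0 z0 - p0 z| <= e & forall i, `|p i z0 - p i z| <= e]].
have nG : nbhs z0 G.
  have hF := nbhs_filter z0.
  by apply: filterS3 near1 near2 near3 => z ? ? ?; split.
have /nbhs_ballP[d /= d0 dP] : nbhs t0 (c @^-1` G) := cc t0 G nG.
exists d => // t t0t td tb.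
have st : t0 <= t by exact: ltW.
have Gc r : t0 < r -> r <= t -> G (c r).
  by move=> t0r rt; apply: dP; rewrite /ball/= ltr_distlC; apply/andP; split; lra.
have [q1 _ _] := Gc t t0t (lexx t).
pose D : set (measurableTypeR R) := `]t0, t]%classic.
have mD : measurable D by exact: measurable_itv.
have int1 (k : R) : leb.-integrable D (EFin \o cst k).
  apply: measurable_bounded_integrable => //.
    by rewrite [X in (X < _)%E]lebesgue_itvoc// ltry.
  exact: bounded_cst.
(* [g] with the partial derivatives frozen at [z0]: by linearity its integral is the differential at
   [z0] applied to the increment of the curve. *)
pose k r := p0 z0 + \sum_i beta r ord0 i * p i z0.
have intbD i : leb.-integrable D (EFin \o (fun r => beta r ord0 i)).
  exact: integrableS (intbeta i).
have intbi i : leb.-integrable D (EFin \o (fun r => beta r ord0 i * p i z0)).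
  exact: integrable_EFinZr.
have [ints intsE] := Rintegral_sum (index_enum 'I_n) mD intbi.
have intk : leb.-integrable D (EFin \o k).
  exact: (integrable_EFinD mD (int1 (p0 z0)) ints).
have intgD : leb.-integrable D (EFin \o g) by exact: integrableS intg.
have intmuD : leb.-integrable D (EFin \o mu) by exact: integrableS intmu.
have q2 : 'd Psi z0 (c t - z0) = \int[leb]_(r in D) k r.
  have -> : c t - z0 = (t - t0, \row_i (\int[leb]_(r in D) beta r ord0 i)).
    congr pair; apply/rowP => i; rewrite !mxE -primitiveB//.
    by rewrite opprD addrACA subrr add0r.
  rewrite dPsiE RintegralD//; last exact: (int1 (p0 z0)).
  rewrite Rintegral_cst// [X in fine X]lebesgue_itvoc//= mulrC; congr (_ + _).
  rewrite intsE; apply: eq_bigr => i _; rewrite mxE RintegralZr//.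
have q3 : primitive g t - primitive g t0 = \int[leb]_(r in D) g r.
  by rewrite primitiveB.
pose k2 r := e + e * n%:R * mu r.
have intk2' : leb.-integrable D (EFin \o (fun r => e * n%:R * mu r)).
  exact: integrable_EFinZl.
have intk2 : leb.-integrable D (EFin \o k2).
  exact: (integrable_EFinD mD (int1 e) intk2').
have q4 : `|\int[leb]_(r in D) k r - \int[leb]_(r in D) g r| <=
    e * (t - t0) + e * n%:R * (primitive mu t - primitive mu t0).
  rewrite -RintegralB//; apply: le_trans (le_normr_Rintegral _ _) _ => //.
    exact: integrable_EFinB.
  have -> : e * (t - t0) + e * n%:R * (primitive mu t - primitive mu t0) =
      \int[leb]_(r in D) k2 r.
    rewrite primitiveB// RintegralD//; last exact: (int1 e).
    rewrite Rintegral_cst// [X in fine X]lebesgue_itvoc//=; congr (_ + _).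
    by rewrite RintegralZl.
  apply: le_Rintegral => //.
    exact: (integrable_norm (integrable_EFinB mD intk intgD)).
  move=> r; rewrite /D/= in_itv/= => /andP[t0r rt].
  have [_ r1 r2] := Gc r t0r rt.
  rewrite gE ?(le_lt_trans at0)// ?(le_trans rt)// /k opprD addrACA -sumrB.
  apply: le_trans (ler_normD _ _) _; apply: lerD => //.
  apply: le_trans (ler_norm_sum _ _ _) _.
  have -> : e * n%:R * mu r = \sum_(i < n) mu r * e.
    by rewrite sumr_const card_ord -mulr_natr; ring.
  apply: ler_sum => i _; rewrite -mulrBr normrM; apply: ler_pM => //.
  exact: le_trans (le_mx_norm _ _) (betamu r).
have -> : (Psi \o c \- primitive g) t - (Psi \o c \- primitive g) t0 =
   (Psi (c t) - Psi z0 - 'd Psi z0 (c t - z0)) +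
   (\int[leb]_(r in D) k r - \int[leb]_(r in D) g r).
  by rewrite -q3 q2 /= /z0; ring.
apply: le_trans (ler_normD _ _) _.
apply: le_trans (lerD (le_trans q1 (ler_wpM2l (ltW e0) (cdist t st))) q4) _.
have -> : e' = e * (n.+2)%:R by rewrite /e divfK.
have d1 : 0 <= t - t0 by rewrite subr_ge0.
have d2 : 0 <= primitive mu t - primitive mu t0.
  by rewrite subr_ge0; exact: primitive_nondecreasing.
have := mulr_ge0 (ltW e0) d1; have := mulr_ge0 (ltW e0) d2.
have := mulr_ge0 (mulr_ge0 (ltW e0) (ler0n R n)) d1.
rewrite /A -[n.+2]addn2 natrD.
set X := primitive mu t; set Y := primitive mu t0; lra.
Qed.

End indefinite_integral.

(** * Measurable selection of subsequences *)

Section measurable_subsequence.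
Context d (Z : measurableType d) (b : nat -> nat -> set Z).
Hypothesis mb : forall k n, measurable (b k n).

Let often (A : nat -> set Z) (B : nat -> set Z) : set Z :=
  [set z | forall N, exists n, [/\ (N <= n)%N, A n z & B n z]].

Let measurable_often A B : (forall n, measurable (A n)) ->
  (forall n, measurable (B n)) -> measurable (often A B).
Proof.
move=> mA mB; rewrite (_ : often A B =
    \bigcap_N \bigcup_(n in [set n | (N <= n)%N]) (A n `&` B n)).
  apply: bigcapT_measurable => N; apply: bigcup_measurable => n _.
  exact: measurableI.
apply/seteqP; split => [z h N _|z h N].
  by have [n [Nn An Bn]] := h N; exists n.
by have [n /= Nn [An Bn]] := h N I; exists n.
Qed.

(* The k-th test is imposed on the indices which passed the previous ones when
   infinitely many of them satisfy it, and its negation otherwise. *)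
Fixpoint refine k : nat -> set Z := if k is j.+1 then fun n =>
    refine j n `&` ((b j n `&` often (refine j) (b j)) `|`
                    (~` b j n `&` ~` often (refine j) (b j)))
  else fun=> setT.

Let measurable_refine k n : measurable (refine k n).
Proof.
elim: k n => [|k IH] n; first exact: measurableT.
have mo : measurable (often (refine k) (b k)) by exact: measurable_often.
apply: measurableI => //; apply: measurableU; apply: measurableI => //.
  exact: measurableC.
exact: measurableC.
Qed.

Let refine_infinite k z N : exists n, (N <= n)%N /\ refine k n z.
Proof.
elim: k N => [|k IH] N; first by exists N.
have [h|h] := pselect (often (refine k) (b k) z).
  by have [n [Nn rn bn]] := h N; exists n; split => //; split => //; left.
have [M hM] : exists M, forall n, (M <= n)%N -> refine k n z -> ~ b k n z.
  move/existsNP : h => [M hM]; exists M => n Mn rn bn; apply: hM.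
  by exists n.
have [n [Nn rn]] := IH (maxn N M); rewrite geq_max in Nn.
have [Nn1 Nn2] := andP Nn.
by exists n; split => //; split => //; right; split => //; exact: hM.
Qed.

(** [s k z] is the least index from [k] on that survives the first [k] refinements, so test [j] has
    a constant answer once [k > j]. Taking the least index makes the choice measurable. Strict
    monotonicity is not asked for: [k <= s k z] already forces the indices to infinity. *)
Lemma measurable_subsequence : exists s : nat -> Z -> nat,
  [/\ forall k n, measurable [set z | s k z = n],
      forall k z, (k <= s k z)%N &
      forall j z, (forall k, (j < k)%N -> b j (s k z) z) \/
                  (forall k, (j < k)%N -> ~ b j (s k z) z)].
Proof.
have exP k z : exists n, (k <= n)%N && `[< refine k n z >].
  by have [n [kn rn]] := refine_infinite k z k; exists n; rewrite kn; exact/asboolP.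
pose s k z := ex_minn (exP k z).
have sP k z : [/\ (k <= s k z)%N, refine k (s k z) z &
    forall n, (k <= n)%N -> refine k n z -> (s k z <= n)%N].
  rewrite /s; case: ex_minnP => n /andP[kn /asboolP rn] nmin; split => // i ki ri.
  by apply: nmin; rewrite ki; exact/asboolP.
exists s; split => [k n|k z|j z]; last 2 first.
- by have [] := sP k z.
- have key k : (j < k)%N -> forall n z', refine k n z' -> refine j.+1 n z'.
    elim: k => // k IH; rewrite ltnS leq_eqVlt => /predU1P[->//|jk] n z' [].
    by move=> + _; exact: IH.
  have [h|h] := pselect (often (refine j) (b j) z); [left|right] => k jk;
    have [_ /(key _ jk) [_ [[]|[]]] //] := sP k z.
have [kn|kn] := leqP k n; last first.
  rewrite (_ : [set z | _] = set0) // -subset0 => z /= szn.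
  by have [+ _ _] := sP k z; rewrite szn leqNgt kn.
rewrite (_ : [set z | _] = refine k n `&`
    \bigcap_(i in [set i | (k <= i < n)%N]) ~` refine k i); last first.
  apply/seteqP; split => [z /= szn|z [rn h]].
    have [_ + m] := sP k z; rewrite szn => rn; split => // i /= /andP[ki iN] ri.
    by have := m i ki ri; rewrite szn leqNgt iN.
  have [k1 k2 k3] := sP k z; apply/eqP; rewrite eqn_leq k3//= leqNgt.
  by apply/negP => lt; apply: (h (s k z)) => //=; rewrite k1.
apply: measurableI => //; apply: bigcap_measurableType => i _.
exact: measurableC.
Qed.

End measurable_subsequence.

(** The limit is the supremum of the eventual lower bounds. A rational just above it cannot be an
    eventual lower bound and one just below it cannot eventually exceed [u], so the tests at these
    rationals squeeze the sequence. *)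
Lemma cvg_of_rat_tests (R : realType) (u : R^nat) (C : R) :
  (forall k, `|u k| <= C) ->
  (forall q : rat, (\forall k \near \oo, u k < ratr q) \/
                   (\forall k \near \oo, ratr q <= u k)) -> cvgn u.
Proof.
move=> uC tests.
pose S := [set x | \forall k \near \oo, x <= u k].
have S0 : S (- C).
  by apply: nearW => k; have := uC k; rewrite ler_norml => /andP[].
have SC : ubound S C.
  move=> x [N _ xN]; apply: le_trans (xN N _) _ => //=.
  by have := uC N; rewrite ler_norml => /andP[].
have hS : has_sup S by split; [exists (- C)|exists C].
have ubS x : S x -> x <= sup S by move=> Sx; apply: ub_le_sup => //; case: hS.
apply/cvg_ex; exists (sup S); apply/cvgrPdist_lt => e e0.
have [q1] := @rat_in_itvoo _ (sup S) (sup S + e) ltac:(lra).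
have [q2] := @rat_in_itvoo _ (sup S - e) (sup S) ltac:(lra).
rewrite !in_itv/= => /andP[q21 q22] /andP[q11 q12].
have h1 : \forall k \near \oo, u k < ratr q1.
  by have [//|/ubS] := tests q1; lra.
have h2 : \forall k \near \oo, ratr q2 <= u k.
  have [h|//] := tests q2.
  have : sup S <= ratr q2; last by lra.
  apply: ge_sup; first by exists (- C).
  move=> x Sx; have [k [uk xk]] := filter_ex (filterI h Sx).
  by apply: (le_trans xk); exact: ltW.
near=> k; rewrite ltr_distlC.
have k1 : u k < ratr q1 by near: k.
have k2 : ratr q2 <= u k by near: k.
by apply/andP; split; lra.
Unshelve. all: by end_near. Qed.

(** * Measurability of parameter integrals and of Caratheodory compositions *)

Section caratheodory_composition.
Context (R : realType) d (S : measurableType d).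

Lemma measurable_Rintegral_parameter (G : S * measurableTypeR R -> R) :
  measurable_fun setT G ->
  measurable_fun setT (fun s => \int[@lebesgue_measure R]_r G (s, r)).
Proof.
move=> mG; rewrite /Rintegral; apply: measurableT_comp => //.
rewrite (_ : (fun _ => _) = (fun s =>
   \int[lebesgue_measure]_r (EFin \o G)^\+ (s, r) -
   \int[lebesgue_measure]_r (EFin \o G)^\- (s, r)))%E; last first.
  apply/funext => s; rewrite integralE; congr (_ - _)%E; apply: eq_integral => r _.
    by rewrite !funeposE.
  by rewrite !funenegE.
have mEG : measurable_fun setT (EFin \o G) by exact/measurable_EFinP.
apply: emeasurable_funB.
  apply: (@measurable_fun_fubini_tonelli_F _ _ _ _ _ lebesgue_measure (EFin \o G)^\+%E) => //.
  exact: measurable_funepos.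
apply: (@measurable_fun_fubini_tonelli_F _ _ _ _ _ lebesgue_measure (EFin \o G)^\-%E) => //.
exact: measurable_funeneg.
Qed.

Lemma measurable_fun_countable_index (K : countType) (key : S -> K)
    (f : S -> K -> R) :
  (forall k, measurable (key @^-1` [set k])) ->
  (forall k, measurable_fun setT (f^~ k)) ->
  measurable_fun setT (fun s => f s (key s)).
Proof.
move=> mkey mf _ Y mY; rewrite setTI.
rewrite (_ : _ @^-1` Y =
    \bigcup_(k in [set: K]) (key @^-1` [set k] `&` (f^~ k) @^-1` Y)).
  apply: bigcup_countable_measurable; first exact: countableP.
  by move=> k _; apply: measurableI => //; rewrite -[_ @^-1` _]setTI; exact: mf.
by apply/seteqP; split => [s Ys|s [k _ [/= <-]]//]; exists (key s).
Qed.

Variable n : nat.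

(** Rounding [X] down to the grid of mesh [1/(k+1)] leaves countably many values, each treated by
    measurability in [s]; continuity in [x] gives the pointwise limit. *)
Lemma measurable_fun_caratheodory (f : S -> 'rV[R]_n -> R) (X : S -> 'rV[R]_n) :
  (forall x, measurable_fun setT (f^~ x)) -> (forall s, continuous (f s)) ->
  (forall i, measurable_fun setT (fun s => X s ord0 i)) ->
  measurable_fun setT (fun s => f s (X s)).
Proof.
move=> mf cf mX.
pose key k s : 'rV[int]_n := \row_i Num.floor (X s ord0 i * (k.+1)%:R).
pose val k (a : 'rV[int]_n) : 'rV[R]_n := \row_i ((a ord0 i)%:~R / (k.+1)%:R).
apply: (@measurable_fun_cvg _ _ _ _ (fun k s => f s (val k (key k s)))).
  move=> k; apply: (measurable_fun_countable_index (key := key k)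
    (f := fun s a => f s (val k a))) => [a|a]; last exact: mf.
  rewrite (_ : _ @^-1` _ = \bigcap_i ((fun s => X s ord0 i * (k.+1)%:R) @^-1`
     `[(a ord0 i)%:~R, (a ord0 i + 1)%:~R[%classic)).
    apply: fin_bigcap_measurable => // i _; rewrite -[_ @^-1` _]setTI.
    by apply: measurable_funM => //; exact: measurable_itv.
  apply/seteqP; split => [s /= <- i _ /=|s h].
    by rewrite in_itv/= mxE ge_floor floorD1_gt.
  apply/rowP => i; rewrite mxE; apply/eqP; rewrite floor_eq.
  by have := h i I; rewrite /= in_itv.
move=> s _; apply: (continuous_cvg _ (cf s (X s))).
apply/cvgrPdist_le => e e0.
near=> k.
have ke : (k.+1%:R)^-1 <= e.
  by near: k; have := near_infty_natSinv_lt (PosNum e0); apply: filterS => k /ltW.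
apply: mx_norm_le => [|i]; first exact: ltW.
rewrite !mxE; set x := X s ord0 i.
have k0 : 0 < k.+1%:R :> R by rewrite ltr0n.
have -> : x - (Num.floor (x * k.+1%:R))%:~R / k.+1%:R =
   (x * k.+1%:R - (Num.floor (x * k.+1%:R))%:~R) / k.+1%:R.
  by rewrite mulrBl mulfK// gt_eqF.
rewrite normrM [`|_^-1|]ger0_norm ?invr_ge0//.
apply: le_trans ke; rewrite ler_piMl// ?invr_ge0 ?(ltW k0)//.
have := ge_floor (x * k.+1%:R); have := floorD1_gt (x * k.+1%:R).
rewrite intrD; set y := x * _ => h1 h2.
by rewrite ger0_norm ?subr_ge0//; lra.
Unshelve. all: by end_near. Qed.

End caratheodory_composition.

(** * Gronwall estimates *)

Lemma cvg_of_uniform_approx (R : realType) (u : R^nat) :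
  (forall e : R, 0 < e -> exists2 v : R^nat, cvgn v & forall k, `|u k - v k| <= e) ->
  cvgn u.
Proof.
move=> uv; apply/cauchy_cvgP; apply: cauchy_exP => e e0.
have [v /cvg_ex[l vl] uvk] := uv (e / 2) ltac:(lra).
exists l; rewrite /= nbhs_filterE/=.
have : \forall k \near \oo, `|l - v k| < e / 2.
  by move/cvgrPdist_lt : vl; apply; lra.
apply: filterS => k lv; rewrite /ball/=.
apply: le_lt_trans (ler_distD (v k) _ _) _.
by rewrite distrC in lv *; have := uvk k; rewrite [`|v k - u k|]distrC distrC in lv *; lra.
Qed.

Lemma Rintegral_dominated_cvg d (T : measurableType d) (R : realType)
    (mu : {measure set T -> \bar R}) (D : set T) (f_ : nat -> T -> R) (f g : T -> R) :
  measurable D -> (forall k, measurable_fun D (f_ k)) ->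
  (forall x, D x -> f_ ^~ x @ \oo --> f x) ->
  mu.-integrable D (EFin \o g) -> (forall k x, D x -> `|f_ k x| <= g x) ->
  mu.-integrable D (EFin \o f) /\
  \int[mu]_(x in D) f_ k x @[k --> \oo] --> \int[mu]_(x in D) f x.
Proof.
move=> mD mf_ cf ig fg.
have mf : measurable_fun D f by exact: measurable_fun_cvg mf_ cf.
have [] := @dominated_convergence _ _ _ mu D mD (fun k => EFin \o f_ k) (EFin \o f)
  (EFin \o g).
- by move=> k; exact/measurable_EFinP.
- exact/measurable_EFinP.
- by apply: aeW => x Dx; apply: cvg_EFin; [exact: nearW|exact: cf].
- by [].
- by apply: aeW => x k Dx; rewrite lee_fin; exact: fg.
move=> intf _ h; split => //.
by apply: fine_cvg; rewrite fineK//; exact: integrable_fin_num.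
Qed.

(** Convexity of the exponential, obtained from [1 + x <= expR x] at [y - x] and at [x - y]. *)
Lemma expR_secant (R : realType) (x y : R) :
  expR x * (y - x) <= expR y - expR x <= expR y * (y - x).
Proof.
have := ler_wpM2l (expR_ge0 x) (expR_ge1Dx (y - x)).
have := ler_wpM2l (expR_ge0 y) (expR_ge1Dx (x - y)).
rewrite -!expRD !subrKC; move: (expR x) (expR y) => ex ey h1 h2.
by apply/andP; split; lra.
Qed.

Section primitive_bounds.
Context (R : realType).
Notation leb := (@lebesgue_measure R).
Implicit Types f m : R -> R.

Lemma measurable_primitive d (S : measurableType d)
    (f : S * measurableTypeR R -> R) (t : S -> R) :
  measurable_fun setT f -> measurable_fun setT t ->
  measurable_fun setT (fun s => primitive (fun r => f (s, r)) (t s)).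
Proof.
move=> mf mt.
pose G (p : S * measurableTypeR R) := if p.2 <= t p.1 then f p else 0.
rewrite (_ : (fun _ => _) = (fun s => \int[leb]_r G (s, r))).
  apply: measurable_Rintegral_parameter; apply: measurable_fun_ifT => //.
  apply: measurable_fun_ler; first exact: measurable_snd.
  exact: (measurableT_comp mt measurable_fst).
apply/funext => s; rewrite primitiveE Rintegral_mkcond; apply: eq_Rintegral => r _.
by rewrite /patch mem_setE in_itv /G.
Qed.

Lemma eq_primitive f g t : (forall r, r <= t -> f r = g r) ->
  primitive f t = primitive g t.
Proof.
move=> fg; rewrite !primitiveE; apply: eq_Rintegral => r; rewrite inE/= in_itv/= => rt.
exact: fg.
Qed.

Lemma primitive0 t : primitive (fun=> 0) t = 0 :> R.
Proof. by rewrite primitiveE /Rintegral integral0. Qed.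

Variables (m : R -> R) (a b : R).
Hypotheses (intm : leb.-integrable setT (EFin \o m)) (m0 : forall t, 0 <= m t).
Hypothesis msupp : forall t, ~~ (a < t <= b) -> m t = 0.

Lemma primitive_before t : t <= a -> primitive m t = 0.
Proof.
move=> ta; rewrite -(primitive0 t); apply: eq_primitive => r rt.
apply: msupp; apply/negP => /andP[ar _].
by have := lt_le_trans ar (le_trans rt ta); rewrite ltxx.
Qed.

Lemma primitive_ge0 t : 0 <= primitive m t.
Proof. by rewrite primitiveE; apply: Rintegral_ge0 => r _. Qed.

Lemma primitive_le_end t : primitive m t <= primitive m b.
Proof.
have [tb|/ltW bt] := leP t b; first exact: primitive_nondecreasing.
rewrite -subr_le0 primitiveB// /Rintegral integral0_eq//= => r.
rewrite in_itv/= => /andP[br _]; congr (_%:E); apply: msupp.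
by rewrite negb_and -!leNgt -ltNge br orbT.
Qed.

Lemma expR_primitive_cvg : continuous (expR \o primitive m).
Proof.
move=> t; apply: continuous_comp; first exact: primitive_continuous.
exact: continuous_expR.
Qed.

Lemma integrable_primitive_exp :
  leb.-integrable setT (EFin \o (fun r => m r * expR (primitive m r))).
Proof.
apply: (le_integrable_EFin _ _ _
  (integrable_EFinZl measurableT (expR (primitive m b)) intm)) => //.
- apply: measurable_funM; first by apply/measurable_EFinP; exact: (measurable_int leb intm).
  exact: (continuous_measurable_fun expR_primitive_cvg).
- move=> r _; rewrite ger0_norm ?mulr_ge0 ?expR_ge0// mulrC ler_wpM2r//.
  by rewrite ler_expR primitive_le_end.
Qed.

(** The antiderivative of [m exp M] for a merely integrable [m]. It makes the Gronwall bound
    [(1 + |x0|) exp M] reproduce itself exactly under integration. *)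
Lemma primitive_exp t :
  primitive (fun r => m r * expR (primitive m r)) t = expR (primitive m t) - 1.
Proof.
set P := primitive (fun r => _).
have Pa s : s <= a -> P s = expR (primitive m s) - 1.
  move=> sa; rewrite primitive_before// expR0 subrr -(primitive0 s).
  apply: eq_primitive => r rs; rewrite msupp ?mul0r//.
  apply/negP => /andP[ar _].
  by have := lt_le_trans ar (le_trans rs sa); rewrite ltxx.
have [/Pa//|at_] := leP t a.
suff : (expR \o primitive m \- P) t = (expR \o primitive m \- P) a.
  rewrite /= (Pa a)//; clear; move: (P t) (expR (primitive m t)) (expR (primitive m a)).
  by move=> x y z; lra.
apply: (local_to_global (A := primitive m)); first exact: ltW.
- move=> s; apply: cvgB; first exact: expR_primitive_cvg.
  by apply: primitive_continuous; exact: integrable_primitive_exp.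
- exact: primitive_continuous.
- exact: primitive_nondecreasing.
move=> t0 e at0 t0t e0.
have /cvgrPdist_le/(_ e e0)/nbhs_ballP[d /= d0 dP] := @expR_primitive_cvg t0.
exists d => // s t0s std _.
have ts : t0 <= s by exact: ltW.
have dM : 0 <= primitive m s - primitive m t0.
  by rewrite subr_ge0; exact: primitive_nondecreasing.
have /andP[x1 x2] := expR_secant (primitive m t0) (primitive m s).
have intmD : leb.-integrable (`]t0, s]%classic : set (measurableTypeR R)) (EFin \o m).
  exact: integrableS intm.
have intPD : leb.-integrable (`]t0, s]%classic : set (measurableTypeR R))
    (EFin \o (fun r => m r * expR (primitive m r))).
  exact: integrableS integrable_primitive_exp.
(* The increments of [P] and of [expR \o primitive m] both lie between the increment of
   [primitive m] multiplied by the exponentials at the two endpoints; by continuity these two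
   factors differ by at most [e]. *)
have y1 : expR (primitive m t0) * (primitive m s - primitive m t0) <= P s - P t0.
  rewrite /P !primitiveB//; last exact: integrable_primitive_exp.
  rewrite -RintegralZl//; apply: le_Rintegral => //.
    exact: integrable_EFinZl.
  move=> r; rewrite /= in_itv/= => /andP[t0r rs]; rewrite (mulrC (m r)) ler_wpM2r//.
  by rewrite ler_expR primitive_nondecreasing// ltW.
have y2 : P s - P t0 <= expR (primitive m s) * (primitive m s - primitive m t0).
  rewrite /P !primitiveB//; last exact: integrable_primitive_exp.
  rewrite -RintegralZl//; apply: le_Rintegral => //.
    exact: integrable_EFinZl.
  move=> r; rewrite /= in_itv/= => /andP[t0r rs]; rewrite (mulrC (m r)) ler_wpM2r//.
  by rewrite ler_expR primitive_nondecreasing.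
have : `|expR (primitive m t0) - expR (primitive m s)| <= e.
  by apply: dP; rewrite /ball/= ltr_distlC std andbT (lt_trans _ t0s)// ltrBlDr ltrDl.
rewrite /=; clear -x1 x2 y1 y2 dM.
move: (primitive m s) (primitive m t0) (P s) (P t0) (expR (primitive m s))
  (expR (primitive m t0)) x1 x2 y1 y2 dM.
move=> M1 M0 P1 P0 e1 e0 x1 x2 y1 y2 dM; rewrite ler_norml => /andP[z _].
have /(ler_wpM2r dM) w : e1 - e0 <= e by lra.
by rewrite ler_norml; apply/andP; split; lra.
Qed.

End primitive_bounds.

(** * Measurable flows of Caratheodory equations *)

Lemma gronwall_arith (R : realType) (u v w e e' : R) :
  (1 + v) * e <= (1 + v) * e' -> u <= v + w -> w <= (1 + v) * (e - 1) ->
  1 + u <= (1 + v) * e'.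
Proof. by move=> *; lra. Qed.

Lemma rowDE (R : realType) n (x y : 'rV[R]_n) i :
  (x + y) ord0 i = x ord0 i + y ord0 i.
Proof. by rewrite mxE. Qed.

Lemma rowBE (R : realType) n (x y : 'rV[R]_n) i :
  (x - y) ord0 i = x ord0 i - y ord0 i.
Proof. by rewrite !mxE. Qed.

Section ode.
Context (R : realType) (n : nat) d (Z : measurableType d).
Notation leb := (@lebesgue_measure R).
Notation TR := (measurableTypeR R).
Variables (a b : R) (m : R -> R) (B : R -> Z -> 'rV[R]_n -> 'rV[R]_n).
Variable x0 : Z -> 'rV[R]_n.
Hypothesis ab : a <= b.
Hypotheses (intm : leb.-integrable setT (EFin \o m)) (m0 : forall t, 0 <= m t).
Hypothesis msupp : forall t, ~~ (a < t <= b) -> m t = 0.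
Hypothesis mB : forall x i,
  measurable_fun setT (fun p : TR * Z => B p.1 p.2 x ord0 i).
Hypothesis cB : forall t z, continuous (B t z).
Hypothesis Bm : forall t z x, `|B t z x| <= m t * (1 + `|x|).
Hypothesis mx0 : forall i, measurable_fun setT (fun z => x0 z ord0 i).

Let M := primitive m.

Definition along (X : R -> Z -> 'rV[R]_n) z i : R -> R :=
  fun r => B r z (X r z) ord0 i.

(** The Picard operator: its fixed points solve the integral equation. The field vanishes up to time
    [a], so the primitive effectively starts there. *)
Definition evolve X t z : 'rV[R]_n := x0 z + \row_i primitive (along X z i) t.

Definition jointly_measurable (X : R -> Z -> 'rV[R]_n) :=
  forall i, measurable_fun setT (fun p : TR * Z => X p.1 p.2 ord0 i).

(** Gronwall's conclusion taken as an invariant of the iteration, instead of being derived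
    afterwards from an integral inequality. *)
Definition exp_bounded (X : R -> Z -> 'rV[R]_n) :=
  forall t z, 1 + `|X t z| <= (1 + `|x0 z|) * expR (M t).

Lemma measurable_along X i : jointly_measurable X ->
  measurable_fun setT (fun p : TR * Z => along X p.2 i p.1).
Proof.
move=> mX; apply: (measurable_fun_caratheodory
  (f := fun (p : TR * Z) x => B p.1 p.2 x ord0 i) (X := fun p => X p.1 p.2)) => //.
move=> p x.
apply: (@continuous_comp _ _ _ (B p.1 p.2) (fun y : 'rV[R]_n => y ord0 i)).
  exact: cB.
exact: coord_continuous.
Qed.

Lemma measurable_along1 X z i : jointly_measurable X ->
  measurable_fun setT (along X z i : TR -> R).
Proof.
move=> mX; exact: (measurableT_comp (measurable_along i mX) (pair2_measurable z)).
Qed.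

Let C z := (1 + `|x0 z|) * expR (M b).

Lemma exp_bounded_le X t z : exp_bounded X -> 1 + `|X t z| <= C z.
Proof.
move=> bX; apply: le_trans (bX t z) _; rewrite ler_wpM2l ?addr_ge0//.
by rewrite ler_expR; exact: (primitive_le_end intm m0 msupp).
Qed.

Lemma along_exp_le X z i r : exp_bounded X ->
  `|along X z i r| <= (1 + `|x0 z|) * (m r * expR (M r)).
Proof.
move=> bX; apply: le_trans (le_mx_norm _ _) _; apply: le_trans (Bm _ _ _) _.
by rewrite mulrCA ler_wpM2l.
Qed.

Lemma along_le X z i r : exp_bounded X -> `|along X z i r| <= C z * m r.
Proof.
move=> bX; apply: le_trans (le_mx_norm _ _) _; apply: le_trans (Bm _ _ _) _.
by rewrite (mulrC (C z)) ler_wpM2l// exp_bounded_le.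
Qed.

Lemma integrable_along X z i : jointly_measurable X -> exp_bounded X ->
  leb.-integrable setT (EFin \o along X z i).
Proof.
move=> mX bX; apply: (le_integrable_EFin _ _ _
  (integrable_EFinZl measurableT (C z) intm)) => //.
- exact: measurable_along1.
- by move=> r _; exact: along_le.
Qed.

Lemma jointly_measurable_evolve X h : jointly_measurable X ->
  jointly_measurable (fun t z => evolve X (t - h) z).
Proof.
move=> mX i; rewrite /evolve.
rewrite (_ : (fun p => _) = (fun p : TR * Z => x0 p.2 ord0 i +
    primitive (along X p.2 i) (p.1 - h))); last by apply/funext => p; rewrite !mxE.
apply: measurable_funD; first exact: (measurableT_comp (mx0 i) measurable_snd).
apply: (measurable_primitive
  (f := fun q : (TR * Z) * TR => along X q.1.2 i q.2)
  (t := fun p : TR * Z => p.1 - h)).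
  apply: (measurableT_comp (measurable_along i mX)
    (g := fun q : (TR * Z) * TR => (q.2, q.1.2))).
  apply: measurable_fun_pair; first exact: measurable_snd.
  exact: (measurableT_comp measurable_snd measurable_fst).
by apply: measurable_funB => //; exact: measurable_fst.
Qed.

Lemma evolve_dist_le X s t z : jointly_measurable X -> exp_bounded X -> s <= t ->
  `|evolve X t z - evolve X s z| <= C z * (M t - M s).
Proof.
move=> mX bX st; apply: mx_norm_le => [|i].
  rewrite mulr_ge0//; first by rewrite mulr_ge0 ?expR_ge0 ?addr_ge0.
  by rewrite subr_ge0; exact: primitive_nondecreasing.
rewrite !mxE opprD addrACA subrr add0r.
have intC := integrable_EFinZl measurableT (C z) intm.
apply: le_trans (primitive_dist_le (integrable_along z i mX bX) intC st _) _.
  by move=> r _ _; exact: along_le.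
rewrite !primitiveB// RintegralZl//; exact: integrableS intm.
Qed.

(** Along [X] the field is at most [(1 + |x0|) m exp M], whose primitive is
    [(1 + |x0|) (exp M - 1)]; a delay only lowers this, [M] being nondecreasing. *)
Lemma exp_bounded_evolve X h : 0 <= h -> jointly_measurable X -> exp_bounded X ->
  exp_bounded (fun t z => evolve X (t - h) z).
Proof.
move=> h0 mX bX t z; set s := t - h.
have Ms : M s <= M t by apply: primitive_nondecreasing => //; rewrite gerBl.
have : `|\row_i primitive (along X z i) s| <= (1 + `|x0 z|) * (expR (M s) - 1).
  apply: mx_norm_le => [|i].
    apply: mulr_ge0; first exact: addr_ge0.
    by rewrite subr_ge0 -[leLHS]expR0 ler_expR primitive_ge0.
  have intP := integrable_primitive_exp intm m0 msupp.
  have intC := integrable_EFinZl measurableT (1 + `|x0 z|) intP.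
  rewrite mxE -(primitive_exp intm m0 msupp).
  rewrite !primitiveE -RintegralZl//; last exact: integrableS intP.
  apply: le_trans (le_normr_Rintegral _ _) _ => //.
    by apply: integrableS (integrable_along z i mX bX).
  apply: le_Rintegral => //.
  - by apply: integrable_norm; apply: integrableS (integrable_along z i mX bX).
  - by apply: integrableS intC.
  - by move=> r _; exact: along_exp_le.
have := ler_normD (x0 z) (\row_i primitive (along X z i) s); rewrite -/(evolve X s z).
have : (1 + `|x0 z|) * expR (M s) <= (1 + `|x0 z|) * expR (M t).
  by rewrite ler_wpM2l ?addr_ge0// ler_expR.
move: `|evolve X s z| `|x0 z| `|\row_i _| (expR (M s)) (expR (M t)).
exact: gronwall_arith.
Qed.

(** Successive substitution in the delayed equation [X t = evolve X (t - h)]. No contraction is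
    involved: the delay makes each iteration settle one more time interval of length [h]. *)
Fixpoint tonelli h k : R -> Z -> 'rV[R]_n :=
  if k is j.+1 then fun t z => evolve (tonelli h j) (t - h) z else fun _ z => x0 z.

Lemma tonelli_jointly_measurable h k : jointly_measurable (tonelli h k).
Proof.
elim: k => [|k IH]; last exact: jointly_measurable_evolve.
by move=> i; exact: (measurableT_comp (mx0 i) measurable_snd).
Qed.

Lemma tonelli_exp_bounded h k : 0 <= h -> exp_bounded (tonelli h k).
Proof.
move=> h0; elim: k => [|k IH]; last first.
  by apply: exp_bounded_evolve => //; exact: tonelli_jointly_measurable.
move=> t z /=; rewrite ler_peMr ?addr_ge0// -expR0 ler_expR.
exact: primitive_ge0.
Qed.

Lemma along_before X z i r : r <= a -> along X z i r = 0.
Proof.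
move=> ra; apply/eqP; rewrite -normr_le0; apply: le_trans (le_mx_norm _ _) _.
apply: le_trans (Bm _ _ _) _; rewrite msupp ?mul0r//.
by rewrite negb_and -leNgt ra.
Qed.

(** The value at [t] uses only the values up to [t - h], which the previous iterate has already
    settled; the base case is the vanishing of the field up to [a]. Thus iterate [k] solves the
    delayed equation up to [a + k h]. *)
Lemma tonelli_stable h k t z : 0 < h -> t <= a + k%:R * h ->
  tonelli h k.+1 t z = tonelli h k t z.
Proof.
move=> h0; elim: k t => [|k IH] t tk.
  rewrite /= /evolve (_ : \row_i _ = 0) ?addr0//; apply/rowP => i; rewrite !mxE.
  rewrite -(primitive0 (t - h)); apply: eq_primitive => r rt; apply: along_before.
  by rewrite mul0r addr0 in tk; apply: le_trans rt (le_trans _ tk); rewrite gerBl ltW.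
rewrite [LHS]/= [RHS]/= /evolve; congr (_ + _); apply/rowP => i; rewrite !mxE.
apply: eq_primitive => r rt; rewrite /along -IH//.
apply: le_trans rt _; rewrite lerBlDr; apply: le_trans tk _.
by rewrite -addrA lerD2l -natr1 mulrDl mul1r.
Qed.

Let hk k : R := (k.+1%:R)^-1.
Let hk0 k : 0 < hk k. Proof. by rewrite /hk invr_gt0 ltr0n. Qed.
Let steps k : nat := Num.bound ((b - a) / hk k).
(* Delayed approximate solutions with step [hk k], run up to the time [b]. *)
Let gam k := tonelli (hk k) (steps k).
(** The undelayed integrals. At a fixed [z] they share the modulus of continuity [C z (M t - M s)],
    and up to time [b] each [gam k] is [eta k] read with delay [hk k]. *)
Let eta k t z := evolve (gam k) t z.

Let mgam k : jointly_measurable (gam k).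
Proof. exact: tonelli_jointly_measurable. Qed.

Let bgam k : exp_bounded (gam k).
Proof. by apply: tonelli_exp_bounded; exact: ltW. Qed.

Let gamE k t z : t <= b -> gam k t z = eta k (t - hk k) z.
Proof.
move=> tb; rewrite /gam -tonelli_stable//.
apply: le_trans tb _; rewrite -lerBlDl -ler_pdivrMr//.
apply: ltW; apply: archi_boundP; rewrite divr_ge0 ?subr_ge0// ltW//.
Qed.

Let meta k i : measurable_fun setT (fun p : TR * Z => eta k p.1 p.2 ord0 i).
Proof.
have := jointly_measurable_evolve 0 (mgam k) i.
by under eq_fun do rewrite subr0.
Qed.

Let beta_ k : exp_bounded (eta k).
Proof.
have := exp_bounded_evolve (lexx 0) (mgam k) (bgam k).
by move=> h t z; have := h t z; rewrite subr0.
Qed.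

Let Cge0 z : 0 <= C z.
Proof. by rewrite mulr_ge0 ?expR_ge0 ?addr_ge0. Qed.

(** Equicontinuity: a rational time slightly after [t] changes all the [eta] by at most [e] at
    once. *)
Let eta_sub z (sub : nat -> nat) (t : R) i :
  (forall q : rat, cvgn (fun k => eta (sub k) (ratr q) z ord0 i)) ->
  cvgn (fun k => eta (sub k) t z ord0 i).
Proof.
move=> cq; apply: cvg_of_uniform_approx => e e0.
have cM : continuous M by exact: primitive_continuous.
have C1 : 0 < C z + 1 by rewrite ltr_wpDl.
have /cvgrPdist_le/(_ (e / (C z + 1)))/(_ (divr_gt0 e0 C1)) := cM t.
move=> /nbhs_ballP[del /= del0 delP].
have [q] := @rat_in_itvoo _ t (t + del) ltac:(by rewrite ltrDl).
rewrite in_itv/= => /andP[tq qd].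
exists (fun k => eta (sub k) (ratr q) z ord0 i) => // k.
have Mtq : `|M t - M (ratr q)| <= e / (C z + 1).
  by apply: delP; rewrite /ball/= ltr_distlC qd andbT (lt_trans _ tq)// ltrBlDr ltrDl.
have := evolve_dist_le z (mgam (sub k)) (bgam (sub k)) (ltW tq).
rewrite distrC => h.
have : `|(evolve (gam (sub k)) t z - evolve (gam (sub k)) (ratr q) z) ord0 i|
    <= C z * (M (ratr q) - M t).
  exact: le_trans (le_mx_norm _ _) h.
rewrite !mxE => /le_trans; apply.
rewrite distrC ger0_norm in Mtq; last first.
  by rewrite subr_ge0; exact: primitive_nondecreasing (ltW tq).
apply: le_trans (ler_wpM2l (Cge0 z) Mtq) _.
rewrite mulrCA ler_piMr//; first exact: ltW.
by rewrite ler_pdivrMr// mul1r lerDl.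
Qed.

(** One test for each rational time, coordinate and rational threshold, the triples being enumerated
    by [pickle]. *)
Let test (j k : nat) : set Z :=
  if unpickle j is Some (q, i, r) then
    [set z | eta k (ratr (q : rat)) z ord0 (i : 'I_n) < ratr (r : rat)]
  else setT.

Let mtest j k : measurable (test j k).
Proof.
rewrite /test; case: unpickle => [[[q i] r]|]; last exact: measurableT.
have mz : measurable_fun setT (fun z => eta k (ratr q) z ord0 i).
  exact: (measurableT_comp (meta k i) (pair1_measurable (ratr q : TR))).
rewrite (_ : [set z | _] = (fun z => eta k (ratr q) z ord0 i) @^-1` `]-oo, ratr r[).
  by rewrite -[_ @^-1` _]setTI; apply: mz => //; exact: measurable_itv.
by apply/seteqP; split => z /=; rewrite in_itv.
Qed.

(** Along the selected indices [s k z], the functions [eta] and, up to [b], the functions [gam] have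
    the same limit; dominated convergence in [eta = evolve gam] then yields the fixed point
    equation. *)
Theorem measurable_caratheodory_flow : exists gamma : R -> Z -> 'rV[R]_n,
  [/\ jointly_measurable gamma,
      forall t z, gamma t z = evolve gamma t z &
      forall t z, 1 + `|gamma t z| <= expR (M b) * (1 + `|x0 z|)].
Proof.
have [s [ms sge stest]] := measurable_subsequence mtest.
have ceta t z i : cvgn (fun k => eta (s k z) t z ord0 i).
  apply: (eta_sub (sub := fun k => s k z)) => q.
  apply: (@cvg_of_rat_tests _ _ (C z)) => [k|r].
    apply: le_trans (le_mx_norm _ _) _.
    by have := exp_bounded_le (ratr q) z (beta_ (s k z)); lra.
  have := stest (pickle (q, i, r)) z; rewrite /test pickleK.
  case=> h; [left|right].
    by exists (pickle (q, i, r)).+1 => // k /= jk; exact: h.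
  by exists (pickle (q, i, r)).+1 => // k /= jk; rewrite leNgt; apply/negP; exact: h.
pose gamma t z : 'rV[R]_n := \row_i limn (fun k => eta (s k z) t z ord0 i).
have cgamma t z i : eta (s k z) t z ord0 i @[k --> \oo] --> gamma t z ord0 i.
  by rewrite mxE; exact: ceta.
have mgamma : jointly_measurable gamma.
  move=> i; apply: (@measurable_fun_cvg _ _ _ _
    (fun k (p : TR * Z) => eta (s k p.2) p.1 p.2 ord0 i)) => [k|p _]; last exact: cgamma.
  apply: (measurable_fun_countable_index (key := fun p : TR * Z => s k p.2)
    (f := fun p j => eta j p.1 p.2 ord0 i)) => [j|j]; last exact: meta.
  rewrite -[_ @^-1` _]setTI.
  exact: (@measurable_snd _ _ TR Z measurableT _ (ms k j)).
have bgamma t z : 1 + `|gamma t z| <= C z.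
  rewrite -lerBrDl; apply: mx_norm_le => [|i].
    rewrite subr_ge0; apply: le_trans (exp_bounded_le t z (beta_ 0)).
    by rewrite lerDl.
  have /cvg_norm/cvgr_to_le : eta (s k z) t z ord0 i @[k --> \oo] --> gamma t z ord0 i.
    exact: cgamma.
  apply; apply: nearW => k; apply: le_trans (le_mx_norm _ _) _.
  by rewrite lerBrDl; exact: exp_bounded_le (beta_ _).
exists gamma; split => //; last first.
  by move=> t z; rewrite mulrC; exact: bgamma.
have cM : continuous M by exact: primitive_continuous.
have hs0 z : hk (s k z) @[k --> \oo] --> (0 : R).
  apply/cvgrPdist_le => e e0; near=> k.
  rewrite sub0r normrN ger0_norm; last exact: ltW.
  apply: (@le_trans _ _ (k.+1%:R^-1)).
    by rewrite lef_pV2 ?posrE ?ltr0n// ler_nat ltnS.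
  by near: k; have := near_infty_natSinv_lt (PosNum e0); apply: filterS => k /ltW.
(* The common modulus absorbs the delay, which tends to 0. *)
have cgam t z : t <= b -> gam (s k z) t z @[k --> \oo] --> gamma t z.
  move=> tb; apply/cvgrPdist_le => e e0.
  have e2 : 0 < e / 2 by rewrite divr_gt0.
  have c1 : \forall k \near \oo, forall i, `|gamma t z ord0 i - eta (s k z) t z ord0 i| <= e / 2.
    apply: (@filter_forall _ _ (fun i k => _) _ eventually_filter) => i.
    by have /cvgrPdist_le := cgamma t z i; apply.
  have c2 : \forall k \near \oo, `|M t - M (t - hk (s k z))| <= e / 2 / (C z + 1).
    have : M (t - hk (s k z)) @[k --> \oo] --> M t.
      apply: (continuous_cvg _ (cM t)).
      by rewrite -[X in _ --> X]subr0; apply: cvgB; [exact: cvg_cst|exact: hs0].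
    by move=> /cvgrPdist_le; apply; rewrite divr_gt0// ltr_wpDl.
  near=> k.
  have k1 : forall i, `|gamma t z ord0 i - eta (s k z) t z ord0 i| <= e / 2 by near: k.
  have : `|M t - M (t - hk (s k z))| <= e / 2 / (C z + 1) by near: k.
  move=> k2; apply: mx_norm_le; first exact: ltW.
  move=> i; rewrite rowBE.
  apply: le_trans (ler_distD (eta (s k z) t z ord0 i) _ _) _.
  rewrite (splitr e); apply: lerD; first exact: k1.
  rewrite gamE//.
  have ht : t - hk (s k z) <= t by rewrite gerBl ltW.
  have h := evolve_dist_le z (mgam (s k z)) (bgam (s k z)) ht.
  have : `|(eta (s k z) t z - eta (s k z) (t - hk (s k z)) z) ord0 i|
      <= C z * (M t - M (t - hk (s k z))).
    exact: le_trans (le_mx_norm _ _) h.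
  rewrite rowBE => /le_trans; apply.
  move: k2; rewrite ger0_norm; last by rewrite subr_ge0; exact: primitive_nondecreasing.
  move=> /(ler_wpM2l (Cge0 z)) /le_trans; apply.
  rewrite mulrCA ler_piMr//; first exact: ltW.
  by rewrite ler_pdivrMr ?mul1r ?lerDl// ltr_wpDl.
move=> t z; apply/rowP => i.
have h1 := cgamma t z i; apply/esym; apply: (cvg_unique _ _ h1) => //.
rewrite /evolve rowDE [X in _ + X]mxE.
have -> : (fun k => eta (s k z) t z ord0 i) =
    (fun k => x0 z ord0 i + primitive (along (gam (s k z)) z i) t).
  by apply/funext => k; rewrite /eta /evolve !mxE.
apply: cvgD; first exact: cvg_cst.
rewrite primitiveE; under eq_fun do rewrite primitiveE.
have intC := integrable_EFinZl measurableT (C z) intm.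
apply: (@Rintegral_dominated_cvg _ TR R leb `]-oo, t]%classic
  (fun k => along (gam (s k z)) z i) (along gamma z i) (fun r => C z * m r) _ _ _ _ _).2.
- exact: measurable_itv.
- move=> k; apply: measurable_funTS; exact: measurable_along1.
- move=> r _; have [rb|br] := leP r b.
    have : B r z (gam (s k z) r z) @[k --> \oo] --> B r z (gamma r z).
      exact: (@continuous_cvg _ _ _ _ _ (fun k => gam (s k z) r z) (B r z) (gamma r z)
      (@cB r z (gamma r z)) (@cgam r z rb)).
    exact: (@continuous_cvg _ _ _ _ _ (fun k => B r z (gam (s k z) r z))
      (fun x : 'rV[R]_n => x ord0 i) (B r z (gamma r z))
      (@coord_continuous _ _ _ ord0 i (B r z (gamma r z)))).
  have B0 x : B r z x = 0.
    apply/eqP; rewrite -normr_le0; apply: le_trans (Bm _ _ _) _.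
    by rewrite msupp ?mul0r// negb_and -ltNge br orbT.
  by rewrite /along; under eq_fun do rewrite B0; rewrite B0; exact: cvg_cst.
- exact: integrableS intC.
- by move=> k r _; exact: along_le.
Unshelve. all: by end_near. Qed.

End ode.

(** * A Borel isomorphism of R^n onto a set of reals *)

Section ternary_code.
Variable R : realType.
Implicit Types (c : nat -> bool) (y : R).

Definition shift_code c : nat -> bool := fun k => c k.+1.

Fixpoint partial_code N c : R :=
  if N is M.+1 then ((c 0%N)%:R + partial_code M (shift_code c)) / 3 else 0.

Lemma partial_code_bounds N c : 0 <= partial_code N c <= 1 / 2.
Proof.
elim: N c => [|N IH] c /=; first by rewrite lexx/=; lra.
by have /andP[] := IH (shift_code c); case: (c 0%N) => /= ? ?; apply/andP; split; lra.
Qed.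

Lemma partial_code_nd c : nondecreasing_seq (partial_code ^~ c).
Proof.
apply/nondecreasing_seqP => N.
elim: N c => [|N IH] c; first by have /andP[] := partial_code_bounds 1 c.
have e M c' : partial_code M.+1 c' =
  ((c' 0%N)%:R + partial_code M (shift_code c')) / 3 by [].
by have := IH (shift_code c); rewrite (e N.+1 c) (e N c); lra.
Qed.

Lemma is_cvg_partial_code c : cvgn (partial_code ^~ c).
Proof.
apply: nondecreasing_is_cvgn; first exact: partial_code_nd.
by exists (1 / 2) => _ [N _ <-]; have /andP[] := partial_code_bounds N c.
Qed.

(* The base 3 expansion with digits 0 and 1 only: such expansions are unique,
   with the first digit 1 exactly when the sum is at least 1/3. *)
Definition code c : R := limn (partial_code ^~ c).

Lemma code_bounds c : 0 <= code c <= 1 / 2.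
Proof.
have cc := @is_cvg_partial_code c; apply/andP; split.
  by apply: limr_ge => //; apply: nearW => N; have /andP[] := partial_code_bounds N c.
by apply: limr_le => //; apply: nearW => N; have /andP[] := partial_code_bounds N c.
Qed.

Lemma code_shift c : code c = ((c 0%N)%:R + code (shift_code c)) / 3.
Proof.
have h : partial_code N.+1 c @[N --> \oo] --> ((c 0%N)%:R + code (shift_code c)) / 3.
  apply: cvgMl; apply: cvgD; first exact: cvg_cst.
  exact: is_cvg_partial_code.
by apply: cvg_lim => //; rewrite -(cvg_shiftS (partial_code ^~ c)).
Qed.

Definition tail_code y : R := 3 * y - (1 / 3 <= y)%R%:R.

Definition digit y k : bool := 1 / 3 <= iter k tail_code y.

Lemma first_digit c : (1 / 3 <= code c) = c 0%N.
Proof.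
have /andP[] := code_bounds (shift_code c); rewrite (code_shift c).
by case: (c 0%N) => /= h1 h2; [apply/idP|apply/negbTE; rewrite -ltNge]; lra.
Qed.

Lemma tail_codeE c : tail_code (code c) = code (shift_code c).
Proof. by rewrite /tail_code first_digit [in LHS]code_shift; field. Qed.

Lemma digit_code c k : digit (code c) k = c k.
Proof.
rewrite /digit; elim: k c => [|k IH] c; first exact: first_digit.
by rewrite iterSr tail_codeE IH.
Qed.

Lemma measurable_digit k : measurable_fun setT (digit ^~ k : R -> bool).
Proof.
apply: measurable_fun_ler => //.
elim: k => [|k IH]; first exact: measurable_id.
rewrite (_ : iter k.+1 _ = fun y => 3 * iter k tail_code y - (1 / 3 <= iter k tail_code y)%R%:R) //.
apply: measurable_funB; first exact: measurable_funM.
rewrite (_ : (fun y => _) = (fun y => if 1 / 3 <= iter k tail_code y then 1 else 0)).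
  by apply: measurable_fun_ifT => //; exact: measurable_fun_ler.
by apply/funext => y; case: (_ <= _).
Qed.

Variable n : nat.

(** A vector is encoded by its answers to the countably many questions [x_i < q] with [q]
    rational. *)
Definition rV_test (x : 'rV[R]_n) (k : nat) : bool :=
  if unpickle k is Some (i, q) then x ord0 (i : 'I_n) < ratr (q : rat) else false.

Definition rV_code (x : 'rV[R]_n) : R := code (rV_test x).

(** Each coordinate is the infimum of the rationals above it. Off the range of [rV_code] the infimum
    may be infinite, and [fine] then returns 0. *)
Definition rV_decode y : 'rV[R]_n := \row_i fine (ereal_inf
  [set (ratr q)%:E | q in [set q : rat | digit y (pickle (i, q))]]).

Lemma rV_codeK x : rV_decode (rV_code x) = x.
Proof.
apply/rowP => i; rewrite mxE /rV_code.
rewrite (_ : ereal_inf _ = (x ord0 i)%:E)//; apply/eqP; rewrite eq_le; apply/andP; split.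
  apply/lee_addgt0Pr => e e0.
  have [q] := @rat_in_itvoo _ (x ord0 i) (x ord0 i + e) ltac:(by rewrite ltrDl).
  rewrite in_itv/= => /andP[xq qe].
  apply: le_trans (_ : (ratr q)%:E <= _)%E; last by rewrite lee_fin ltW.
  apply: ereal_inf_lbound; exists q => //=.
  by rewrite digit_code /rV_test pickleK.
apply: le_ereal_inf_tmp => _ [q /= + <-].
by rewrite digit_code /rV_test pickleK lee_fin => /ltW.
Qed.

Lemma measurable_rV_code : measurable_fun setT (rV_code : borel 'rV[R]_n -> R).
Proof.
have mx i := @measurable_coord R n i.
have mt k : measurable_fun setT (rV_test ^~ k : borel 'rV[R]_n -> bool).
  rewrite /rV_test; case: unpickle => [[i q]|]; last exact: measurable_cst.
  exact: measurable_fun_ltr.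
(* The recursion of [partial_code] shifts the sequence, so the induction has to carry the shift
   [k]. *)
have mp N k : measurable_fun setT
    ((fun x => partial_code N (fun j => rV_test x (j + k)%N)) : borel 'rV[R]_n -> R).
  elim: N k => [|N IH] k /=; first exact: measurable_cst.
  apply: measurable_funM => //; apply: measurable_funD.
    rewrite (_ : (fun x => _) = (fun x => if rV_test x k then 1 else 0)).
      exact: measurable_fun_ifT.
    by apply/funext => x; rewrite add0n; case: rV_test.
  rewrite (_ : (fun x => _) = (fun x => partial_code N (fun j => rV_test x (j + k.+1)%N))) //.
  apply/funext => x; congr partial_code; apply/funext => j.
  by rewrite /shift_code addnS addSn.
apply: (@measurable_fun_cvg _ (borel 'rV[R]_n) R setT
  (fun N x => partial_code N (rV_test x)) (@rV_code)).
  move=> N; rewrite (_ : (fun x => _) = (fun x => partial_code N (fun j => rV_test x (j + 0)%N))) //.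
  by apply/funext => x; congr partial_code; apply/funext => j; rewrite addn0.
by move=> x _; exact: is_cvg_partial_code.
Qed.

Lemma measurable_rV_decode : measurable_fun setT (rV_decode : R -> borel 'rV[R]_n).
Proof.
apply/measurable_fun_borel_rV => i; rewrite /rV_decode.
under eq_fun do rewrite mxE.
apply: measurableT_comp => //.
apply: (measurability _ (ErealGenInftyO.measurableE R)) => //.
move=> _ [_ [r ->] <-]; rewrite setTI.
rewrite (_ : _ @^-1` _ = \bigcup_(q in [set q : rat | ratr q < r :> R])
    [set y : R | digit y (pickle (i, q))]).
  apply: bigcup_countable_measurable; first exact: countableP.
  move=> q _; rewrite -[X in measurable X]setTI.
  exact: (@measurable_digit (pickle (i, q)) measurableT [set true]).
apply/seteqP; split => [y|y [q /= qr yq]]; rewrite /= in_itv/=.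
  by move=> /ereal_inf_lt[_ [q /= yq <-]]; rewrite lte_fin => qr; exists q.
by apply: le_lt_trans (_ : _ <= (ratr q)%:E)%E _; rewrite ?lte_fin//;
  apply: ereal_inf_lbound; exists q.
Qed.

End ternary_code.

(** * Conditional quantiles *)

Section image_measures.
Local Open Scope ereal_scope.
Context d d' (T : measurableType d) (T' : measurableType d') (R : realType).

(** Image of the restriction of [m] to the event [E]. With [E] fixed, a joint probability becomes a
    measure in the second event, ready for Radon-Nikodym and for uniqueness on a generating
    class. *)
Definition image_on (m : {measure set T -> \bar R}) (E : set T) (f : T -> T')
    & measurable E & measurable_fun setT f := fun B => m (E `&` f @^-1` B).

Section measure.
Variables (m : {measure set T -> \bar R}) (E : set T) (f : T -> T').
Hypotheses (mE : measurable E) (mf : measurable_fun setT f).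

Let mpre B : measurable B -> measurable (f @^-1` B).
Proof. by move=> mB; rewrite -[_ @^-1` _]setTI; exact: mf. Qed.

Let image0 : image_on m mE mf set0 = 0.
Proof. by rewrite /image_on preimage_set0 setI0 measure0. Qed.

Let image_ge0 B : 0 <= image_on m mE mf B.
Proof. by apply: measure_ge0; apply: measurableI => //; exact: mpre. Qed.

Let image_semi_sigma_additive : semi_sigma_additive (image_on m mE mf).
Proof.
move=> F mF tF mUF; rewrite /image_on preimage_bigcup setI_bigcupr.
apply: measure_semi_sigma_additive.
- by move=> k; apply: measurableI => //; exact: mpre.
- apply/trivIsetP => /= i j _ _ ij; rewrite setIACA -preimage_setI.
  by move/trivIsetP : tF => /(_ _ _ _ _ ij) ->//; rewrite preimage_set0 setI0.
- by rewrite -setI_bigcupr -preimage_bigcup; apply: measurableI => //; exact: mpre.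
Qed.

HB.instance Definition _ := isMeasure.Build _ _ _ (image_on m mE mf)
  image0 image_ge0 image_semi_sigma_additive.

End measure.

Definition law (P : probability T R) (f : T -> T') (mf : measurable_fun setT f) :
  probability T' R := distribution P (mfun_Sub (mem_set mf)).

Lemma lawE (P : probability T R) f (mf : measurable_fun setT f) B :
  law P mf B = P (f @^-1` B).
Proof. by []. Qed.

Lemma ge0_integral_law (P : probability T R) f (mf : measurable_fun setT f)
    (g : T' -> \bar R) : measurable_fun setT g -> (forall y, 0 <= g y) ->
  \int[law P mf]_y g y = \int[P]_x g (f x).
Proof.
move=> mg g0; have := @ge0_integral_pushforward _ _ _ _ _ f mf P setT g.
by rewrite preimage_setT; apply.
Qed.

Lemma integral_law (P : probability T R) f (mf : measurable_fun setT f)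
    (g : T' -> \bar R) : measurable_fun setT g -> P.-integrable setT (g \o f) ->
  \int[law P mf]_y g y = \int[P]_x g (f x).
Proof.
move=> mg ig; have := @integral_pushforward _ _ _ _ _ f mf P setT g mg.
by rewrite preimage_setT; apply.
Qed.

End image_measures.

Section conditional_probability.
Local Open Scope ereal_scope.
Context d d' (T : measurableType d) (W : measurableType d') (R : realType).

(** The inequality is tested on the set [g < f] itself. *)
Lemma null_of_integral_le (m : {finite_measure set W -> \bar R}) (f g : W -> R) :
  m.-integrable setT (EFin \o f) -> m.-integrable setT (EFin \o g) ->
  (forall A, measurable A ->
     \int[m]_(w in A) (f w)%:E <= \int[m]_(w in A) (g w)%:E) ->
  m [set w | (g w < f w)%R] = 0.
Proof.
move=> intf intg fg; set A := [set w | _].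
have mf : measurable_fun setT f by apply/measurable_EFinP; exact: (measurable_int m intf).
have mg : measurable_fun setT g by apply/measurable_EFinP; exact: (measurable_int m intg).
have mA : measurable A.
  have := @measurable_fun_ltr _ _ _ setT g f mg mf measurableT [set true].
  by rewrite setTI; apply.
have intfA : m.-integrable A (EFin \o f) by exact: integrableS intf.
have intgA : m.-integrable A (EFin \o g) by exact: integrableS intg.
have mfg : measurable_fun A (EFin \o (fun w => f w - g w)%R).
  by apply/measurable_EFinP; apply: measurable_funTS; exact: measurable_funB.
have abs0 : \int[m]_(w in A) `|(EFin \o (fun w => f w - g w)%R) w| = 0.
  rewrite (eq_integral (fun w => (EFin \o f) w - (EFin \o g) w)); last first.
    by move=> w; rewrite inE /A/= => gf; rewrite ger0_norm// subr_ge0 ltW.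
  rewrite integralB//; apply/eqP; rewrite eq_le; apply/andP; split.
    by rewrite sube_le0; exact: fg.
  rewrite -integralB//; apply: integral_ge0 => w.
  by rewrite /A /= -EFinB lee_fin subr_ge0 => /ltW.
have /(ae_eq_integral_abs m mA mfg)[N [mN N0 AN]] := abs0.
apply/eqP; rewrite eq_le measure_ge0 andbT -N0 le_measure ?inE//.
move=> w Aw; apply: AN => /(_ Aw) /eqP; rewrite eqe subr_eq0 => /eqP e.
by move: Aw; rewrite /A/= e ltxx.
Qed.

(** A Radon-Nikodym density of the image of [mu] restricted to [E], a measure dominated by [pi]
    setwise. *)
Lemma conditional_probability (mu : probability T R) (pi : probability W R)
    (X : T -> W) (E : set T) : measurable_fun setT X -> measurable E ->
  (forall A, measurable A -> mu (X @^-1` A) = pi A) ->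
  exists f : W -> R, [/\ measurable_fun setT f, forall w, (0 <= f w <= 1)%R &
    forall A, measurable A -> mu (E `&` X @^-1` A) = \int[pi]_(w in A) (f w)%:E].
Proof.
move=> mX mE muX.
have mpre A : measurable A -> measurable (X @^-1` A).
  by move=> mA; rewrite -[_ @^-1` _]setTI; exact: mX.
pose nu0 := image_on mu mE mX.
have nu0T : nu0 setT < +oo.
  rewrite /nu0 /image_on preimage_setT setIT (le_lt_trans (probability_le1 _ _))//.
  exact: ltry.
pose nu : {finite_measure set W -> \bar R} := mfrestr measurableT nu0T.
have nuE A : nu A = mu (E `&` X @^-1` A) by rewrite /nu/= /mfrestr /mrestr setIT.
have nupi A : measurable A -> nu A <= pi A.
  move=> mA; rewrite nuE -muX//; apply: le_measure; rewrite ?inE//.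
    by apply: measurableI => //; exact: mpre.
  exact: mpre.
have nudom : nu `<< pi.
  apply/null_content_dominatesP => A mA A0.
  by apply/eqP; rewrite eq_le measure_ge0 andbT -A0; exact: nupi.
have [F [F0 Ffin intF FE]] := radon_nikodym_sigma_finite nudom.
(* The density is at most 1 only almost everywhere; truncation gives the bound at every [w], as the
   pointwise use of [noise_ray] requires. *)
pose f w := Num.min 1%R (fine (F w)).
have mfF : measurable_fun setT (fine \o F).
  by apply: measurableT_comp => //; exact: (measurable_int pi intF).
have mf : measurable_fun setT f by exact: measurable_minr.
have intfF : pi.-integrable setT (EFin \o (fine \o F)).
  by apply: eq_integrable intF => // w _ /=; rewrite fineK.
have N0 : pi [set w | (1 < fine (F w))%R] = 0.
  apply: (@null_of_integral_le _ (fine \o F) (cst 1%R)) => //.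
    exact: finite_measure_integrable_cst.
  move=> A mA; rewrite [leRHS](integral_cst pi mA 1) mul1e.
  under eq_integral do rewrite /= fineK//.
  by rewrite -FE//; exact: nupi.
have mN : measurable [set w | (1 < fine (F w))%R].
  have := @measurable_fun_ltr _ _ _ setT (cst 1%R) (fine \o F) 
    (measurable_cst _) mfF measurableT [set true].
  by rewrite setTI; apply.
exists f; split => // [w|A mA].
  by rewrite /f ge_min lexx /= le_min ler01 fine_ge0.
rewrite -nuE FE//; apply: (integral_off_null mN N0) => w _ /=.
move=> /negP; rewrite -leNgt => F1.
by rewrite /f (min_idPr F1) fineK.
Qed.

End conditional_probability.

Section noise.
Variable R : realType.
Local Open Scope ereal_scope.

Definition noise : probability (measurableTypeR R) R := uniform_prob (@ltr01 R).

Lemma noise_ray (c : R) : (0 <= c <= 1)%R -> noise `]-oo, c[%classic = c%:E.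
Proof.
move=> /andP[c0 c1]; rewrite /noise/= /uniform_prob integral_uniform_pdf.
rewrite (eq_integral (cst 1)); last first.
  move=> x; rewrite inE/= => -[_]; rewrite /= in_itv/= /uniform_pdf => ->.
  by rewrite subr0 invr1.
rewrite integral_cst/= ?mul1e; last exact: measurableI.
rewrite (_ : _ `&` _ = `[0%R, c[%classic).
  rewrite lebesgue_measure_itv/= lte_fin.
  move: c0; rewrite le_eqVlt => /predU1P[<-|->]; first by rewrite ltxx.
  by rewrite sube0.
apply/seteqP; split => x /=; rewrite !in_itv/=.
  by move=> [xc /andP[-> _]].
by move=> /andP[x0 xc]; rewrite xc x0/=; split => //; rewrite (le_trans (ltW xc)).
Qed.

End noise.

Section randomization_real.
Local Open Scope ereal_scope.
Context d d' (T : measurableType d) (W : measurableType d') (R : realType).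
Notation TR := (measurableTypeR R).
Variables (mu : probability T R) (pi : probability W R).
Variables (X : T -> W) (Y : T -> R).
Hypotheses (mX : measurable_fun setT X) (mY : measurable_fun setT Y).
Hypothesis muX : forall A, measurable A -> mu (X @^-1` A) = pi A.
Hypothesis Y01 : forall t, (0 <= Y t < 1)%R.

Notation prod := (pi \x noise R).

Let below (q : rat) : set T := Y @^-1` `]-oo, ratr q[.

Let measurable_below q : measurable (below q).
Proof. by rewrite /below -[_ @^-1` _]setTI; apply: mY => //; exact: measurable_itv. Qed.

(* A version of the conditional distribution function of Y given X. *)
Let f q := sval (cid (conditional_probability mX (measurable_below q) muX)).

Let mf q : measurable_fun setT (f q).
Proof. by rewrite /f; case: cid => g []. Qed.

Let f01 q w : (0 <= f q w <= 1)%R.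
Proof. by rewrite /f; case: cid => g []. Qed.

Let fE q A : measurable A ->
  mu (below q `&` X @^-1` A) = \int[pi]_(w in A) (f q w)%:E.
Proof. by move=> mA; rewrite /f; case: cid => g [m01 b01 h] /=; exact: h. Qed.

(** The inequality [z.2 < f q z.1] is the quantile condition. The two conditions on [ratr q] keep
    the infimum in [[0, 1]], hence finite, whatever the chosen versions [f q] do. *)
Let good (q : rat) (z : W * TR) : Prop :=
  (0 < ratr q :> R)%R /\ ((z.2 < f q z.1)%R \/ (1 <= ratr q :> R)%R).

(* The conditional quantile function of Y given X. *)
Let Q (z : W * TR) : R := fine (ereal_inf [set (ratr q)%:E | q in good ^~ z]).

Let Q_lt z (a : R) : (Q z < a)%R <-> exists q, good q z /\ (ratr q < a)%R.
Proof.
set S := [set (ratr q : R)%:E | q in good ^~ z].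
have S1 : ereal_inf S <= 1%:E.
  apply: ereal_inf_lbound; exists 1%R; last by rewrite rmorph1.
  by split; [rewrite rmorph1 ltr01|right; rewrite rmorph1].
have S0 : 0%:E <= ereal_inf S.
  by apply: le_ereal_inf_tmp => _ [q [q0 _] <-]; rewrite lee_fin ltW.
have Sfin : ereal_inf S \is a fin_num.
  by rewrite fin_numE -ltNye -ltey (lt_le_trans _ S0) ?ltNyr// (le_lt_trans S1) ?ltry.
have QE : (Q z)%:E = ereal_inf S by rewrite /Q fineK.
rewrite -lte_fin QE; split => [/ereal_inf_lt[_ [q gq <-] qa]|[q [gq qa]]].
  by exists q; split => //; rewrite lte_fin in qa.
apply: le_lt_trans (_ : (ratr q)%:E < _); last by rewrite lte_fin.
by apply: ereal_inf_lbound; exists q.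
Qed.

Let sublevel (q : rat) : set (W * TR) := [set z | (z.2 < f q z.1)%R].

Let measurable_sublevel q : measurable (sublevel q).
Proof.
have := @measurable_fun_ltr _ (W * TR)%type R setT snd (f q \o fst) (measurable_snd)
  (measurableT_comp (mf q) measurable_fst) measurableT [set true].
by rewrite setTI; apply.
Qed.

Let mQ : measurable_fun setT (Q : W * TR -> R).
Proof.
apply: (measurability _ (RGenInftyO.measurableE R)) => //.
move=> _ [_ [r ->] <-]; rewrite setTI.
rewrite (_ : _ @^-1` _ = \bigcup_(q in [set q : rat | (0 < ratr q :> R)%R /\ (ratr q < r)%R])
    (if (1 <= ratr q :> R)%R then setT else sublevel q)).
  apply: bigcup_countable_measurable; first exact: countableP.
  by move=> q _; case: ifP.
apply/seteqP; split => [z|z [q /= [q0 qr] zq]]; rewrite /= in_itv/=.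
  move=> /Q_lt[q [[q0 gq] qr]]; exists q => //.
  by case: ifPn => // q1; case: gq => //; rewrite (negbTE q1).
apply/Q_lt; exists q; split => //; split => //.
by move: zq; case: ifPn => [? _|_ ?]; [right|left].
Qed.

(** The section at [w] is the ray below [f q w], whose probability under the uniform noise is
    [f q w]. *)
Let prod_sublevel q A : measurable A ->
  prod ((A `*` setT) `&` sublevel q) = mu (below q `&` X @^-1` A).
Proof.
move=> mA; rewrite fE// /product_measure1 [RHS]integral_mkcond.
apply: eq_integral => w _; rewrite /= patchE.
case: ifPn => [wA|wA].
  rewrite (_ : xsection _ w = `]-oo, f q w[%classic); first exact: noise_ray.
  apply/seteqP; split => u; rewrite xsectionE /= in_itv/=; first by case.
  by move=> uf; split => //; split => //; exact: set_mem.
rewrite (_ : xsection _ w = set0) ?measure0// -subset0 => u.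
rewrite xsectionE => -[[/= Aw _] _].
by move: wA; rewrite notin_setE; apply.
Qed.

Let prod_strip A : measurable A -> prod (A `*` setT) = pi A.
Proof.
move=> mA; rewrite product_measure1E// -[RHS]mule1; congr (_ * _).
exact: probability_setT.
Qed.

(** The versions are chosen separately for each rational, so monotonicity holds only off a null
    set. *)
Let f_mono_ae (a q : rat) : (q < a)%R -> pi [set w | (f a w < f q w)%R] = 0.
Proof.
have intf r : pi.-integrable setT (EFin \o f r).
  apply: (le_integrable_EFin _ _ _ (finite_measure_integrable_cst pi 1 measurableT)) => //.
  by move=> w _; have /andP[? ?] := f01 r w; rewrite ger0_norm.
move=> qa; apply: null_of_integral_le => // A mA; rewrite -!fE//.
have mpre : measurable (X @^-1` A) by rewrite -[_ @^-1` _]setTI; exact: mX.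
apply: le_measure; rewrite ?inE; [exact: measurableI..|].
apply: setSI => t; rewrite /below/= !in_itv/= => /lt_trans; apply.
by rewrite ltr_rat.
Qed.

Let rays : set (set R) := [set `]-oo, ratr q[%classic | q in [set: rat]].

Let raysE : <<s rays>> = @measurable _ TR.
Proof.
rewrite [RHS]RGenInftyO.measurableE; apply/seteqP; split.
  apply: smallest_sub; first exact: smallest_sigma_algebra.
  by move=> _ [q _ <-]; apply: sub_sigma_algebra; exists (ratr q).
apply: smallest_sub; first exact: smallest_sigma_algebra.
move=> _ [x ->].
rewrite (_ : `]-oo, x[%classic = \bigcup_(q in [set q : rat | (ratr q < x)%R])
    (`]-oo, ratr q[%classic : set (g_sigma_algebraType rays))).
  apply: (@bigcup_countable_measurable _ (g_sigma_algebraType rays)).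
    exact: countableP.
  by move=> q _; apply: sub_sigma_algebra; exists q.
apply/seteqP; split => y /=; rewrite in_itv/=.
  move=> yx; have [q] := rat_in_itvoo yx; rewrite in_itv/= => /andP[yq qx].
  by exists q => //=; rewrite in_itv.
by move=> [q /= qx]; rewrite in_itv/= => /lt_trans; apply.
Qed.

(** Off the null set where monotonicity fails, [Q z < a] implies [z.2 < f a z.1]. Conversely
    [z.2 < f q z.1] with [0 < q < a] implies [Q z < a], and letting [q] increase to [a] needs only
    continuity from below of [mu], not left continuity of the versions. *)
Let eq_on_rays A (mA : measurable A) (a : rat) :
  mu (X @^-1` A `&` below a) = prod (A `*` setT `&` Q @^-1` `]-oo, ratr a[).
Proof.
have mpre : measurable (X @^-1` A) by rewrite -[_ @^-1` _]setTI; exact: mX.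
have mAT : measurable (A `*` setT : set (W * TR)) by exact: measurableX.
have mQa : measurable (Q @^-1` `]-oo, ratr a[).
  by rewrite -[_ @^-1` _]setTI; apply: mQ => //; exact: measurable_itv.
(* For [a <= 0] both ray preimages are empty; for [1 < a] both are everything. *)
have [a0|a0] := leP (ratr a) (0 : R)%R.
  rewrite (_ : below a = set0); last first.
    rewrite -subset0 => t; rewrite /below/= in_itv/= => Yt.
    have /andP[Y0 _] := Y01 t.
    by have := lt_le_trans Yt a0; rewrite ltNge Y0.
  rewrite (_ : Q @^-1` _ = set0) ?setI0 ?measure0// -subset0 => z.
  rewrite /= in_itv/= => /Q_lt[q [[q0 _] qa]].
  by have := lt_trans q0 (lt_le_trans qa a0); rewrite ltxx.
have [a1|a1] := ltP (1 : R)%R (ratr a).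
  rewrite (_ : below a = setT); last first.
    rewrite -subTset => t _; rewrite /below/= in_itv/=.
    by have /andP[_ Y1] := Y01 t; exact: lt_trans a1.
  rewrite (_ : Q @^-1` _ = setT) ?setIT ?prod_strip ?muX// -subTset => z _.
  rewrite /= in_itv/=; apply/Q_lt; exists 1%R; rewrite rmorph1; split => //.
  by split; rewrite rmorph1 ?ltr01//; right.
apply/eqP; rewrite eq_le; apply/andP; split; last first.
  pose N k := if (unpickle k : option rat) is Some q then
    (if (q < a)%R then [set w | (f a w < f q w)%R] else set0) else set0.
  have mN k : measurable (N k).
    rewrite /N; case: unpickle => // q; case: ifP => // _.
    have := @measurable_fun_ltr _ _ _ setT (f a) (f q) (mf a) (mf q) measurableT [set true].
    by rewrite setTI; apply.
  have mUN : measurable (\bigcup_k N k) by exact: bigcupT_measurable.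
  have N0 : pi (\bigcup_k N k) = 0.
    apply/negligibleP => //; apply: negligible_bigcup => k.
    apply/negligibleP => //; rewrite /N; case: unpickle => [q|]; rewrite ?measure0//.
    by case: ifP => [/f_mono_ae//|_]; rewrite measure0.
  have mUNT : measurable ((\bigcup_k N k) `*` setT : set (W * TR)) by exact: measurableX.
  apply: (@le_trans _ _ (prod ((A `*` setT `&` sublevel a) `|` ((\bigcup_k N k) `*` setT)))).
    apply: le_measure; rewrite ?inE; first exact: measurableI.
      by apply: measurableU => //; exact: measurableI.
    move=> z [zA]; rewrite /= in_itv/= => /Q_lt[q [[q0 gq] qa]].
    have {}gq : (z.2 < f q z.1)%R.
      by case: gq => // q1; have := lt_le_trans qa a1; rewrite ltNge q1.
    have [qf|qf] := leP (f q z.1) (f a z.1).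
      by left; split => //; exact: lt_le_trans qf.
    right; split; last by []; exists (pickle q); first exact: I.
    by rewrite /N pickleK -(ltr_rat R) qa.
  apply: le_trans (measureU2 _ _ _) _ => //; first exact: measurableI.
  have e1 := prod_sublevel a mA; have e2 := prod_strip mUN.
  by rewrite [X in X + _]e1 [X in _ + X]e2 N0 adde0 setIC.
(* The denominator [k.+2], rather than [k.+1], keeps [q k] positive, as [good] demands. *)
pose q k : rat := (a - a / k.+2%:R)%R.
have a0' : (0 < a)%R by rewrite -(ltr0q R).
have q0 k : (0 < q k)%R.
  by rewrite subr_gt0 ltr_pdivrMr ?ltr0n// ltr_pMr// ltr1n.
have qa k : (q k < a)%R by rewrite gtrBl divr_gt0.
have ndq : {homo q : m n / (m <= n)%N >-> (m <= n)%R}.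
  move=> m n mn; rewrite lerD2l lerN2 ler_pM2l// lef_pV2 ?posrE ?ltr0n//.
  by rewrite ler_nat.
have bigE : below a = \bigcup_k below (q k).
  apply/seteqP; split => t; last first.
    move=> [k _]; rewrite /below/= !in_itv/= => /lt_trans; apply.
    by rewrite ltr_rat.
  rewrite /below/= in_itv/= => Yt.
  have e0 : (0 < ratr a - Y t)%R by rewrite subr_gt0.
  have [k _ kP] := near_infty_natSinv_lt (PosNum e0).
  exists k => //; rewrite /= in_itv/= /q rmorphB/= fmorph_div/= ratr_nat.
  rewrite ltrBrDr -ltrBrDl; apply: le_lt_trans (kP k (leqnn k)).
  rewrite -[leRHS]mul1r; apply: ler_pM => //; first exact: ltW.
  by rewrite lef_pV2 ?posrE ?ltr0n// ler_nat.
have mB k : measurable (X @^-1` A `&` below (q k)) by exact: measurableI.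
have : mu (X @^-1` A `&` below (q k)) @[k --> \oo] --> mu (X @^-1` A `&` below a).
  rewrite bigE setI_bigcupr; apply: nondecreasing_cvg_mu => //.
    exact: bigcupT_measurable.
  move=> m n mn; apply/subsetPset; apply: setIS => t.
  rewrite /below/= !in_itv/= => /lt_le_trans; apply.
  by rewrite ler_rat; exact: ndq.
move=> cmu; have <- := cvg_lim (@ereal_hausdorff R) cmu.
apply: lime_le; first by apply/cvg_ex; eexists; exact: cmu.
apply: nearW => k; have e := prod_sublevel (q k) mA; rewrite setIC -e.
apply: le_measure; rewrite ?inE; [exact: measurableI|exact: measurableI|].
apply: setIS => z zq; rewrite /= in_itv/=; apply/Q_lt; exists (q k).
by split; [split; [rewrite ltr0q|left]|rewrite ltr_rat].
Qed.

Theorem randomization_real : exists Q : W * TR -> R, measurable_fun setT Q /\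
  forall A B, measurable A -> measurable (B : set TR) ->
    mu (X @^-1` A `&` Y @^-1` B) = prod (A `*` setT `&` Q @^-1` B).
Proof.
exists Q; split => // A B mA mB.
have mpre : measurable (X @^-1` A) by rewrite -[_ @^-1` _]setTI; exact: mX.
have mAT : measurable (A `*` setT : set (W * TR)) by exact: measurableX.
have mY' : measurable_fun setT (Y : T -> TR) := mY.
have mQ' : measurable_fun setT (Q : W * TR -> TR) := mQ.
apply: (@g_sigma_algebra_measure_unique _ R TR rays _
  (fun k => `]-oo, (ratr (k%:R : rat))[%classic) _ _
  (image_on mu mpre mY') (image_on prod mAT mQ')) => //.
- by move=> _ [q _ <-]; exact: measurable_itv.
- by move=> k; exists k%:R%R.
- apply/seteqP; split => // x _; exists (Num.bound `|x|) => //.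
  rewrite /= in_itv/= ratr_nat; apply: le_lt_trans (ler_norm x) _.
  by rewrite archi_boundP.
- move=> _ _ [q _ <-] [r _ <-]; exists (Num.min q r) => //.
  apply/seteqP; split => x /=; rewrite !in_itv/= minEle; case: ifPn => h.
  + by move=> xq; split => //; apply: lt_le_trans xq _; rewrite ler_rat.
  + move=> xr; split => //; apply: lt_le_trans xr _; rewrite ler_rat ltW//.
    by rewrite ltNge.
  + by case.
  + by case.
- by move=> _ [q _ <-]; exact: eq_on_rays.
- move=> k; apply: le_lt_trans (probability_le1 _ _) (ltry _).
  apply: measurableI => //; rewrite -[_ @^-1` _]setTI.
  by apply: mY => //; exact: measurable_itv.
- by rewrite raysE.
Qed.

End randomization_real.

(** * Randomization and disintegration *)

Lemma eq_measure_on_rectangles (R : realType) (X Y : ptopologicalType)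
    (m1 m2 : {measure set (borel (X * Y)%type) -> \bar R}) :
  @second_countable X -> @second_countable Y ->
  (m1 setT < +oo)%E ->
  (forall (A : set (borel X)) (B : set (borel Y)), measurable A -> measurable B ->
     m1 (fst @^-1` A `&` snd @^-1` B) = m2 (fst @^-1` A `&` snd @^-1` B)) ->
  forall A, measurable A -> m1 A = m2 A.
Proof.
move=> [B cB bB] [C cC bC] m1oo m12.
pose G : set (set (X * Y)) := [set fst @^-1` A `&` snd @^-1` B |
   A in (measurable : set (set (borel X))) & B in (measurable : set (set (borel Y)))].
have Gm : G `<=` (measurable : set (set (borel (X * Y)%type))).
  move=> _ [A mA [A' mA' <-]]; apply: measurableI.
    rewrite -[_ @^-1` _]setTI; exact: measurable_fst_borel.
  by rewrite -[_ @^-1` _]setTI; exact: measurable_snd_borel.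
have GT : G setT.
  by exists setT => //; exists setT => //; rewrite !preimage_setT setIT.
move=> A mA; apply: (@g_sigma_algebra_measure_unique _ R (borel (X * Y)%type) G Gm
  (fun=> setT)) => //.
- by rewrite -subTset => x _; exists 0%N.
- move=> _ _ [A1 mA1 [A2 mA2 <-]] [A3 mA3 [A4 mA4 <-]].
  exists (A1 `&` A3); first exact: measurableI.
  exists (A2 `&` A4); first exact: measurableI.
  by rewrite !preimage_setI setIACA.
- by move=> _ [A1 mA1 [A2 mA2 <-]]; exact: m12.
suff : (measurable : set (set (borel (X * Y)%type))) `<=` <<s G>> by apply.
apply: smallest_sub; first exact: smallest_sigma_algebra.
move=> V oV.
(* Second countability enters here: the identity is measurable because its two components are, so
   rectangles generate the Borel sets. *)
have mid : measurable_fun setT (id : g_sigma_algebraType G -> borel (X * Y)%type).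
  have mf : measurable_fun setT (fst : g_sigma_algebraType G -> borel X).
    move=> _ A1 mA1; rewrite setTI; apply: sub_sigma_algebra.
    by exists A1 => //; exists setT => //; rewrite preimage_setT setIT.
  have mg : measurable_fun setT (snd : g_sigma_algebraType G -> borel Y).
    move=> _ A1 mA1; rewrite setTI; apply: sub_sigma_algebra.
    by exists setT => //; exists A1 => //; rewrite preimage_setT setTI.
  have := @measurable_fun_borel_pair _ (g_sigma_algebraType G) X Y fst snd
    (ex_intro2 _ _ B cB bB) (ex_intro2 _ _ C cC bC) mf mg.
  rewrite (_ : (fun t => (t.1, t.2)) = id)//.
  by apply/funext => -[].
have := mid measurableT V; rewrite setTI; apply.
exact: sub_sigma_algebra.
Qed.

Section sectional_kernel.
Context d d' d2 (W : measurableType d) (U : measurableType d')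
  (Y : measurableType d2) (R : realType).
Variables (P : probability U R) (F : W * U -> Y).

Definition sectional (mF : measurable_fun setT F) (w : W) :
    {measure set Y -> \bar R} :=
  law P (measurableT_comp mF (pair1_measurable w)).

Hypothesis mF : measurable_fun setT F.

Lemma sectionalE w B : sectional mF w B = P ((fun u => F (w, u)) @^-1` B).
Proof. by []. Qed.

Let measurable_sectional B : measurable B ->
  measurable_fun setT (sectional mF ^~ B).
Proof.
move=> mB; rewrite (_ : (fun w => _) = P \o xsection (F @^-1` B)).
  apply: measurable_fun_xsection; rewrite -[_ @^-1` _]setTI; exact: mF.
apply/funext => w; rewrite sectionalE/=; congr (P _).
by apply/seteqP; split => u; rewrite xsectionE.
Qed.

HB.instance Definition _ := isKernel.Build _ _ _ _ _ (sectional mF)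
  measurable_sectional.

Let sectional_prob w : sectional mF w setT = 1%E.
Proof. by rewrite sectionalE preimage_setT probability_setT. Qed.

HB.instance Definition _ := Kernel_isProbability.Build _ _ _ _ _
  (sectional mF) sectional_prob.

End sectional_kernel.

Section disintegration.
Local Open Scope ereal_scope.
Context (R : realType) (Om : ptopologicalType) (n : nat).
Variable pi : probability (borel Om) R.
Hypothesis sc_Om : @second_countable Om.
Notation TR := (measurableTypeR R).
Notation V := 'rV[R]_n.
Notation prod := (pi \x noise R).

Lemma measurable_graph (F : borel Om * TR -> V) :
  measurable_fun setT (F : _ -> borel V) ->
  measurable_fun setT ((fun z => (z.1, F z)) : borel Om * TR -> borel (Om * V)%type).
Proof.
move=> mF; by apply: measurable_fun_borel_pair => //; exact: second_countable_rV.
Qed.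

Definition graph_law F (mF : measurable_fun setT (F : borel Om * TR -> borel V)) :
    probability (borel (Om * V)%type) R :=
  law prod (measurable_graph mF).

Lemma graph_lawE F (mF : measurable_fun setT (F : borel Om * TR -> borel V)) A :
  graph_law mF A = prod ((fun z => (z.1, F z)) @^-1` A).
Proof. by []. Qed.

Theorem randomization (mu : probability (borel (Om * V)%type) R) : P_pi pi mu ->
  exists F (mF : measurable_fun setT (F : borel Om * TR -> borel V)),
    forall A, measurable A -> mu A = graph_law mF A.
Proof.
move=> muP; pose Y (x : borel (Om * V)%type) := rV_code x.2.
have mY : measurable_fun setT Y.
  exact: (measurableT_comp (@measurable_rV_code R n) (@measurable_snd_borel Om V)).
have Y01 x : (0 <= Y x < 1)%R.
  rewrite /Y /rV_code; have /andP[-> h] := code_bounds R (rV_test x.2).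
  by apply: le_lt_trans h _; lra.
have [Q [mQ QE]] := randomization_real (@measurable_fst_borel Om V) mY muP Y01.
have mF : measurable_fun setT (rV_decode n \o Q : borel Om * TR -> borel V).
  exact: (measurableT_comp (@measurable_rV_decode R n) mQ).
exists (rV_decode n \o Q), mF.
apply: eq_measure_on_rectangles => //; first exact: second_countable_rV.
  by rewrite [X in X < _](probability_setT mu) ltry.
move=> A B mA mB.
have mdB : measurable (rV_decode n @^-1` B : set TR).
  by rewrite -[_ @^-1` _]setTI; apply: measurable_rV_decode.
have := QE A (rV_decode n @^-1` B) mA mdB.
have <- : fst @^-1` A `&` snd @^-1` B =
    fst @^-1` A `&` Y @^-1` (rV_decode n @^-1` B).
  by apply/seteqP; split => x /= [xA]; rewrite /Y/= rV_codeK.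
move=> e; apply: (eq_trans e).
apply: eq_trans (esym (graph_lawE mF _)); congr (prod _).
by apply/seteqP; split => z /=; [case=> -[]|case].
Qed.

Lemma disintegrates_graph_law F (mF : measurable_fun setT (F : borel Om * TR -> borel V)) :
  disintegrates pi (graph_law mF) (sectional (noise R) mF).
Proof.
move=> A mA; rewrite /graph_law lawE /product_measure1; apply: eq_integral => w _ /=.
congr (noise R _); apply/seteqP; split => u; rewrite xsectionE/= => h.
Qed.

(** Lower orthants with rational corner: a countable class, stable under intersection and generating
    the Borel sets, so that a single null set of [w] can serve all of them. *)
Let box (q : 'rV[rat]_n) : set V := [set x | forall i, (x ord0 i < ratr (q ord0 i))%R].

Let boxes : set (set V) := range box.

Let mbox q : measurable (box q : set (borel V)).
Proof.
have mx i := @measurable_coord R n i.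
rewrite (_ : box q = \bigcap_i ((fun x : V => x ord0 i) @^-1` `]-oo, ratr (q ord0 i)[)).
  apply: fin_bigcap_measurable => // i _; rewrite -[_ @^-1` _]setTI.
  by apply: mx => //; exact: measurable_itv.
apply/seteqP; split => [x h i _|x h i]; first by rewrite /= in_itv/=.
by have := h i I; rewrite /= in_itv.
Qed.

Let boxesE : (measurable : set (set (borel V))) `<=` <<s boxes>>.
Proof.
have mid : measurable_fun setT (id : g_sigma_algebraType boxes -> borel V).
  apply/measurable_fun_borel_rV => i.
  apply: (measurability _ (RGenInftyO.measurableE R)) => //.
  move=> _ [_ [a ->] <-]; rewrite setTI.
  rewrite (_ : _ @^-1` _ = \bigcup_(q in [set q : 'rV[rat]_n | (ratr (q ord0 i) < a)%R])
      (box q : set (g_sigma_algebraType boxes))).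
    apply: (@bigcup_countable_measurable _ (g_sigma_algebraType boxes)).
      exact: countableP.
    by move=> q _; apply: sub_sigma_algebra; exists q.
  apply/seteqP; split => [x|x [q qa]]; rewrite /= in_itv/=; last first.
    by move=> /(_ i) /lt_trans; apply.
  move=> xa.
  (* Only coordinate [i] of the corner must stay below [a]; any rational above [x] serves for the
     others. *)
  have ex j : exists q : rat, (x ord0 j < ratr q :> R)%R /\ (j = i -> (ratr q < a :> R)%R).
    have [->|ji] := eqVneq j i.
      by have [q] := rat_in_itvoo xa; rewrite in_itv/= => /andP[xq qa]; exists q.
    have [q] := @rat_in_itvoo _ (x ord0 j) (x ord0 j + 1) ltac:(by rewrite ltrDl).
    by rewrite in_itv/= => /andP[xq qa]; exists q; split => // /eqP; rewrite (negbTE ji).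
  pose q j := sval (cid (ex j)).
  have qP j := svalP (cid (ex j)).
  exists (\row_j q j); first by rewrite /= mxE; have [_] := qP i; apply.
  by move=> j; rewrite mxE; have [] := qP j.
by move=> A mA; have := mid measurableT A mA; rewrite setTI.
Qed.

(** [disint] is obtained by choice; this is what ties it to a concrete kernel. Integrating over [A]
    shows that the two kernels agree almost everywhere on each orthant. *)
Lemma disintegration_unique (mu : probability (borel (Om * V)%type) R)
    (k l : R.-pker (borel Om) ~> (borel V)) :
  disintegrates pi mu k -> disintegrates pi mu l ->
  exists N : set (borel Om), [/\ measurable N, pi N = 0 &
    forall w, ~ N w -> forall B, measurable B -> k w B = l w B].
Proof.
have prob1 (k1 : R.-pker (borel Om) ~> (borel V)) w B : measurable B -> k1 w B <= 1.
  move=> mB; rewrite -(@prob_kernel _ _ _ _ _ k1 w); apply: le_measure; rewrite ?inE//.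
have fink (k1 : R.-pker (borel Om) ~> (borel V)) w B : measurable B -> k1 w B \is a fin_num.
  by move=> mB; rewrite ge0_fin_numE ?measure_ge0// (le_lt_trans (prob1 _ _ _ mB))// ltry.
have key (k1 l1 : R.-pker (borel Om) ~> (borel V)) : disintegrates pi mu k1 ->
    disintegrates pi mu l1 -> forall q,
    pi [set w | (fine (l1 w (box q)) < fine (k1 w (box q)))%R] = 0.
  move=> dk dl q.
  have intk (k' : R.-pker (borel Om) ~> (borel V)) :
      pi.-integrable setT (EFin \o (fun w => fine (k' w (box q)))).
    apply: (le_integrable_EFin _ _ _ (finite_measure_integrable_cst pi 1 measurableT)) => //.
      by apply: measurableT_comp => //; exact: measurable_kernel.
    move=> w _; rewrite ger0_norm ?fine_ge0//.
    by rewrite -lee_fin fineK ?fink// prob1.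
  apply: null_of_integral_le => // A mA.
  have sec (k' : R.-pker (borel Om) ~> (borel V)) : disintegrates pi mu k' ->
      \int[pi]_(w in A) (fine (k' w (box q)))%:E = mu (fst @^-1` A `&` snd @^-1` box q).
    move=> dk'; rewrite dk'; last first.
      apply: measurableI; rewrite -[_ @^-1` _]setTI.
        exact: measurable_fst_borel.
      exact: measurable_snd_borel.
    rewrite [LHS]integral_mkcond; apply: eq_integral => w _; rewrite /= patchE.
    case: ifPn => wA.
      rewrite fineK ?fink//; congr (k' w _); apply/seteqP; split => x; rewrite xsectionE/=.
        by move=> xq; split => //; exact: set_mem.
      by case.
    rewrite (_ : xsection _ w = set0) ?measure0// -subset0 => x; rewrite xsectionE/=.
    by case=> Aw; move: wA; rewrite notin_setE.
  by rewrite !sec.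
move=> dk dl.
pose Nq q := [set w | (fine (l w (box q)) < fine (k w (box q)))%R] `|`
  [set w | (fine (k w (box q)) < fine (l w (box q)))%R].
have mlt (k1 l1 : R.-pker (borel Om) ~> (borel V)) q :
    measurable [set w | (fine (l1 w (box q)) < fine (k1 w (box q)))%R].
  have mk (k' : R.-pker (borel Om) ~> (borel V)) :
      measurable_fun setT (fun w => fine (k' w (box q))).
    by apply: measurableT_comp => //; exact: measurable_kernel.
  have := @measurable_fun_ltr _ _ _ setT _ _ (mk l1) (mk k1) measurableT [set true].
  by rewrite setTI; apply.
have mNq q : measurable (Nq q) by apply: measurableU; exact: mlt.
have Nq0 q : pi.-negligible (Nq q).
  by apply: negligibleU; apply/negligibleP => //; exact: key.
pose N := \bigcup_j (if (unpickle j : option 'rV[rat]_n) is Some q then Nq q else set0).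
have mN : measurable N.
  by apply: bigcupT_measurable => j; case: unpickle => [q|] //; exact: mNq.
exists N; split => //.
  apply/negligibleP => //; apply: negligible_bigcup => j.
  case: unpickle => [q|]; first exact: Nq0.
  exact: negligible_set0.
move=> w Nw B mB.
have eqbox q : k w (box q) = l w (box q).
  rewrite -(fineK (fink k w _ (mbox q))) -(fineK (fink l w _ (mbox q))).
  congr (_%:E); apply/eqP; rewrite eq_le !leNgt; apply/andP; split; apply/negP => h;
    apply: Nw; exists (pickle q); [exact: I| |exact: I|]; rewrite pickleK; [left|right]; exact: h.
apply: (@g_sigma_algebra_measure_unique _ R (borel V) boxes _
  (fun j => box (const_mx j%:R))) => //.
- by move=> _ [q _ <-]; exact: mbox.
- by move=> j; exists (const_mx j%:R).
- rewrite -subTset => x _; exists (Num.bound `|x|) => // i; rewrite mxE ratr_nat.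
  apply: le_lt_trans (ler_norm _) _; apply: le_lt_trans (le_mx_norm _ _) _.
  exact: archi_boundP.
- move=> _ _ [q _ <-] [r _ <-]; exists (\row_i Num.min (q ord0 i) (r ord0 i)) => //.
  apply/seteqP; split => x; last first.
    by move=> [xq xr] i; rewrite mxE minEle; case: ifP.
  move=> h; split => i; have := h i; rewrite mxE => /lt_le_trans; apply;
    by rewrite ler_rat ge_min lexx ?orbT.
- by move=> _ [q _ <-]; exact: eqbox.
- by move=> j; apply: le_lt_trans (prob1 _ _ _ _) (ltry _); exact: mbox.
- exact: boxesE.
Qed.

Lemma disint_graph_law (mu : probability (borel (Om * V)%type) R) F
    (mF : measurable_fun setT (F : borel Om * TR -> borel V)) :
  (forall A, measurable A -> mu A = graph_law mF A) ->
  exists N : set (borel Om), [/\ measurable N, pi N = 0 &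
    forall w, ~ N w -> forall B, measurable B ->
      disint pi mu w B = sectional (noise R) mF w B].
Proof.
move=> muE.
have dF : disintegrates pi mu (sectional (noise R) mF).
  by move=> A mA; rewrite muE//; exact: disintegrates_graph_law.
apply: disintegration_unique => //; last exact: dF.
(* [sectional] is itself a disintegration, which rules out the default kernel. *)
rewrite /disint; case: pselect => [h|[]]; last by exists (sectional (noise R) mF).
exact: svalP.
Qed.

Lemma integral_disint (mu : probability (borel (Om * V)%type) R) F
    (mF : measurable_fun setT (F : borel Om * TR -> borel V)) (g : V -> \bar R) :
  (forall A, measurable A -> mu A = graph_law mF A) ->
  measurable_fun setT (g : borel V -> \bar R) -> (forall x, 0 <= g x) ->
  \int[pi]_w \int[disint pi mu w]_x g x = \int[prod]_z g (F z).
Proof.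
move=> muE mg g0; have [N [mN N0 NE]] := disint_graph_law muE.
rewrite (integral_off_null (g := fun w => \int[noise R]_u g (F (w, u))) mN N0); last first.
  move=> w _ Nw; rewrite (eq_measure_integral (sectional (noise R) mF w)); last first.
    by move=> B mB _; exact: NE.
  exact: ge0_integral_law.
rewrite (@fubini_tonelli1 _ _ _ _ _ pi (noise R) (g \o F))//.
  exact: measurableT_comp mg mF.
by move=> z; exact: g0.
Qed.

End disintegration.

(** * Measurability with respect to a completion *)

Lemma rational_approximation (R : realType) n (x : 'rV[R]_n) :
  exists q : nat -> 'rV[rat]_n, (fun k => map_mx ratr (q k)) @ \oo --> x.
Proof.
have ex k i : exists r : rat, `|x ord0 i - ratr r| <= k.+1%:R^-1.
  have : x ord0 i < x ord0 i + k.+1%:R^-1 by rewrite ltrDl invr_gt0.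
  move=> /rat_in_itvoo[r]; rewrite in_itv/= => /andP[h1 h2]; exists r.
  by rewrite distrC ger0_norm ?lerBlDl ?subr_ge0 ltW.
exists (fun k => \row_i sval (cid (ex k i))); apply/cvgrPdist_le => e e0.
near=> k.
have ke : (k.+1%:R)^-1 <= e.
  by near: k; have := near_infty_natSinv_lt (PosNum e0); apply: filterS => k /ltW.
apply: mx_norm_le => [|i]; first exact: ltW.
by rewrite !mxE; apply: le_trans ke; exact: svalP (cid (ex k i)).
Unshelve. all: by end_near. Qed.

Section completion.
Context d (Z : measurableType d) (R : realType) (mu : {measure set Z -> \bar R}).

(** The sets that agree with a measurable set off a null set form a sigma-algebra containing the
    generators. *)
Lemma completed_measurable_off_null (S : set Z) :
  (completed_algebra_gen mu).-sigma.-measurable S ->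
  exists A N : set Z, [/\ measurable A, measurable N, mu N = 0%E &
    forall z, ~ N z -> (S z <-> A z)].
Proof.
pose C := [set S : set Z | exists A N : set Z, [/\ measurable A, measurable N,
  mu N = 0%E & forall z, ~ N z -> (S z <-> A z)]].
suff : (completed_algebra_gen mu).-sigma.-measurable `<=` C by apply.
apply: smallest_sub => [|_ [A mA] [M [N [mN N0 MN]] <-]]; last first.
  exists A, N; split => // z Nz; split; last by left.
  by case=> // /MN.
split.
- by exists set0, set0; rewrite measure0; split => // z _; split.
- move=> A [B [N [mB mN N0 AB]]]; exists (~` B), N; split => //.
    exact: measurableC.
  by move=> z /AB[AB1 AB2]; rewrite setTD/=; split=> [h /AB2|h /AB1].
- move=> F FC; pose A k := sval (cid (FC k)); pose N k := sval (cid (svalP (cid (FC k)))).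
  have AN k := svalP (cid (svalP (cid (FC k)))).
  exists (\bigcup_k A k), (\bigcup_k N k); split.
  + by apply: bigcupT_measurable => k; case: (AN k).
  + by apply: bigcupT_measurable => k; case: (AN k).
  + apply/negligibleP; first by apply: bigcupT_measurable => k; case: (AN k).
    by apply: negligible_bigcup => k; apply/negligibleP; case: (AN k).
  + move=> z Nz; split => -[k _ h]; exists k => //; have [_ _ _ e] := AN k.
      by apply/e => // Nkz; apply: Nz; exists k.
    by apply/e => // Nkz; apply: Nz; exists k.
Qed.

Variables (n : nat) (D : set Z) (f : Z -> 'rV[R]_n -> 'rV[R]_n) (P : Z -> Prop).
Hypothesis mD : measurable D.
Hypothesis mf : forall x, measurable_fun (D : set (completed mu))
  (f^~ x : completed mu -> borel 'rV[R]_n).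
Hypothesis aeP : \forall z \ae mu, D z -> P z.
Hypothesis Pcont : forall z, P z -> continuous (f z).

Lemma measurable_off_null : exists N : set Z, [/\ measurable N, mu N = 0%E,
  forall z, D z -> ~ N z -> P z &
  forall x i, measurable_fun (D `\` N) (fun z => f z x ord0 i)].
Proof.
pose half (i : 'I_n) (q : rat) : set 'rV[R]_n := [set x | x ord0 i < ratr q].
have mhalf i q : measurable (half i q : set (borel 'rV[R]_n)).
  have := @measurable_coord R n i measurableT _ (measurable_itv `]-oo, (ratr q : R)[).
  by rewrite setTI; congr (measurable _).
have mDc : measurable (D : set (completed mu)).
  apply: sub_sigma_algebra; exists D => //; exists set0; last by rewrite setU0.
  exact: negligible_set0.
have test (r : 'rV[rat]_n * 'I_n * rat) := completed_measurable_off_null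
  (mf (map_mx ratr r.1.1) mDc (mhalf r.1.2 r.2)).
pose A r := sval (cid (test r)); pose Nr r := sval (cid (svalP (cid (test r)))).
have AN r := svalP (cid (svalP (cid (test r)))).
have [N1 [mN1 N10 PN1]] := aeP.
pose N2 := \bigcup_j (if (unpickle j : option ('rV[rat]_n * 'I_n * rat)%type) is Some r
  then Nr r else set0).
have mN2 : measurable N2.
  by apply: bigcupT_measurable => j; case: unpickle => [r|] //; case: (AN r).
have N20 : mu N2 = 0%E.
  apply/negligibleP => //; apply: negligible_bigcup => j; case: unpickle => [r|].
    by apply/negligibleP; case: (AN r).
  exact: negligible_set0.
have mN : measurable (N1 `|` N2) by exact: measurableU.
have offP z : D z -> ~ (N1 `|` N2) z -> P z.
  by move=> Dz Nz; apply: contrapT => nP; apply: Nz; left; apply: PN1 => /(_ Dz).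
have mDN : measurable (D `\` (N1 `|` N2)) by exact: measurableD.
exists (N1 `|` N2); split => //.
  by apply: null_set_setU.
have mrat (q : 'rV[rat]_n) i :
    measurable_fun (D `\` (N1 `|` N2)) (fun z => f z (map_mx ratr q) ord0 i).
  apply: (measurability _ (RGenInftyO.measurableE R)) => //.
  move=> _ [_ [a ->] <-].
  rewrite (_ : _ `&` _ = \bigcup_(r in [set r : rat | (ratr r < a)%R])
      ((D `\` (N1 `|` N2)) `&` A (q, i, r))).
    apply: bigcup_countable_measurable; first exact: countableP.
    by move=> r _; apply: measurableI => //; case: (AN (q, i, r)).
  have offN z r : (D `\` (N1 `|` N2)) z ->
      f z (map_mx ratr q) ord0 i < ratr r <-> A (q, i, r) z.
    move=> [Dz Nz]; have [_ _ _ e] := AN (q, i, r).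
    apply: (iff_trans _ (e z _)); first by split => // -[].
    move=> Nrz; apply: Nz; right; exists (pickle (q, i, r)); first exact: I.
    by rewrite pickleK.
  apply/seteqP; split => [z [zD /=]|z [r ra [zD zA]]].
    rewrite in_itv/= => za; have [r] := rat_in_itvoo za.
    rewrite in_itv/= => /andP[zr ra]; exists r => //; split => //.
    exact/offN.
  by split => //=; rewrite in_itv/=; apply: lt_trans ra; apply/offN.
move=> x i; have [q qx] := rational_approximation x.
apply: (@measurable_fun_cvg _ _ _ _ (fun k z => f z (map_mx ratr (q k)) ord0 i)) => //.
move=> z [Dz Nz].
have cf : {for x, continuous (fun y => f z y ord0 i)}.
  apply: (@continuous_comp _ _ _ (f z) (fun y : 'rV[R]_n => y ord0 i)).
    exact: (Pcont (offP z Dz Nz)).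
  exact: coord_continuous.
exact: (cvg_comp _ _ qx cf).
Qed.

End completion.

(** * The regularized vector field *)

Section euclidean_norm.
Context (R : realType) (n : nat).
Implicit Type x : 'rV[R]_n.

Lemma enorm_ge0 x : 0 <= enorm x.
Proof. exact: sqrtr_ge0. Qed.

Lemma mx_norm_le_enorm x : `|x| <= enorm x.
Proof.
apply: mx_norm_le => [|i]; first exact: enorm_ge0.
rewrite -sqrtr_sqr /enorm ler_sqrt; last first.
  by apply: sumr_ge0 => j _; rewrite -expr2 sqr_ge0.
rewrite /dotr (bigD1 i)//= expr2 lerDl.
by apply: sumr_ge0 => j _; rewrite -expr2 sqr_ge0.
Qed.

Lemma enorm_le_mx_norm x : enorm x <= n%:R * `|x|.
Proof.
rewrite -[leRHS]ger0_norm ?mulr_ge0// -sqrtr_sqr /enorm ler_sqrt ?sqr_ge0//.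
apply: (@le_trans _ _ (\sum_(i < n) `|x| ^+ 2)).
  apply: ler_sum => i _; rewrite -expr2 -real_normK ?num_real//.
  by rewrite lerXn2r ?nnegrE// le_mx_norm.
rewrite sumr_const card_ord -[leLHS]mulr_natl exprMn ler_wpM2r ?sqr_ge0//.
by rewrite -natrX ler_nat; case: (n) => // k; rewrite expnS expn1 leq_pmulr.
Qed.

Lemma measurable_enorm : measurable_fun setT (@enorm R n : borel 'rV[R]_n -> R).
Proof.
have mx i := @measurable_coord R n i.
have msqrt : measurable_fun setT (Num.sqrt : R -> R).
  exact: continuous_measurable_fun (@sqrt_continuous R).
apply: (measurableT_comp msqrt).
by apply: measurable_sum => i; exact: measurable_funM.
Qed.

End euclidean_norm.

Section regularized_field.
Context (R : realType) (Om : ptopologicalType) (n : nat).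
Variable pi : probability (borel Om) R.
Notation TR := (measurableTypeR R).
Notation V := 'rV[R]_n.

(** Turns hypotheses that hold almost everywhere for the completed measure into ones that hold at
    every point, as the construction of trajectories needs. *)
Lemma regularized_field (T : R) (v : R -> Om -> V -> V) (m : R -> R) (tau : R) :
  caratheodory pi T v -> sublinear pi T v m -> 0 <= tau ->
  (forall t, t \in `[0, T] -> 0 <= m t) ->
  exists (vt : R -> Om -> V -> V) (N : set (TR * borel Om)),
  [/\ measurable N /\ (lebesgue_measure \x pi)%E N = 0%E,
    forall x i, measurable_fun setT (fun z : TR * borel Om => vt z.1 z.2 x ord0 i),
    forall t w, continuous (vt t w),
    forall t w x, `|vt t w x| <=
      (if tau < t <= T then n.+1%:R * m t else 0) * (1 + `|x|) &
    forall t w, tau < t <= T -> ~ N (t, w) -> vt t w = v t w].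
Proof.
move=> [mv cv] sv tau0 m0.
pose D : set (TR * borel Om) := [set z | z.1 \in `[0, T]].
pose P (z : TR * borel Om) := continuous (v z.1 z.2) /\
  forall x, enorm (v z.1 z.2 x) <= m z.1 * (1 + enorm x).
have mD : measurable D.
  rewrite (_ : D = `[0, T]%classic `*` setT); first exact: measurableX.
  by apply/seteqP; split => z /=; [|case].
have aeP : \forall z \ae (lebesgue_measure \x pi)%E, D z -> P z.
  near=> z => Dz; split.
    by move: Dz; near: z; exact: cv.
  by move: Dz; near: z; exact: sv.
have [N [mN N0 PN mvN]] := measurable_off_null mD mv aeP (fun z (h : P z) => proj1 h).
(* The field is kept on [E] and set to 0 elsewhere: on [N] for regularity, and outside []tau, T]] so
   that trajectories are at rest there. *)
pose E : set (TR * borel Om) := (`]tau, T]%classic `*` setT) `\` N.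
have mE : measurable E by apply: measurableD => //; exact: measurableX.
have EDN : E `<=` D `\` N.
  move=> z [[/= + _] Nz]; rewrite in_itv/= => /andP[h1 h2]; split => //.
  by rewrite /D/= in_itv/= h2 andbT (le_trans tau0)// ltW.
exists (fun t w x => if (t, w) \in E then v t w x else 0), N; split => //.
- move=> x i; have h : measurable_fun (setT `&` E) (fun z => v z.1 z.2 x ord0 i).
    by rewrite setTI; exact: measurable_funS (measurableD mD mN) EDN (mvN x i).
  move/(measurable_restrict _ mE measurableT): h.
  apply: eq_measurable_fun => z _; rewrite patchE -surjective_pairing.
  by case: ifP => // _; rewrite [RHS]mxE.
- move=> t w; have [|_] := boolP ((t, w) \in E); last exact: cst_continuous.
  by rewrite inE => /EDN[Dz /(PN _ Dz)[]].
- move=> t w x; case: ifPn => [|tE].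
    rewrite inE => tE; have [[/= + _] _] := tE; rewrite in_itv/= => ->.
    have [Dz /(PN _ Dz)[_ /(_ x) h]] := EDN _ tE.
    apply: le_trans (mx_norm_le_enorm _) (le_trans h _).
    (* The factor [n.+1] pays for the change of norm: [1 + enorm x <= 1 + n |x| <= (n + 1) (1 +
       |x|)]. *)
    rewrite /= [n.+1%:R * _]mulrC -mulrA ler_wpM2l//; first exact: m0.
    have := enorm_le_mx_norm x; rewrite -(addn1 n) natrD; set e := enorm x; set y := `|x|.
    have : 0 <= y by exact: normr_ge0.
    have : 0 <= n%:R :> R by exact: ler0n.
    by set k := n%:R; nra.
  rewrite normr0; case: ifPn => tT; last by rewrite mul0r.
  rewrite !mulr_ge0//.
  by move: tT => /andP[h1 h2]; apply: m0; rewrite in_itv/= h2 andbT (le_trans tau0)// ltW.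
- move=> t w tT Ntw; apply/funext => x.
  by rewrite ifT// inE; split => //; split => //=; rewrite in_itv.
Unshelve. all: by end_near. Qed.

End regularized_field.

(** * Test functions along trajectories *)

Lemma near_eq_diff (R : realType) (V W : normedModType R) (f g : V -> W) (x : V) :
  (\forall y \near x, f y = g y) -> differentiable f x ->
  differentiable g x /\ 'd g x = 'd f x :> (V -> W).
Proof.
move=> fg df.
have gE : g \o shift x = cst (g x) + 'd f x +o_ (0:V) id.
  apply/eqaddoP => e e0.
  have /eqaddoP/(_ e e0) := diff_locally df.
  have := fg; rewrite (near_shift 0 x); rewrite -(nbhs_singleton fg).
  by apply: filterS2 => y /=; rewrite subr0 !fctE => ->.
have dE := diff_unique (diff_continuous df) gE.
by split => //; apply/diff_locallyP; rewrite dE; split => //; exact: diff_continuous.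
Qed.

Lemma near_eq_continuous (X Y : topologicalType) (f g : X -> Y) (x : X) :
  (\forall y \near x, f y = g y) -> {for x, continuous f} -> {for x, continuous g}.
Proof.
move=> fg cf; suff : g y @[y --> x] --> f x by rewrite (nbhs_singleton fg).
by apply: cvg_trans cf; apply: near_eq_cvg.
Qed.

Lemma continuous_pair (Z X Y : topologicalType) (f : Z -> X) (g : Z -> Y) (z : Z) :
  {for z, continuous f} -> {for z, continuous g} ->
  {for z, continuous (fun z => (f z, g z))}.
Proof. by move=> cf cg; exact: (cvg_pair cf cg). Qed.

Lemma difference_quotient_arith (R : realType) (c g D e r : R) :
  0 < c -> 0 <= r -> 0 < e ->
  `|g - c^-1 * D| <= e / (1 + r) * (c^-1 * r) -> `|D - c * g| <= e.
Proof.
move=> c0 r0 e0 H.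
have -> : D - c * g = - (c * (g - c^-1 * D)) by field; rewrite gt_eqF.
rewrite normrN normrM (gtr0_norm c0).
apply: (@le_trans _ _ (c * (e / (1 + r) * (c^-1 * r)))); first by rewrite ler_pM2l.
have -> : c * (e / (1 + r) * (c^-1 * r)) = e * (r / (1 + r)).
  by field; rewrite !gt_eqF// ltr_pwDl.
by rewrite ler_piMr ?(ltW e0)// ltW// ltr_pdivrMr ?mul1r ?ltr_pwDl// ltrDr.
Qed.

Section test_function.
Context (R : realType) (Om : ptopologicalType) (n : nat).
Notation TR := (measurableTypeR R).
Notation V := 'rV[R]_n.
Variables (a b : R) (phi : R -> Om -> V -> R).
Hypothesis tphi : test_function a b phi.

(* Since the support of a test function is compact in ]a, b[ x R^d, extending it
   by zero keeps it C^1 and makes the endpoint terms of the chain rule vanish. *)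
Definition extend (w : Om) (z : R * V) : R :=
  if a < z.1 < b then phi z.1 w z.2 else 0.

Let U : set (R * V) := [set z | z.1 \in `]a, b[].

Let oU : open U.
Proof.
rewrite (_ : U = fst @^-1` `]a, b[%classic)//.
by apply: open_comp => [z _|]; [exact: cvg_fst|exact: interval_open].
Qed.

Let extend_inside w z : U z -> \forall y \near z, phi y.1 w y.2 = extend w y.
Proof.
move=> Uz; have : nbhs z U by apply: open_nbhs_nbhs.
by apply: filterS => y; rewrite /U /= in_itv/= /extend => ->.
Qed.

(** The support is a closed subset of [U], so even a boundary point of [U] has a neighbourhood that
    misses it. *)
Let extend_outside w z : ~ U z -> \forall y \near z, cst 0 y = extend w y.
Proof.
move=> nUz; have [_ _ /(_ w)[_ cS SU] _] := tphi.
set S := closure _ in cS SU.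
have : nbhs z (~` S).
  apply: open_nbhs_nbhs; split; last by move=> /SU.
  by apply: closed_openC; exact: closed_closure.
apply: filterS => y Sy; rewrite /extend; case: ifPn => // yab.
apply/esym/eqP/negPn/negP => phi0; apply: Sy; apply: subset_closure.
by split => //=; rewrite in_itv.
Qed.

Lemma differentiable_extend w z : differentiable (extend w) z.
Proof.
have [Uz|Uz] := pselect (U z).
  have [_ _ /(_ w)[/(_ z Uz)[df _] _ _] _] := tphi.
  by have [] := near_eq_diff (extend_inside w Uz) df.
by have [] := near_eq_diff (extend_outside w Uz) (differentiable_cst 0 z).
Qed.

Lemma continuous_diff_extend w h : continuous (fun z => 'd (extend w) z h).
Proof.
move=> z; have [Uz|Uz] := pselect (U z).
  have [_ _ /(_ w)[/(_ z Uz)[_ /(_ h) cd] _ _] _] := tphi.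
  have e : \forall y \near z, 'd (fun z => phi z.1 w z.2) y h = 'd (extend w) y h.
    have : nbhs z U by apply: open_nbhs_nbhs.
    apply: filterS => y Uy.
    have [_ _ /(_ w)[/(_ y Uy)[df _] _ _] _] := tphi.
    have [_ dE] := near_eq_diff (extend_inside w Uy) df.
    exact: esym (congr1 (fun F : R * V -> R => F h) dE).
  exact: near_eq_continuous e cd.
have e : \forall y \near z, cst 0 y = 'd (extend w) y h.
  have := near_join (extend_outside w Uz); apply: filterS => y e.
  by have [_ ->] := near_eq_diff e (differentiable_cst 0 y); rewrite diff_cst.
apply: (near_eq_continuous e); exact: cst_continuous.
Qed.

Lemma extend_continuous w : continuous (extend w).
Proof. by move=> z; apply: differentiable_continuous; exact: differentiable_extend. Qed.

Lemma extend_endpoints w z : ~~ (a < z.1 < b) -> extend w z = 0.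
Proof. by rewrite /extend => /negbTE ->. Qed.

Definition extend_dt w z := 'd (extend w) z (1, 0).
Definition extend_dx i w z := 'd (extend w) z (0, delta_mx ord0 i).

Lemma diff_extendE w z s y :
  'd (extend w) z (s, y) = s * extend_dt w z + \sum_i y ord0 i * extend_dx i w z.
Proof.
have pairP (z1 z2 : R * V) : z1.1 = z2.1 -> z1.2 = z2.2 -> z1 = z2.
  by case: z1 z2 => ? ? [? ?] /= -> ->.
have -> : (s, y) = s *: ((1 : R), (0 : V)) + ((0 : R), y).
  apply: pairP; first by rewrite -[RHS]/(s * 1 + 0) mulr1 addr0.
  by rewrite -[RHS]/(s *: (0 : V) + y) scaler0 add0r.
rewrite linearD linearZ; congr (_ + _).
rewrite [in LHS](row_sum_delta y).
rewrite (big_morph (fun x : V => 'd (extend w) z (0, x)) (id1 := 0) (op1 := +%R)).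
- apply: eq_bigr => i _; rewrite -linearZ; congr ('d _ _ _).
  by apply: pairP => //; rewrite -[RHS]/(_ * 0) mulr0.
- move=> x1 x2; rewrite -linearD; congr ('d _ _ _).
  by apply: pairP => //; rewrite -[RHS]/(0 + 0 : R) addr0.
- exact: linear0.
Qed.

Lemma extend_outside_diff w z h : ~~ (a < z.1 < b) -> 'd (extend w) z h = 0.
Proof.
move=> zab; have Uz : ~ U z by rewrite /U/= in_itv/=; exact/negP.
by have [_ ->] := near_eq_diff (extend_outside w Uz) (differentiable_cst 0 z); rewrite diff_cst.
Qed.

Lemma extend_dtE w t y : a < t < b ->
  extend_dt w (t, y) = derive1 (fun s => phi s w y) t.
Proof.
move=> tab; have Uz : U (t, y) by rewrite /U/= in_itv.
rewrite /extend_dt -deriveE; last exact: differentiable_extend.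
rewrite -(near_eq_derive _ (extend_inside w Uz)) /derive /derive1.
set d := (fun _ : R => _); set d' := (fun _ : R => _).
suff -> : d = d' by []; apply/funext => h; rewrite /d /d' /=.
by rewrite scaler0 add0r [h *: (1 : R)]mulr1.
Qed.

Lemma extend_dxE i w t y : a < t < b ->
  extend_dx i w (t, y) = grad (phi t w) y ord0 i.
Proof.
move=> tab; have Uz : U (t, y) by rewrite /U/= in_itv.
rewrite /extend_dx -deriveE; last exact: differentiable_extend.
rewrite -(near_eq_derive _ (extend_inside w Uz)) mxE /derive.
set d := (fun _ : R => _); set d' := (fun _ : R => _).
suff -> : d = d' by []; apply/funext => h; rewrite /d /d' /=.
by rewrite [h *: (0 : R)]mulr0 add0r.
Qed.

Lemma extend_bounded : exists2 M : R, 0 <= M & forall w z,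
  `|extend_dt w z| <= M /\ forall i, `|extend_dx i w z| <= M.
Proof.
have [_ _ _ [M MP]] := tphi; exists `|M| => // w [t y].
have [tab|tab] := boolP (a < t < b); last first.
  by rewrite /extend_dt /extend_dx !extend_outside_diff// normr0; split => // i;
    rewrite extend_outside_diff// normr0.
have := MP t w y; rewrite in_itv/= => /(_ tab) /le_trans /(_ (ler_norm M)) h.
rewrite extend_dtE//; split.
  by apply: le_trans h; rewrite -addrA [leRHS]addrCA lerDl addr_ge0// enorm_ge0.
move=> i; rewrite extend_dxE//; apply: le_trans h.
apply: le_trans (le_mx_norm _ _) (le_trans (mx_norm_le_enorm _) _).
by rewrite lerDr addr_ge0.
Qed.

Lemma measurable_extend_fixed z : measurable_fun setT (extend ^~ z : borel Om -> R).
Proof.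
have [tab|zab] := boolP (a < z.1 < b); last first.
  rewrite (_ : extend ^~ z = cst 0); first exact: measurable_cst.
  by apply/funext => w; rewrite extend_endpoints.
rewrite /extend tab; apply: (measurability _ (RGenInftyO.measurableE R)) => //.
move=> _ [_ [r ->] <-]; rewrite setTI; apply: sub_sigma_algebra.
pose W : set (R * Om * V) := [set z | z.1.1 \in `]a, b[].
have oW : open W.
  rewrite (_ : W = (fst \o fst) @^-1` `]a, b[%classic)//.
  apply: open_comp => [u _|]; last exact: interval_open.
  by apply: continuous_comp; exact: cvg_fst.
have [cphi _ _ _] := tphi.
have WA : W `<=` [set z | z.1.1 \in `[a, b]].
  by move=> u /=; rewrite /W/= !in_itv/= => /andP[h1 h2]; rewrite !ltW.
have := continuous_subspaceW WA cphi; rewrite (continuous_open_subspace _ oW) => cW.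
apply: (open_comp (f := fun w => phi z.1 w z.2)); last exact: interval_open.
move=> w _; have : (z.1, w, z.2) \in W by rewrite inE /W/= in_itv.
move=> /cW c; apply: (continuous_comp (f := fun w => (z.1, w, z.2)) _ c).
apply: (continuous_pair (f := fun w => (z.1, w)) (g := fun=> z.2)); last exact: cst_continuous.
by apply: (continuous_pair (f := fun=> z.1) (g := id)); [exact: cst_continuous|exact: cvg_id].
Qed.

Lemma measurable_extend d (S : measurableType d) (t : S -> R) (w : S -> Om) (X : S -> V) :
  measurable_fun setT t -> measurable_fun setT (w : S -> borel Om) ->
  (forall i, measurable_fun setT (fun s => X s ord0 i)) ->
  measurable_fun setT (fun s => extend (w s) (t s, X s)).
Proof.
move=> mt mw mX.
(* Time is recast as a vector of length 1, so that the Caratheodory composition applies twice, in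
   space and in time. *)
have -> : (fun s => extend (w s) (t s, X s)) =
    (fun s => (fun (s : S) (r : 'rV[R]_1) => extend (w s) (r ord0 ord0, X s)) s (\row_i t s)).
  by apply/funext => s /=; rewrite mxE.
apply: (measurable_fun_caratheodory (f := fun (s : S) (r : 'rV[R]_1) =>
   extend (w s) (r ord0 ord0, X s)) (X := fun s => \row_i t s)) => [r|s r|i].
- apply: (measurable_fun_caratheodory (f := fun s x => extend (w s) (r ord0 ord0, x))) => //.
    by move=> x; exact: (measurableT_comp (@measurable_extend_fixed (r ord0 ord0, x)) mw).
  move=> s x; apply: (continuous_comp (f := fun x => (r ord0 ord0, x)));
    last exact: extend_continuous.
  by apply: (continuous_pair (f := fun=> r ord0 ord0) (g := id));
    [exact: cst_continuous|exact: cvg_id].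
- apply: (continuous_comp (f := fun r : 'rV[R]_1 => (r ord0 ord0, X s)));
    last exact: extend_continuous.
  by apply: (continuous_pair (f := fun r : 'rV[R]_1 => r ord0 ord0) (g := fun=> X s));
    [exact: coord_continuous|exact: cst_continuous].
- by rewrite (_ : (fun _ => _) = t)//; apply/funext => s; rewrite mxE.
Qed.

(** Presents the differential as a limit of a sequence of difference quotients, whence its
    measurability in all parameters. *)
Let difference_quotient w z h :
  (fun k => k.+1%:R * (extend w (z + k.+1%:R^-1 *: h) - extend w z)) @ \oo -->
  'd (extend w) z h.
Proof.
set f := extend w; have df : differentiable f z by exact: differentiable_extend.
have hz : (fun k => z + k.+1%:R^-1 *: h) @ \oo --> z.
  suff : (fun k => z + k.+1%:R^-1 *: h) @ \oo --> z + 0 *: h by rewrite scale0r addr0.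
  apply: cvgD; first exact: cvg_cst.
  by apply: cvgZr_tmp; exact: cvg_harmonic.
apply/cvgrPdist_le => e e0.
have e1 : 0 < e / (1 + `|h|) by rewrite divr_gt0// ltr_pwDl.
pose y k := z + k.+1%:R^-1 *: h.
have : \forall k \near \oo, `|f (y k) - f z - 'd f z (y k - z)| <=
    e / (1 + `|h|) * `|y k - z| by exact: hz _ (diff_dist_le df e1).
apply: filterS => k; rewrite /y.
have -> : z + k.+1%:R^-1 *: h - z = k.+1%:R^-1 *: h by rewrite addrAC subrr add0r.
rewrite linearZ/= normrZ [`|_^-1|]ger0_norm ?invr_ge0//.
set c := k.+1%:R; set D := 'd f z h; set g := f _ - f z => H.
have c0 : 0 < c by rewrite ltr0n.
exact: difference_quotient_arith c0 (normr_ge0 h) e0 H.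
Qed.

Let measurable_diff_extend d (S : measurableType d) (t : S -> R) (w : S -> Om) (X : S -> V) h :
  measurable_fun setT t -> measurable_fun setT (w : S -> borel Om) ->
  (forall i, measurable_fun setT (fun s => X s ord0 i)) ->
  measurable_fun setT (fun s => 'd (extend (w s)) (t s, X s) h).
Proof.
move=> mt mw mX.
apply: (@measurable_fun_cvg _ _ _ _ (fun k s => k.+1%:R *
  (extend (w s) ((t s, X s) + k.+1%:R^-1 *: h) - extend (w s) (t s, X s)))).
  move=> k; apply: measurable_funM; first exact: measurable_cst.
  apply: measurable_funB; last exact: measurable_extend.
  apply: (measurable_extend (t := fun s => t s + k.+1%:R^-1 * h.1)
    (X := fun s => X s + k.+1%:R^-1 *: h.2)) => //.
    by apply: measurable_funD => //; exact: measurable_cst.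
  move=> i; under eq_fun do rewrite rowDE.
  by apply: measurable_funD => //; exact: measurable_cst.
by move=> s _; exact: difference_quotient.
Qed.

Lemma measurable_extend_dt d (S : measurableType d) (t : S -> R) (w : S -> Om) (X : S -> V) :
  measurable_fun setT t -> measurable_fun setT (w : S -> borel Om) ->
  (forall i, measurable_fun setT (fun s => X s ord0 i)) ->
  measurable_fun setT (fun s => extend_dt (w s) (t s, X s)).
Proof. exact: measurable_diff_extend. Qed.

Lemma measurable_extend_dx i d (S : measurableType d) (t : S -> R) (w : S -> Om) (X : S -> V) :
  measurable_fun setT t -> measurable_fun setT (w : S -> borel Om) ->
  (forall i, measurable_fun setT (fun s => X s ord0 i)) ->
  measurable_fun setT (fun s => extend_dx i (w s) (t s, X s)).
Proof. exact: measurable_diff_extend. Qed.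

End test_function.

(** * Wasserstein distance of graph laws *)

Section wasserstein_bound.
Local Open Scope ereal_scope.
Context (R : realType) (Om : ptopologicalType) (n : nat).
Variable pi : probability (borel Om) R.
Hypothesis sc_Om : @second_countable Om.
Notation TR := (measurableTypeR R).
Notation V := 'rV[R]_n.
Notation prod := (pi \x noise R).
Variable p : R.
Hypothesis p_gt0 : (0 < p)%R.

Lemma poweRVK (x : \bar R) : 0 <= x -> (x `^ p^-1) `^ p = x.
Proof. by move=> x0; rewrite -poweRrM mulVf ?gt_eqF// poweRe1. Qed.

Lemma powRVK (x : R) : (0 <= x)%R -> ((x `^ p) `^ p^-1 = x)%R.
Proof. by move=> x0; rewrite -powRrM mulfV ?gt_eqF// powRr1. Qed.

Lemma measurable_enorm_powR : measurable_fun setT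
  ((fun x => (enorm x `^ p)%:E) : borel V -> \bar R).
Proof.
apply/measurable_EFinP; apply: (measurableT_comp (measurable_powR _)).
exact: measurable_enorm.
Qed.

Lemma measurable_enormB_powR : measurable_fun setT
  ((fun z => (enorm (z.1 - z.2) `^ p)%:E) : borel (V * V)%type -> \bar R).
Proof.
suff mB : measurable_fun setT ((fun z => z.1 - z.2)%R : borel (V * V)%type -> borel V).
  exact: (measurableT_comp measurable_enorm_powR mB).
apply/measurable_fun_borel_rV => i; under eq_fun do rewrite rowBE.
apply: measurable_funB.
  by have [h _] := measurable_fun_borel_rV (fst : borel (V * V)%type -> V);
    apply: h; exact: measurable_fst_borel.
by have [h _] := measurable_fun_borel_rV (snd : borel (V * V)%type -> V);
  apply: h; exact: measurable_snd_borel.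
Qed.

Variables (F G : borel Om * TR -> V).
Hypotheses (mF : measurable_fun setT (F : _ -> borel V))
  (mG : measurable_fun setT (G : _ -> borel V)).

(* The noise couples the two fibres. *)
Lemma wasserstein_sectional_le w (mu nu : set (borel V) -> \bar R) :
  (forall A, measurable A -> mu A = sectional (noise R) mF w A) ->
  (forall A, measurable A -> nu A = sectional (noise R) mG w A) ->
  wasserstein p mu nu `^ p <= \int[noise R]_u (enorm (F (w, u) - G (w, u)) `^ p)%:E.
Proof.
move=> muE nuE.
have mFG : measurable_fun setT ((fun u => (F (w, u), G (w, u))) : TR -> borel (V * V)%type).
  apply: measurable_fun_borel_pair; [exact: second_countable_rV|exact: second_countable_rV|..].
    exact: (measurableT_comp mF (pair1_measurable w)).
  exact: (measurableT_comp mG (pair1_measurable w)).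
rewrite /wasserstein poweRVK; last first.
  by apply: le_ereal_inf_tmp => _ [g _ <-]; apply: integral_ge0 => z _; rewrite lee_fin powR_ge0.
apply: ereal_inf_lbound; exists (law (noise R) mFG).
  by move=> A mA; rewrite muE// nuE.
rewrite ge0_integral_law//; first exact: measurable_enormB_powR.
by move=> z; rewrite lee_fin powR_ge0.
Qed.

(** The fibrewise distance is not known to be measurable in [w]; it is bounded off the null sets
    where [disint] differs from the explicit kernels, and the comparison of nonmeasurable integrands
    concludes. *)
Lemma W_pi_p_graph_le (mu nu : probability (borel (Om * V)%type) R) :
  (forall A, measurable A -> mu A = graph_law pi sc_Om mF A) ->
  (forall A, measurable A -> nu A = graph_law pi sc_Om mG A) ->
  W_pi_p pi p mu nu <= (\int[prod]_z (enorm (F z - G z) `^ p)%:E) `^ p^-1.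
Proof.
move=> muE nuE.
have [N1 [mN1 N10 N1E]] := disint_graph_law muE.
have [N2 [mN2 N20 N2E]] := disint_graph_law nuE.
have int0 (x : V) : 0 <= (enorm x `^ p)%:E by rewrite lee_fin powR_ge0.
rewrite /W_pi_p; apply: gt0_ler_poweR; rewrite ?invr_ge0 ?(ltW p_gt0)//.
- by rewrite in_itv/= leey andbT; apply: integral_ge0 => w _; exact: poweR_ge0.
- by rewrite in_itv/= leey andbT; apply: integral_ge0 => w _; exact: int0.
rewrite (@fubini_tonelli1 _ _ _ _ _ pi (noise R) (fun z => (enorm (F z - G z) `^ p)%:E)).
- apply: (@ge0_le_integral_off_null _ _ _ _ (N1 `|` N2)).
  + exact: measurableU.
  + exact: null_set_setU.
  + by move=> w; exact: poweR_ge0.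
  + by move=> w; apply: integral_ge0 => u _; exact: int0.
  + move=> w Nw; apply: wasserstein_sectional_le => A mA; [apply: N1E|apply: N2E] => //.
    * by move=> h; apply: Nw; left.
    * by move=> h; apply: Nw; right.
- have mFG : measurable_fun setT ((fun z => F z - G z)%R : borel Om * TR -> borel V).
    apply/measurable_fun_borel_rV => i; under eq_fun do rewrite rowBE.
    apply: measurable_funB.
      by have [h _] := measurable_fun_borel_rV F; apply: h.
    by have [h _] := measurable_fun_borel_rV G; apply: h.
  exact: (measurableT_comp measurable_enorm_powR mFG).
- by move=> z; exact: int0.
Qed.

End wasserstein_bound.

(** Since [1 + x] is at most twice the larger of 1 and [x]. *)
Lemma powR_1D (R : realType) (p x : R) : 0 <= p -> 0 <= x ->
  (1 + x) `^ p <= 2 `^ p * (1 + x `^ p).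
Proof.
move=> p0 x0; have x1 : 0 <= 1 + x by rewrite addr_ge0.
have [xle1|x_gt1] := leP x 1.
  apply: (@le_trans _ _ (2 `^ p)); first by rewrite ge0_ler_powR ?nnegrE//; lra.
  by rewrite ler_peMr ?powR_ge0// lerDl powR_ge0.
apply: (@le_trans _ _ ((2 * x) `^ p)); first by rewrite ge0_ler_powR ?nnegrE//; lra.
by rewrite powRM// ler_wpM2l ?powR_ge0// lerDr.
Qed.

(** * Laws transported by the flow *)

(** The product bound [k t * l z] gives joint integrability, so the integrals can be exchanged and
    the inner one vanishes. *)
Lemma iterated_integral_eq0 (R : realType) d (Z : measurableType d)
    (P : probability Z R) (G : measurableTypeR R * Z -> R) (k : R -> R) (l : Z -> R) :
  measurable_fun setT G -> (forall z, 0 <= l z) ->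
  (@lebesgue_measure R).-integrable setT (EFin \o k) ->
  P.-integrable setT (EFin \o l) ->
  (forall t z, `|G (t, z)| <= k t * l z) ->
  (forall z, \int[@lebesgue_measure R]_t (G (t, z))%:E = 0)%E ->
  (\int[@lebesgue_measure R]_t \int[P]_z (G (t, z))%:E = 0)%E.
Proof.
move=> mG l0 intk intl Gkl G0.
have mEG : measurable_fun setT (EFin \o G) by exact/measurable_EFinP.
pose I := (\int[P]_z (l z)%:E)%E.
have I_fin : I \is a fin_num := integrable_fin_num measurableT intl.
have I0 : (0 <= I)%E by apply/integral_ge0 => z _; rewrite lee_fin.
have ml : measurable_fun setT (EFin \o l) by have /integrableP[] := intl.
have intG : (@lebesgue_measure R \x P)%E.-integrable setT (EFin \o G).
  apply/integrable12ltyP => //.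
  have /integrableP[mk] := intk.
  rewrite -(ge0_fin_numE (integral_ge0 _ _)); last by move=> t _; exact: abse_ge0.
  move=> kfin; apply: (@le_lt_trans _ _
    (\int[@lebesgue_measure R]_t (`|(k t)%:E| * (fine I)%:E))%E); last first.
    rewrite ge0_integralZr//; last 2 first.
    - exact: measurableT_comp.
    - by rewrite lee_fin fine_ge0.
    by rewrite -(fineK kfin) -EFinM ltry.
  apply: ge0_le_integral => //.
  - by move=> t _; exact: integral_ge0.
  - have mabs : measurable_fun setT (abse \o (EFin \o G)) by exact: measurableT_comp.
    apply: (@measurable_fun_fubini_tonelli_F _ _ _ _ _ P (abse \o (EFin \o G))) => // x.
    exact: abse_ge0.
  - by apply: emeasurable_funM; [exact: measurableT_comp|exact: measurable_cst].
  - move=> t _; rewrite fineK// -ge0_integralZl//; last by move=> z _; rewrite lee_fin.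
    apply: ge0_le_integral => //.
    + by apply: measurableT_comp => //; exact: (measurableT_comp mEG (pair1_measurable t)).
    + exact: measurable_funeM.
    + move=> z _; rewrite lee_fin; apply: le_trans (Gkl t z) _.
      by rewrite ler_wpM2r// ler_norm.
rewrite (Fubini (f := EFin \o G) intG).
by apply: integral0_eq => z _; exact: G0.
Qed.

Section flow.
Context (R : realType) (Om : ptopologicalType) (n : nat).
Variable pi : probability (borel Om) R.
Hypothesis sc_Om : @second_countable Om.
Notation TR := (measurableTypeR R).
Notation V := 'rV[R]_n.
Notation prod := (pi \x noise R)%E.
Notation leb := (@lebesgue_measure R).
Variables (a b : R) (m : R -> R) (v : R -> Om -> V -> V).
Hypothesis ab : a <= b.
Hypotheses (intm : leb.-integrable setT (EFin \o m)) (m0 : forall t, 0 <= m t).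
Hypothesis msupp : forall t, ~~ (a < t <= b) -> m t = 0.
Hypothesis mv : forall x i,
  measurable_fun setT (fun z : TR * borel Om => v z.1 z.2 x ord0 i).
Hypothesis cv : forall t w, continuous (v t w).
Hypothesis vm : forall t w x, `|v t w x| <= m t * (1 + `|x|).
Let B t (z : borel Om * TR) y := v t z.1 y.
Variables (F0 : borel Om * TR -> V) (gamma : R -> borel Om * TR -> V).
Hypothesis mF0 : measurable_fun setT (F0 : _ -> borel V).
Hypothesis mgamma : jointly_measurable gamma.
Hypothesis gammaE : forall t z, gamma t z = evolve B F0 gamma t z.
Variable C : R.
Hypothesis C0 : 0 <= C.
Hypothesis gammaC : forall t z, 1 + `|gamma t z| <= C * (1 + `|F0 z|).
Let M := primitive m.

Lemma measurable_flow t : measurable_fun setT (gamma t : _ -> borel V).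
Proof.
apply/measurable_fun_borel_rV => i.
exact: (measurableT_comp (mgamma i) (pair1_measurable (t : TR))).
Qed.

Lemma measurable_field_along i :
  measurable_fun setT (fun x : TR * (borel Om * TR) => along B gamma x.2 i x.1).
Proof.
apply: (measurable_fun_caratheodory (f := fun (x : TR * (borel Om * TR)) y =>
  v x.1 x.2.1 y ord0 i) (X := fun x => gamma x.1 x.2)) => [y|x|j].
- have mp : measurable_fun setT ((fun x => (x.1, x.2.1)) :
      TR * (borel Om * TR) -> TR * borel Om).
    by apply: measurable_fun_pair => //; exact: measurableT_comp.
  exact: (measurableT_comp (mv y i) mp).
- move=> y; apply: (continuous_comp (f := v x.1 x.2.1) (g := fun y : V => y ord0 i)).
    exact: cv.
  exact: coord_continuous.
- exact: mgamma.
Qed.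

Lemma along_flow_le z i r : `|along B gamma z i r| <= C * (1 + `|F0 z|) * m r.
Proof.
apply: le_trans (le_mx_norm _ _) _; apply: le_trans (vm _ _ _) _.
by rewrite mulrC ler_wpM2r.
Qed.

Lemma integrable_along_flow z i : leb.-integrable setT (EFin \o along B gamma z i).
Proof.
have mal : measurable_fun setT (along B gamma z i : TR -> R).
  exact: (measurableT_comp (measurable_field_along i) (pair2_measurable z)).
exact: (le_integrable_EFin measurableT mal (fun r _ => along_flow_le z i r)
  (integrable_EFinZl measurableT (C * (1 + `|F0 z|)) intm)).
Qed.

Lemma flow_dist_le s t z : s <= t ->
  `|gamma t z - gamma s z| <= C * (1 + `|F0 z|) * (M t - M s).
Proof.
move=> st; apply: mx_norm_le => [|i].
  by rewrite !mulr_ge0// subr_ge0 primitive_nondecreasing.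
rewrite rowBE !gammaE /evolve !rowDE opprD addrACA subrr add0r !mxE.
have intCm := integrable_EFinZl measurableT (C * (1 + `|F0 z|)) intm.
apply: le_trans (primitive_dist_le (integrable_along_flow z i) intCm st
  (fun r _ _ => along_flow_le z i r)) _.
rewrite !primitiveB// RintegralZl//; exact: integrableS intm.
Qed.

Lemma flow_start z : gamma a z = F0 z.
Proof.
rewrite gammaE /evolve -[RHS]addr0; congr (_ + _); apply/rowP => i; rewrite !mxE.
rewrite (eq_primitive (g := fun=> 0)) ?primitive0// => r ra.
have : `|along B gamma z i r| <= 0.
  by apply: le_trans (along_flow_le z i r) _; rewrite msupp ?mulr0// negb_and -leNgt ra.
by rewrite normr_le0 => /eqP.
Qed.

Definition flow_law t := graph_law pi sc_Om (measurable_flow t).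

Lemma P_pi_flow_law t : P_pi pi (flow_law t).
Proof.
move=> A mA; rewrite /flow_law graph_lawE (_ : _ @^-1` _ = A `*` setT).
  rewrite product_measure1E// -[RHS]mule1; congr (_ * _)%E.
  exact: probability_setT (noise R).
by apply/seteqP; split => z //= [].
Qed.

(** * Moment bounds and absolute continuity of the transported laws *)

Section absolutely_continuous.
Variable p : R.
Hypothesis p_ge1 : 1 <= p.
Hypothesis F0p : (\int[prod]_z (enorm (F0 z) `^ p)%:E < +oo)%E.
(** The growth constant of the trajectories for the Euclidean norm: [C] bounds the sup norm and [n]
    converts. *)
Let K := n%:R * C.
Let J := (\int[prod]_z ((1 + enorm (F0 z)) `^ p)%:E)%E.

Let p_gt0 : 0 < p. Proof. by rewrite (lt_le_trans _ p_ge1). Qed.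

Let mF0p : measurable_fun setT (fun z => (enorm (F0 z) `^ p)%:E).
Proof. exact: (measurableT_comp (measurable_enorm_powR p) mF0). Qed.

Let m1F0p : measurable_fun setT (fun z => ((1 + enorm (F0 z)) `^ p)%:E).
Proof.
apply/measurable_EFinP; apply: (measurableT_comp (measurable_powR _)).
apply: measurable_funD; first exact: measurable_cst.
exact: (measurableT_comp (@measurable_enorm R n) mF0).
Qed.

Let J0 : (0 <= J)%E.
Proof. by apply: integral_ge0 => z _; rewrite lee_fin powR_ge0. Qed.

Let J_fin : J \is a fin_num.
Proof.
rewrite (ge0_fin_numE J0).
have mJ : measurable_fun setT (fun z => ((2 `^ p)%:E * (1 + (enorm (F0 z) `^ p)%:E))%E).
  by apply: measurable_funeM; apply: emeasurable_funD; [exact: measurable_cst|exact: mF0p].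
apply: (@le_lt_trans _ _ (\int[prod]_z ((2 `^ p)%:E * (1 + (enorm (F0 z) `^ p)%:E)))%E).
  apply: ge0_le_integral => //.
  - by move=> z _; rewrite lee_fin powR_ge0.
  - by move=> z _; rewrite -EFinD -EFinM lee_fin powR_1D ?enorm_ge0// ltW.
rewrite ge0_integralZl//.
- rewrite ge0_integralD//; last by move=> z _; rewrite lee_fin powR_ge0.
  rewrite integral_cst// lte_mul_pinfty//.
  rewrite lte_add_pinfty//.
  have prod1 : (pi \x noise R)%E setT = 1%E.
    rewrite -setXTT product_measure1E// -[RHS]mule1.
    by congr (_ * _)%E; [exact: (probability_setT pi)|exact: probability_setT (noise R)].
  by rewrite [X in (_ * X < _)%E]prod1 mul1e ltry.
- apply: emeasurable_funD; [exact: measurable_cst|exact: mF0p].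
- by move=> z _; rewrite -EFinD lee_fin addr_ge0// powR_ge0.
Qed.

Let enorm_flow_le t z : enorm (gamma t z) <= K * (1 + enorm (F0 z)).
Proof.
apply: le_trans (enorm_le_mx_norm _) _; rewrite /K -mulrA ler_wpM2l//.
apply: (@le_trans _ _ (C * (1 + `|F0 z|))).
  by apply: le_trans (gammaC t z); rewrite lerDr.
by rewrite ler_wpM2l// lerD2l mx_norm_le_enorm.
Qed.

Let enorm_flow_dist_le s t z : s <= t ->
  enorm (gamma s z - gamma t z) <= K * (M t - M s) * (1 + enorm (F0 z)).
Proof.
move=> st; apply: le_trans (enorm_le_mx_norm _) _; rewrite distrC /K -!mulrA ler_wpM2l//.
apply: le_trans (flow_dist_le z st) _; rewrite -mulrA ler_wpM2l// mulrC.
rewrite ler_wpM2l ?subr_ge0; last by rewrite lerD2l mx_norm_le_enorm.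
  by [].
exact: primitive_nondecreasing.
Qed.

Let integral_powR_le (f : borel Om * TR -> V) k :
  measurable_fun setT (f : _ -> borel V) -> 0 <= k ->
  (forall z, enorm (f z) <= k * (1 + enorm (F0 z))) ->
  (\int[prod]_z (enorm (f z) `^ p)%:E <= (k `^ p)%:E * J)%E.
Proof.
move=> mf k0 fk; rewrite -ge0_integralZl//; last 2 first.
- by move=> z _; rewrite lee_fin powR_ge0.
- by rewrite lee_fin powR_ge0.
apply: ge0_le_integral => //.
- by move=> z _; rewrite lee_fin powR_ge0.
- exact: (measurableT_comp (measurable_enorm_powR p) mf).
- exact: measurable_funeM.
- move=> z _; rewrite -EFinM lee_fin -powRM ?addr_ge0 ?enorm_ge0//.
  by rewrite ge0_ler_powR ?nnegrE ?(ltW p_gt0)// ?enorm_ge0// mulr_ge0// addr_ge0// enorm_ge0.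
Qed.

Lemma AC_flow_law : AC_curve pi p a b flow_law.
Proof.
have K0 : 0 <= K by rewrite mulr_ge0.
split=> [t _|].
  split; first exact: P_pi_flow_law.
  have lawE A : measurable A -> flow_law t A = graph_law pi sc_Om (measurable_flow t) A by [].
  have e0 (x : V) : (0 <= (enorm x `^ p)%:E)%E by rewrite lee_fin powR_ge0.
  rewrite (integral_disint lawE (measurable_enorm_powR p) e0).
  apply: le_lt_trans (integral_powR_le (measurable_flow t) K0 (enorm_flow_le t)) _.
  by rewrite -(fineK J_fin) -EFinM ltry.
pose j := fine J `^ p^-1.
have j0 : 0 <= j by exact: powR_ge0.
(* The displacement between [s] and [t] is at most [K (M t - M s) (1 + enorm (F0 z))]; taking its
   [L^p] norm leaves the factor [j], the norm of [1 + enorm (F0 z)]. *)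
exists (fun r => K * j * m r); split.
- by apply: integrable_EFinZl => //; exact: integrableS intm.
- by move=> t _; rewrite !mulr_ge0.
move=> s t _ st _.
have Mst : 0 <= M t - M s by rewrite subr_ge0; exact: primitive_nondecreasing.
apply: le_trans (W_pi_p_graph_le p_gt0 (mF := measurable_flow s) (mG := measurable_flow t)
  (fun _ _ => erefl) (fun _ _ => erefl)) _.
have mst : measurable_fun setT ((fun z => gamma s z - gamma t z) : _ -> borel V).
  apply/measurable_fun_borel_rV => i; under eq_fun do rewrite rowBE.
  apply: measurable_funB.
    by have [h _] := measurable_fun_borel_rV (gamma s); apply: h; exact: measurable_flow.
  by have [h _] := measurable_fun_borel_rV (gamma t); apply: h; exact: measurable_flow.
apply: (@le_trans _ _ ((((K * (M t - M s)) `^ p)%:E * J) `^ p^-1)%E).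
  apply: gt0_ler_poweR; rewrite ?invr_ge0 ?(ltW p_gt0)//.
  - rewrite in_itv/= leey andbT; apply: integral_ge0 => z _.
    by rewrite lee_fin powR_ge0.
  - by rewrite in_itv/= leey andbT mule_ge0// lee_fin powR_ge0.
  apply: integral_powR_le => //; first exact: mulr_ge0.
  by move=> z; exact: enorm_flow_dist_le.
rewrite poweRM ?lee_fin ?powR_ge0// poweR_EFin powRVK ?mulr_ge0//.
rewrite -(fineK J_fin) poweR_EFin -/j -EFinM.
apply: (@le_trans _ _ (\int[leb]_(r in `]s, t]) (K * j * m r)%:E)%E).
  have im : leb.-integrable `]s, t] (EFin \o m) by exact: integrableS intm.
  under eq_integral do rewrite EFinM.
  have mE : (\int[leb]_(r in `]s, t]) (m r)%:E = (M t - M s)%:E)%E.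
    by rewrite /M primitiveB// /Rintegral fineK//; exact: integrable_fin_num im.
  by rewrite integralZl// mE -EFinM lee_fin mulrAC.
apply: ge0_subset_integral => //.
- apply/measurable_EFinP; apply: measurable_funM => //.
  have /integrableP[/measurable_EFinP mm _] := intm.
  exact: measurable_funS mm.
- by move=> r _; rewrite lee_fin !mulr_ge0.
- by move=> r /=; rewrite !in_itv/= => /andP[/ltW -> ->].
Qed.

(** * Weak formulation along the trajectories *)

Section weak_form.
Variables (v0 : R -> Om -> V -> V) (N : set (TR * borel Om)).
Hypotheses (mN : measurable N) (N0 : (leb \x pi)%E N = 0%E).
Hypothesis vE : forall t w, a < t <= b -> ~ N (t, w) -> v t w = v0 t w.
Variable phi : R -> Om -> V -> R.
Hypothesis tphi : test_function a b phi.

(** The derivative in time of the extended test function along the trajectory, written with the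
    regularized field. *)
Let G (x : TR * (borel Om * TR)) : R :=
  extend_dt a b phi x.2.1 (x.1, gamma x.1 x.2) +
  \sum_i along B gamma x.2 i x.1 * extend_dx a b phi i x.2.1 (x.1, gamma x.1 x.2).

Let mG : measurable_fun setT G.
Proof.
have m21 : measurable_fun setT ((fun x => x.2.1) : TR * (borel Om * TR) -> borel Om).
  exact: measurableT_comp.
have m1 : measurable_fun setT ((fun x => x.1) : TR * (borel Om * TR) -> R).
  exact: measurable_fst.
apply: measurable_funD; first exact: (measurable_extend_dt tphi m1 m21 mgamma).
apply: measurable_sum => i; apply: measurable_funM; first exact: measurable_field_along.
exact: (measurable_extend_dx tphi i m1 m21 mgamma).
Qed.

Let G_outside t z : ~~ (a < t <= b) -> G (t, z) = 0.
Proof.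
move=> tab; have tab' : ~~ (a < t < b).
  by apply: contra tab => /andP[-> /ltW ->].
rewrite /G /extend_dt /= extend_outside_diff// add0r big1// => i _.
by rewrite /extend_dx extend_outside_diff// mulr0.
Qed.

(** Time profile of the bound on [G]: the indicator for the time derivative, and one term [C m] for
    each of the [n] space derivatives. *)
Let h (t : R) : R := \1_(`]a, b]%classic : set R) t + n%:R * C * m t.

Let integrable_h : leb.-integrable setT (EFin \o h).
Proof.
apply: integrable_EFinD => //; last exact: integrable_EFinZl.
exact: integrable_indic_itv.
Qed.

Let G_bounded : exists2 A : R, 0 <= A &
  forall t z, `|G (t, z)| <= A * h t * (1 + enorm (F0 z)).
Proof.
have [A A0 AP] := extend_bounded tphi; exists A => // t z.
have [tab|tab] := boolP (a < t <= b); last first.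
  by rewrite G_outside// normr0 !mulr_ge0// ?addr_ge0 ?enorm_ge0// !mulr_ge0.
have [dtA dxA] := AP z.1 (t, gamma t z).
have F1 : 0 <= `|F0 z| by exact: normr_ge0.
apply: le_trans (ler_normD _ _) _.
apply: (@le_trans _ _ (A + \sum_(i < n) (C * (1 + `|F0 z|) * m t) * A)).
  apply: lerD => //; apply: le_trans (ler_norm_sum _ _ _) _; apply: ler_sum => i _.
  by rewrite normrM ler_pM// along_flow_le.
rewrite sumr_const card_ord -[X in _ + X <= _]mulr_natl /h indicE mem_set /=; last first.
  by rewrite in_itv.
have := m0 t; set y := m t; set u := `|F0 z| in F1 *; set k := n%:R => y0.
apply: (@le_trans _ _ (A * (1 + k * C * y) * (1 + u))); last first.
  by rewrite ler_wpM2l ?lerD2l ?mx_norm_le_enorm// mulr_ge0// addr_ge0// !mulr_ge0.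
have -> : A * (1 + k * C * y) * (1 + u) = A + A * u + k * (C * (1 + u) * y * A) by ring.
by rewrite lerD2r lerDl mulr_ge0.
Qed.

Let integrable_1F0 : prod.-integrable setT (EFin \o (fun z => 1 + enorm (F0 z))).
Proof.
have mn : measurable_fun setT (fun z => 1 + enorm (F0 z)).
  apply: measurable_funD; first exact: measurable_cst.
  exact: (measurableT_comp (@measurable_enorm R n) mF0).
apply/integrableP; split; first exact/measurable_EFinP.
apply: (@le_lt_trans _ _ J); last by rewrite -ge0_fin_numE.
apply: ge0_le_integral => //.
- by apply: measurableT_comp => //; exact/measurable_EFinP.
(* A base at least 1 is dominated by its power [p >= 1], so the [p]-moment controls the first
   one. *)
- move=> z _; have e1 : 1 <= 1 + enorm (F0 z) by rewrite lerDl enorm_ge0.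
  rewrite /= lee_fin ger0_norm ?(le_trans ler01)//.
  by rewrite -[leLHS]powRr1 ?(le_trans ler01)// ler_powR.
Qed.

Let integrable_G1 t : prod.-integrable setT (EFin \o (fun z => G (t, z))).
Proof.
have [A A0 GA] := G_bounded.
have mGt : measurable_fun setT (fun z => G (t, z)).
  exact: (measurableT_comp mG (pair1_measurable (t : TR))).
exact: (le_integrable_EFin measurableT mGt (fun z _ => GA t z)
  (integrable_EFinZl measurableT (A * h t) integrable_1F0)).
Qed.

Let integrable_G2 z : leb.-integrable setT (EFin \o (fun t => G (t, z))).
Proof.
have [A A0 GA] := G_bounded.
have mGz : measurable_fun setT (fun t => G (t, z)).
  exact: (measurableT_comp mG (pair2_measurable z)).
apply: (le_integrable_EFin measurableT mGz (fun t _ => GA t z)).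
exact: (integrable_EFinZr measurableT _ (integrable_EFinZl measurableT A integrable_h)).
Qed.

(** The integral is the increment of the extended test function between [a] and [b], where it
    vanishes. *)
Let chain_rule z : (\int[leb]_t (G (t, z))%:E = 0)%E.
Proof.
pose Psi := extend a b phi z.1.
have cE t : F0 z + \row_i primitive (fun r => (B r z (gamma r z)) ord0 i) t = gamma t z.
  by rewrite gammaE.
have H := @chain_rule_ac R n Psi (extend_dt a b phi z.1) (fun i => extend_dx a b phi i z.1)
  (F0 z) (fun r => B r z (gamma r z)) (fun r => C * (1 + `|F0 z|) * m r)
  (fun t => G (t, z)) a b ab.
have ae : ~~ (a < (a, gamma a z).1 < b) by rewrite /= ltxx.
have be : ~~ (a < (b, gamma b z).1 < b) by rewrite /= ltxx andbF.
have {}H : primitive (fun t => G (t, z)) b - primitive (fun t => G (t, z)) a = 0.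
  rewrite H.
  - by rewrite !cE /Psi !extend_endpoints// subrr.
  - by move=> x; exact: differentiable_extend.
  - by move=> x s y; exact: diff_extendE.
  - exact: continuous_diff_extend.
  - by move=> i; exact: continuous_diff_extend.
  - exact: integrable_EFinZl.
  - by move=> i; exact: integrable_along_flow.
  - exact: integrable_G2.
  - by move=> r; apply: le_trans (vm _ _ _) _; rewrite mulrC ler_wpM2r.
  - by move=> r ar rb; rewrite cE.
have Gout : (fun t => (G (t, z))%:E) = (fun t => (G (t, z))%:E) \_ `]a, b].
  apply/funext => t; rewrite patchE; case: ifPn => //.
  by rewrite notin_setE/= in_itv/= => /negP tab; rewrite G_outside.
rewrite Gout -integral_mkcond.
move: H; rewrite (primitiveB (integrable_G2 z) ab) /Rintegral => H.
rewrite -[LHS]fineK ?H//; apply: integrable_fin_num => //.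
exact: integrableS (integrable_G2 z).
Qed.

Lemma weak_form : (\int[leb]_(t in `[a, b]) \int[flow_law t]_x
  (derive1 (fun s => phi s x.1 x.2) t +
   dotr (grad (phi t x.1) x.2) (v0 t x.1 x.2))%:E = 0)%E.
Proof.
(* Fubini for the null set [N]: almost every time section of it is [pi]-null. *)
have [N' [mN' N'0 N'P]] : exists N' : set TR, [/\ measurable N', leb N' = 0%E &
    forall t, ~ N' t -> pi (xsection N t) = 0%E].
  have mx := measurable_fun_xsection pi mN.
  have : (\int[leb]_t `|(pi \o xsection N) t| = 0)%E.
    by rewrite -[RHS]N0; apply: eq_integral => t _; rewrite gee0_abs.
  move/(ae_eq_integral_abs leb measurableT mx) => [N' [mN' N'0 N'P]].
  exists N'; split => // t Nt; apply: contrapT => ht; apply: Nt; apply: N'P => /= /(_ I).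
  exact: ht.
(* The endpoints are discarded because the partial derivatives of [phi] are identified with those of
   its extension only strictly between [a] and [b]. *)
pose N2 := N' `|` [set a] `|` [set b].
have mN2 : measurable N2 by apply: measurableU => //; exact: measurableU.
have N20 : leb N2 = 0%E.
  apply: null_set_setU; [exact: measurableU|exact: measurable_set1| |].
    by apply: null_set_setU => //; exact: lebesgue_measure_set1.
  exact: lebesgue_measure_set1.
rewrite (integral_off_null (g := fun t => (\int[prod]_z (G (t, z))%:E)%E) mN2 N20); last first.
  move=> t; rewrite /= in_itv/= => /andP[ta tb] Nt.
  have tab : a < t < b.
    rewrite !lt_neqAle ta tb !andbT; apply/andP; split; apply/eqP => e; apply: Nt.
      by left; right.
    by right.
  have tab' : a < t <= b by have /andP[-> /ltW ->] := tab.
  have N't : pi (xsection N t) = 0%E by apply: N'P => h'; apply: Nt; left; left.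
  (* A Borel substitute for the weak integrand, with [v] in place of [v0]. The two differ only over
     the section of [N], which is null for [flow_law t] because its first marginal is [pi]. *)
  pose I (x : borel (Om * V)%type) : R := extend_dt a b phi x.1 (t, x.2) +
    \sum_i v t x.1 x.2 ord0 i * extend_dx a b phi i x.1 (t, x.2).
  have ms i : measurable_fun setT (fun x : borel (Om * V)%type => x.2 ord0 i).
    by have [H _] := measurable_fun_borel_rV (snd : borel (Om * V)%type -> V);
      apply: H; exact: measurable_snd_borel.
  have mt : measurable_fun setT ((fun=> t) : borel (Om * V)%type -> R) by exact: measurable_cst.
  have mf := @measurable_fst_borel Om V.
  have mI : measurable_fun setT I.
    apply: measurable_funD; first exact: (measurable_extend_dt tphi mt mf ms).
    apply: measurable_sum => i; apply: measurable_funM; last first.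
      exact: (measurable_extend_dx tphi i mt mf ms).
    apply: (measurable_fun_caratheodory (f := fun (x : borel (Om * V)%type) y =>
      v t x.1 y ord0 i) (X := snd)) => // [y|x].
      have mtf : measurable_fun setT ((fun x => (t, x.1)) : borel (Om * V)%type -> TR * borel Om).
        exact: measurable_fun_pair.
      exact: (measurableT_comp (mv y i) mtf).
    move=> y; apply: (continuous_comp (f := v t x.1) (g := fun y : V => y ord0 i)).
      exact: cv.
    exact: coord_continuous.
  have mNt : measurable (fst @^-1` xsection N t : set (borel (Om * V)%type)).
    by rewrite -[_ @^-1` _]setTI; apply: mf => //; exact: measurable_xsection.
  rewrite (integral_off_null (N := (fst @^-1` xsection N t : set (borel (Om * V)%type)))
    (g := fun x : borel (Om * V)%type => (I x)%:E) mNt).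
  - rewrite /flow_law /graph_law integral_law//.
    + exact/measurable_EFinP.
    + exact: integrable_G1.
  - by rewrite -N't; apply: P_pi_flow_law; exact: measurable_xsection.
  - move=> x _ Nx; congr (_%:E); rewrite /I extend_dtE//; congr (_ + _).
    rewrite /dotr; apply: eq_bigr => i _; rewrite extend_dxE// mulrC vE//.
    by move=> h'; apply: Nx; rewrite /= xsectionE.
have Gout : (fun t => \int[prod]_z (G (t, z))%:E)%E =
    (fun t => \int[prod]_z (G (t, z))%:E)%E \_ `[a, b].
  apply/funext => t; rewrite patchE; case: ifPn => //.
  rewrite notin_setE/= in_itv/= => tab; apply: integral0_eq => z _; rewrite G_outside//.
  by apply/negP => /andP[h1 h2]; apply: tab; rewrite (ltW h1) h2.
rewrite integral_mkcond -Gout.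
have [A A0 GA] := G_bounded.
apply: (iterated_integral_eq0 mG _ (integrable_EFinZl measurableT A integrable_h)
  integrable_1F0 GA chain_rule).
by move=> z; rewrite addr_ge0// enorm_ge0.
Qed.

End weak_form.

End absolutely_continuous.

End flow.

Theorem theorem4p9 (R : realType) (Om : ptopologicalType)
  (polish_Om : polish R Om) (pi : probability (borel Om) R)
  (d : nat) (T : R) (T_gt0 : 0 < T) (p : R) (p_ge1 : 1 <= p)
  (v : R -> Om -> 'rV[R]_d -> 'rV[R]_d) (v_car : caratheodory pi T v)
  (m : R -> R)
  (m_int : lebesgue_measure.-integrable `[0, T] (EFin \o m))
  (m_ge0 : forall t, t \in `[0, T] -> 0 <= m t)
  (v_sub : sublinear pi T v m)
  (tau : R) (tau_in : tau \in `[0, T])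
  (mu0 : probability (borel (Om * 'rV[R]_d)%type) R)
  (mu0_in : P_pi_p pi p mu0) :
  exists mu : R -> probability (borel (Om * 'rV[R]_d)%type) R,
    AC_curve pi p tau T mu /\ forward_solution tau T v mu0 mu.
Proof.
have sc_Om := polish_second_countable polish_Om.
have [mu0_pi mu0_p] := mu0_in.
have [F0 [mF0 mu0E]] := randomization sc_Om mu0_pi.
have /andP[tau0 tauT] : 0 <= tau <= T by move: tau_in; rewrite in_itv.
have [w [N [[mN N0] mw cw wm wE]]] := regularized_field v_car v_sub tau0 m_ge0.
(* The dominating function of the regularized field; the cut-off makes it nonnegative and integrable
   on the whole line, [m] being controlled only on [[0, T]]. *)
pose k t := if tau < t <= T then d.+1%:R * m t else 0.
have sub_itv : `]tau, T]%classic `<=` (`[0, T]%classic : set R).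
  by move=> t /=; rewrite !in_itv/= => /andP[/ltW/(le_trans tau0) -> ->].
have k0 t : 0 <= k t.
  rewrite /k; case: ifP => // tT; rewrite mulr_ge0// m_ge0//.
  by apply: sub_itv; rewrite /= in_itv.
have intk : lebesgue_measure.-integrable setT (EFin \o k).
  have mI : measurable (`]tau, T]%classic : set (measurableTypeR R)).
    exact: measurable_itv.
  have intm : lebesgue_measure.-integrable `]tau, T]%classic (EFin \o m).
    by apply: integrableS m_int => //; exact: measurable_itv.
  have := integrable_EFinZl mI d.+1%:R intm; rewrite integrable_mkcond//.
  congr (_.-integrable _ _); apply/funext => t.
  by rewrite patchE mem_setE in_itv/= /k; case: ifP.
have supp_k t : ~~ (tau < t <= T) -> k t = 0 by rewrite /k => /negbTE ->.
have mw2 x i : measurable_fun setT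
    (fun q : measurableTypeR R * (borel Om * measurableTypeR R) => w q.1 q.2.1 x ord0 i).
  have mq : measurable_fun setT ((fun q => (q.1, q.2.1)) :
      measurableTypeR R * (borel Om * measurableTypeR R) -> measurableTypeR R * borel Om).
    by apply: measurable_fun_pair => //; exact: measurableT_comp.
  exact: (measurableT_comp (mw x i) mq).
have mF0i i : measurable_fun setT (fun z => F0 z ord0 i).
  by have [h _] := measurable_fun_borel_rV F0; exact: h.
have [gamma [mgamma gammaE gammaC]] := measurable_caratheodory_flow
  (B := fun t (z : borel Om * measurableTypeR R) => w t z.1) tauT intk k0 supp_k
  mw2 (fun t z => cw t z.1) (fun t z => wm t z.1) mF0i.
have F0p : (\int[pi \x noise R]_z (enorm (F0 z) `^ p)%:E < +oo)%E.
  have e0 (x : 'rV[R]_d) : (0 <= (enorm x `^ p)%:E)%E by rewrite lee_fin powR_ge0.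
  by rewrite -(integral_disint mu0E (measurable_enorm_powR p) e0).
have C0 : 0 <= expR (primitive k T) by exact: expR_ge0.
exists (flow_law pi sc_Om mgamma); split.
  exact: (AC_flow_law sc_Om tau T intk k0 mw cw wm mF0 mgamma gammaE C0 gammaC p_ge1 F0p).
split=> [A mA|phi tphi]; last first.
  exact: (weak_form sc_Om tauT intk k0 mw cw wm mF0 mgamma gammaE C0 gammaC p_ge1 F0p
    mN N0 wE tphi).
rewrite (mu0E _ mA) /flow_law !graph_lawE; congr ((pi \x noise R)%E (_ @^-1` A)).
by apply/funext => z; rewrite (flow_start k0 supp_k wm gammaE gammaC).
Qed.
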